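(* The formula $$\langle\varphi,\psi\rangle=\int_P\varphi^*\,\star_P[\psi]$$ defines a $\Sigma$-valued scalar product in $\mathrm{hor}_{P,\Sigma}$. This scalar product is $G$-covariant, and in terms of the natural left $\mathcal B$-module identification $\mathrm{hor}_{P,\Sigma}\leftrightarrow\mathcal B\otimes\mathbb V_\Sigma^\wedge$ it is given by the direct product of the natural scalar products in $\mathbb V_\Sigma^\wedge$ and $\mathcal B$, i.e. $\langle b\otimes\vartheta,q\otimes\eta\rangle=\omega_P(b^*q)\,\langle\vartheta,\eta\rangle_\wedge$ for $b,q\in\mathcal B$, $\vartheta,\eta\in\mathbb V_\Sigma^\wedge$.
   Context: **Group and bundle.** $G$ is a compact matrix quantum group with Hopf $*$-algebra $\mathcal A$ of polynomial functions (coproduct $\phi(a)=a^{(1)}\otimes a^{(2)}$, counit $\epsilon$, antipode $\kappa$, Haar state $h$). $P=(\mathcal B,i,F)$ is a quantum principal $G$-bundle over a quantum space $M$ represented by a unital $*$-algebra $\mathcal V$: $\mathcal B$ is a unital $*$-algebra, $i:\mathcal V\to\mathcal B$ an injective unital $*$-homomorphism (treated as inclusion), $F:\mathcal B\to\mathcal B\otimes\mathcal A$ a unital $*$-homomorphism with $(\mathrm{id}\otimes\phi)F=(F\otimes\mathrm{id})F$, $(\mathrm{id}\otimes\epsilon)F=\mathrm{id}$, $\mathcal V=\{b: F(b)=b\otimes1\}$, and $q\otimes b\mapsto qF(b)$ maps $\mathcal B\otimes_{\mathcal V}\mathcal B$ onto $\mathcal B\otimes\mathcal A$. Write $F(b)=\sum_kb_k\otimes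 c_k$. $\mathcal V$ is a dense $*$-subalgebra of a unital C*-algebra with a faithful state $\omega_M$; $\int_\uparrow=(\mathrm{id}\otimes h)F:\mathcal B\to\mathcal V$ is strictly positive ($\int_\uparrow(b^*b)\ge0$, zero only for $b=0$); $\omega_P=\omega_M\circ\int_\uparrow$; the scalar product in $\mathcal B$ is $\langle b,q\rangle=\omega_P(b^*q)$. **Coordinate space.** $\mathbb V$ is a finite-dimensional complex vector space (the left-invariant part of a $*$-covariant bicovariant $\mathcal A$-bimodule) with an antilinear involution $*$, a right $\mathcal A$-module structure $\circ$ and a right coaction $\varkappa:\mathbb V\to\mathbb V\otimes\mathcal A$ such that $\varkappa*=( *\otimes* )\varkappa$, $(\theta\circ a)^*=\theta^*\circ\kappa(a)^*$, $\varkappa(\theta\circ a)=\sum_k(\theta_k\circ a^{(2)})\otimes\kappa(a^{(1)})c_ka^{(3)}$ if $\varkappa(\theta)=\sum_k\theta_k\otimes c_k$. $\tau(\eta\otimes\vartheta)=\sum_k\vartheta_k\otimes(\eta\circ c_k)$ is the associated braid operator; $\theta_1,\dots,\theta_d$ is a basis of $\mathbb V$. **Quantum metric.** $\sigma:\mathbb V\otimes\mathbb V\to\mathbb V\otimes\mathbb V$ is an invertible braid operator with $*\sigma=\sigma*$ (where $(x_1\otimes\dots\otimes x_n)^*=x_n^*\otimes\dots\otimes x_1^*$), compatible with $\circ$ and $\varkappa$. $\Sigma$ is a unital $*$-algebra and $g:\mathbb V\otimes\mathbb V\to\Sigma$ is linear with: $g\sigma=g$; $g(x,y)^*=g(y^*,x^*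 )$; with $g\cdot g:x\otimes y\otimes z\otimes t\mapsto g(x,y)g(z,t)$, $g\cdot g=(g\cdot g)(\mathrm{id}\otimes\sigma\otimes\mathrm{id})(\sigma^{\mp1}\otimes\sigma^{\pm1})(\mathrm{id}\otimes\sigma^{-1}\otimes\mathrm{id})$; the matrix $(g(\theta_i,\theta_j))$ is invertible over $\Sigma$ and $\Sigma$ is generated by its entries and those of its inverse; there is a twisting $\nu_\Sigma:\mathbb V\otimes\Sigma\to\Sigma\otimes\mathbb V$, coming from a unital homomorphism $\Sigma\to M_d(\Sigma)$, with $\nu_\Sigma(\mathrm{id}\otimes g)=(g\otimes\mathrm{id})(\mathrm{id}\otimes\sigma)(\sigma^{-1}\otimes\mathrm{id})$. Then $\mathbb V_\Sigma=\Sigma\otimes\mathbb V$ is a $\Sigma$-bimodule with $\theta q=\nu_\Sigma(\theta\otimes q)$ and $*$-structure $(q\theta)^*=\theta^*q^*$; $\sigma,g$ extend $\Sigma$-bilinearly to $\mathbb V_\Sigma\otimes_\Sigma\mathbb V_\Sigma$. $\Sigma$ is realized by (possibly unbounded) operators on a common dense domain $H_0\subseteq l^2(\mathbb Z)$, $*$ being the formal adjoint, with cyclic and separating vectors in $H_0$, and $g(\xi^*,\xi)>0$ for $0\ne\xi\in\mathbb V_\Sigma$. $\Sigma$ carries a right $\mathcal A$-module structure and a $*$-homomorphic coaction $\varkappa_\Sigma$ determined by $g(x,y)\circ a=g(x\circ a^{(1)},y\circ a^{(2)})$, $\varkappa_\Sigma g(x,y)=(g\otimes\mathrm{id})\varkappa(x\otimes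 y)$. **Exterior algebra and Hodge operator.** $A^n_\sigma=\sum_{\pi\in S_n}(-1)^{\ell(\pi)}\sigma_\pi$, assumed positive for $g(\psi^*,\xi)$ (with $g((\psi\otimes x)\otimes(y\otimes\xi))=g(\psi,g(x,y)\xi)$), with $\mathrm{im}(A^n_\sigma)$ the space of $\tau$-antisymmetric $n$-tensors. $\mathbb V^\wedge=\mathbb V^\otimes/\ker A_\sigma$, $\mathbb V_\Sigma^\wedge=\mathbb V_\Sigma^\otimes/\ker A_\sigma\leftrightarrow\Sigma\otimes\mathbb V^\wedge$, with $\circ,\varkappa$ extended multiplicatively and $*$ antimultiplicatively. $g_\wedge(\psi,\xi)=g(\psi,A_\sigma\xi)$ and $\langle\vartheta,\eta\rangle_\wedge=g_\wedge(\vartheta^*,\eta)$. There is $m\in\mathbb N$ with $\mathbb V^{\wedge m}=\mathbb Cw\cong\mathbb C$, $\mathbb V^{\wedge k}=0$ for $k>m$; $\varkappa(w)=w\otimes1$ and $w\circ a=\lambda(a)w$ with $\lambda:\mathcal A\to\mathbb C$ a central unital multiplicative functional. $wq=S(q)w$ defines an automorphism $S$ of $\Sigma$; $j(x,y)w$ is the degree-$m$ component of $x\wedge y$ for $x,y\in\mathbb V^\wedge_\Sigma$; $\star:\mathbb V_\Sigma^\wedge\to\mathbb V_\Sigma^\wedge$ is the unique linear operator with $\star(\mathbb V_\Sigma^{\wedge k})\subseteq\mathbb V_\Sigma^{\wedge m-k}$ and $g_\wedge(x,y)=j(x,\star[y])$. **Horizontal forms.** $\mathrm{hor}_{P,\Sigma}=\mathcal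 B\otimes\mathbb V_\Sigma^\wedge$ with $(q\otimes\vartheta)(b\otimes\eta)=\sum_kqb_k\otimes(\vartheta\circ c_k)\eta$ and $(b\otimes\vartheta)^*=\sum_kb_k^*\otimes(\vartheta^*\circ c_k^* )$, where in the formula for the scalar product $\vartheta^*$ is the antimultiplicative (ungraded) $*$ of $\mathbb V_\Sigma^\wedge$. $F^\wedge$ is the product coaction of $F$ and $\varkappa$ on $\mathrm{hor}_{P,\Sigma}$. $\star_P(b\otimes\vartheta)=b\otimes\star(\vartheta)$. $\int_P:\mathrm{hor}_{P,\Sigma}\to\Sigma$ is the left $\Sigma$-linear map with $\int_P(b\otimes qw)=\omega_P(b)q$ for $q\in\Sigma$, and $\int_P(b\otimes\vartheta)=0$ if $\deg\vartheta<m$. A $\Sigma$-valued scalar product is a map satisfying $\langle\varphi,\psi q\rangle=\langle\varphi,\psi\rangle q$, $\langle\varphi q,\psi\rangle=q^*\langle\varphi,\psi\rangle$, $\langle q\varphi,\psi\rangle=\langle\varphi,q^*\psi\rangle$, $\langle\varphi,\psi\rangle^*=\langle\psi,\varphi\rangle$, additive in each variable, and strictly positive. $G$-covariance means $\sum_{kl}\langle\varphi_k,\psi_l\rangle\otimes c_k^*d_l=\varkappa_\Sigma(\langle\varphi,\psi\rangle)$ where $F^\wedge(\varphi)=\sum_k\varphi_k\otimes c_k$, $F^\wedge(\psi)=\sum_l\psi_l\otimes d_l$. *)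

(* Defs.v *)
From HB Require Import structures.
From mathcomp Require Import all_boot all_order all_fingroup all_algebra generic_quotient.
From mathcomp Require Import boolp classical_sets functions reals topology normedtype sequences.
From mathcomp Require Import complex.
Set Implicit Arguments. Unset Strict Implicit. Unset Printing Implicit Defensive.
Import Order.TTheory GRing.Theory Num.Theory.
Import numFieldNormedType.Exports.
Local Open Scope ring_scope.
Local Open Scope quotient_scope.

Reserved Notation "u ⊗ v" (at level 40, left associativity).

Section Tensor.
Variable (K : comNzRingType).

Definition balanced (U V : lmodType K) (Z : zmodType) (f : U -> V -> Z) : Prop :=
  [/\ forall u u' v, f (u + u') v = f u v + f u' v,
      forall u v v', f u (v + v') = f u v + f u v'
    & forall c u v, f (c *: u) v = f u (c *: v)].

Definition fsum (U V : lmodType K) (Z : zmodType) (f : U -> V -> Z)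
  (s : seq (U * V)) : Z := \sum_(p <- s) f p.1 p.2.

(* Two formal sums of pairs define the same tensor iff no balanced map
   separates them; this is the kernel of the projection of the free abelian
   group on U * V onto U ⊗ V. *)
Definition same_tensor (U V : lmodType K) (s t : seq (U * V)) : Prop :=
  forall (Z : zmodType) (f : U -> V -> Z), balanced f -> fsum f s = fsum f t.

Section TensorType.
Variables (U V : lmodType K).

Definition same_tensorb : rel (seq (U * V)) := fun s t => `[< same_tensor s t >].

Fact same_tensorb_refl : reflexive same_tensorb.
Proof. by move=> s; apply/asboolP. Qed.

Fact same_tensorb_sym : symmetric same_tensorb.
Proof.
by move=> s t; apply/idP/idP => /asboolP st; apply/asboolP => Z f fb; rewrite st.
Qed.

Fact same_tensorb_trans : transitive same_tensorb.
Proof.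
move=> t s r /asboolP st /asboolP tr; apply/asboolP => Z f fb.
by rewrite st // tr.
Qed.

Canonical same_tensor_equiv :=
  EquivRel same_tensorb same_tensorb_refl same_tensorb_sym same_tensorb_trans.

Definition tens : Type := {eq_quot same_tensor_equiv}.
HB.instance Definition _ := Choice.on tens.

Definition tsum (s : seq (U * V)) : tens := \pi_({eq_quot same_tensor_equiv}) s.
Definition tpure (u : U) (v : V) : tens := tsum [:: (u, v)].
Definition tseq (x : tens) : seq (U * V) := repr (x : {eq_quot same_tensor_equiv}).

Lemma tseqK x : tsum (tseq x) = x. Proof. exact: reprK. Qed.

(* Meaningful for balanced f only: see tlift_tsum. *)
Definition tlift (Z : zmodType) (f : U -> V -> Z) (x : tens) : Z := fsum f (tseq x).

Lemma tsum_eq s t : same_tensor s t -> tsum s = tsum t.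
Proof. by move=> st; apply/eqquotP/asboolP. Qed.

Lemma tlift_tsum (Z : zmodType) (f : U -> V -> Z) s :
  balanced f -> tlift f (tsum s) = fsum f s.
Proof.
move=> fb; rewrite /tlift.
have /asboolP : same_tensorb (tseq (tsum s)) s.
  by apply/(@eqquotP _ same_tensor_equiv {eq_quot same_tensor_equiv}); rewrite /tsum /tseq reprK.
exact.
Qed.

Lemma tens_eq (x y : tens) :
  (forall (Z : zmodType) (f : U -> V -> Z), balanced f -> tlift f x = tlift f y) ->
  x = y.
Proof. by move=> xy; rewrite -(tseqK x) -(tseqK y); apply: tsum_eq => Z f /xy. Qed.

Lemma eq_tlift (Z : zmodType) (f g : U -> V -> Z) x :
  (forall u v, f u v = g u v) -> tlift f x = tlift g x.
Proof. by move=> fg; apply: eq_bigr => p _; apply: fg. Qed.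

Lemma tlift_addf (Z : zmodType) (f g : U -> V -> Z) x :
  tlift (fun u v => f u v + g u v) x = tlift f x + tlift g x.
Proof. by rewrite /tlift /fsum big_split. Qed.

Definition tzero : tens := tsum [::].
Definition tadd (x y : tens) : tens := tsum (tseq x ++ tseq y).
Definition topp (x : tens) : tens := tsum [seq (- p.1, p.2) | p <- tseq x].
Definition tscale (c : K) (x : tens) : tens := tsum [seq (c *: p.1, p.2) | p <- tseq x].

Lemma balancedN (Z : zmodType) (f : U -> V -> Z) u v :
  balanced f -> f (- u) v = - f u v.
Proof.
case=> fl _ _; have f0 : f 0 v = 0 by apply: (addrI (f 0 v)); rewrite -fl !addr0.
by apply: (addrI (f u v)); rewrite -fl !subrr.
Qed.

Lemma balancedZ (Z : zmodType) (f : U -> V -> Z) c :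
  balanced f -> balanced (fun u v => f (c *: u) v).
Proof.
case=> fl fr fz; split=> [u u' v|u v v'|d u v]; first by rewrite scalerDr fl.
  by rewrite fr.
by rewrite scalerA mulrC -scalerA fz.
Qed.

Lemma tlift0_ (Z : zmodType) (f : U -> V -> Z) : balanced f -> tlift f tzero = 0.
Proof. by move=> fb; rewrite tlift_tsum // /fsum big_nil. Qed.

Lemma tliftD_ (Z : zmodType) (f : U -> V -> Z) x y :
  balanced f -> tlift f (tadd x y) = tlift f x + tlift f y.
Proof. by move=> fb; rewrite tlift_tsum // /fsum big_cat. Qed.

Lemma tliftN_ (Z : zmodType) (f : U -> V -> Z) x :
  balanced f -> tlift f (topp x) = - tlift f x.
Proof.
move=> fb; rewrite tlift_tsum // /tlift /fsum big_map -sumrN.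
by apply: eq_bigr => p _; rewrite balancedN.
Qed.

Lemma tliftZ_ (Z : zmodType) (f : U -> V -> Z) c x :
  balanced f -> tlift f (tscale c x) = tlift (fun u v => f (c *: u) v) x.
Proof. by move=> fb; rewrite tlift_tsum // /fsum big_map. Qed.

Fact taddA : associative tadd.
Proof. by move=> x y z; apply: tens_eq => Z f fb; rewrite !tliftD_ // addrA. Qed.
Fact taddC : commutative tadd.
Proof. by move=> x y; apply: tens_eq => Z f fb; rewrite !tliftD_ // addrC. Qed.
Fact tadd0 : left_id tzero tadd.
Proof. by move=> x; apply: tens_eq => Z f fb; rewrite !tliftD_ // tlift0_ ?add0r. Qed.
Fact taddN : left_inverse tzero topp tadd.
Proof.
by move=> x; apply: tens_eq => Z f fb; rewrite !tliftD_ // tliftN_ // tlift0_ ?addNr.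
Qed.
HB.instance Definition _ := GRing.isZmodule.Build tens taddA taddC tadd0 taddN.

Lemma tlift0 (Z : zmodType) (f : U -> V -> Z) : balanced f -> tlift f 0 = 0.
Proof. exact: tlift0_. Qed.
Lemma tliftD (Z : zmodType) (f : U -> V -> Z) x y :
  balanced f -> tlift f (x + y) = tlift f x + tlift f y.
Proof. exact: tliftD_. Qed.

Fact tscaleA a b v : tscale a (tscale b v) = tscale (a * b) v.
Proof.
apply: tens_eq => Z f fb; rewrite !tliftZ_ //; last exact: balancedZ.
by apply: eq_bigr => p _; rewrite scalerA mulrC.
Qed.
Fact tscale1 : left_id 1 tscale.
Proof.
move=> x; apply: tens_eq => Z f fb; rewrite tliftZ_ //.
by apply: eq_bigr => p _; rewrite scale1r.
Qed.
Fact tscaleDr : right_distributive tscale +%R.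
Proof.
move=> c x y; apply: tens_eq => Z f fb.
by rewrite tliftZ_ // !tliftD ?tliftZ_ //; apply: balancedZ.
Qed.
Fact tscaleDl v : {morph tscale^~ v : a b / a + b}.
Proof.
move=> a b; apply: tens_eq => Z f fb; rewrite tliftD // !tliftZ_ //.
rewrite /tlift /fsum -big_split; apply: eq_bigr => p _ /=.
by rewrite scalerDl; case: fb => ->.
Qed.
HB.instance Definition _ :=
  GRing.Zmodule_isLmodule.Build K tens tscaleA tscale1 tscaleDr tscaleDl.

Lemma tliftZ (Z : zmodType) (f : U -> V -> Z) c x :
  balanced f -> tlift f (c *: x) = tlift (fun u v => f (c *: u) v) x.
Proof. exact: tliftZ_. Qed.

Lemma tlift_pure (Z : zmodType) (f : U -> V -> Z) u v :
  balanced f -> tlift f (tpure u v) = f u v.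
Proof. by move=> fb; rewrite tlift_tsum // /fsum big_seq1. Qed.

Lemma tpure_balanced : balanced tpure.
Proof.
split=> [u u' v|u v v'|c u v]; apply: tens_eq => Z f fb;
  rewrite ?tliftD // !tlift_pure //; by case: fb.
Qed.

Lemma tpureZ c u v : tpure (c *: u) v = c *: tpure u v.
Proof. by apply: tens_eq => Z f fb; rewrite tliftZ // !tlift_pure //; apply: balancedZ. Qed.

Lemma tsumE s : tsum s = \sum_(p <- s) tpure p.1 p.2.
Proof.
apply: tens_eq => Z f fb; rewrite tlift_tsum //.
elim: s => [|p s ih]; first by rewrite !big_nil tlift0 // /fsum big_nil.
by rewrite big_cons tliftD // -ih /fsum big_cons tlift_pure.
Qed.

Lemma tens_ind (P : tens -> Prop) :
  P 0 -> (forall x y, P x -> P y -> P (x + y)) -> (forall u v, P (tpure u v)) ->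
  forall x, P x.
Proof. by move=> P0 PD Pp x; rewrite -(tseqK x) tsumE; apply: big_ind. Qed.

End TensorType.
End Tensor.

Notation "u ⊗ v" := (tpure u v) : ring_scope.

Section TensorMaps.
Variable (K : comNzRingType).

Definition tmap (U V U' V' : lmodType K) (f : U -> U') (g : V -> V') :
  tens U V -> tens U' V' := tlift (fun u v => f u ⊗ g v).

Definition tassoc (U V W : lmodType K) : tens (tens U V) W -> tens U (tens V W) :=
  tlift (fun x w => tlift (fun u v => u ⊗ (v ⊗ w)) x).

Definition tassocV (U V W : lmodType K) : tens U (tens V W) -> tens (tens U V) W :=
  tlift (fun u y => tlift (fun v w => (u ⊗ v) ⊗ w) y).

End TensorMaps.

Section TensorAlgebra.
Variables (K : comNzRingType) (A B : algType K).

Definition tmul (x y : tens A B) : tens A B :=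
  tlift (fun a b => tlift (fun a' b' => (a * a') ⊗ (b * b')) y) x.

Lemma tmul_inner a b : balanced (fun a' b' => (a * a') ⊗ (b * b') : tens A B).
Proof.
have [tl tr tz] := tpure_balanced A B.
split=> [u u' v|u v v'|c u v]; rewrite ?mulrDr ?tl ?tr //.
by rewrite -!scalerAr tz.
Qed.

Lemma tmul_outer (y : tens A B) :
  balanced (fun a b => tlift (fun a' b' => (a * a') ⊗ (b * b') : tens A B) y).
Proof.
have [tl tr tz] := tpure_balanced A B.
split=> [u u' v|u v v'|c u v].
- by rewrite /tlift /fsum -big_split; apply: eq_bigr => p _; rewrite mulrDl tl.
- by rewrite /tlift /fsum -big_split; apply: eq_bigr => p _; rewrite mulrDl tr.
- by apply: eq_bigr => p _; rewrite -!scalerAl tz.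
Qed.

Lemma tmul_pure a b a' b' : tmul (a ⊗ b) (a' ⊗ b') = (a * a') ⊗ (b * b').
Proof. by rewrite /tmul tlift_pure ?tlift_pure //; [exact: tmul_inner|exact: tmul_outer]. Qed.

Fact tmulDl : left_distributive tmul +%R.
Proof. by move=> x y z; rewrite /tmul tliftD //; apply: tmul_outer. Qed.

Fact tmulDr : right_distributive tmul +%R.
Proof.
move=> x y z; rewrite /tmul -tlift_addf; apply: eq_tlift => a b.
by rewrite tliftD //; apply: tmul_inner.
Qed.

Fact tmul0r x : tmul 0 x = 0.
Proof. by apply: (addrI (tmul 0 x)); rewrite -tmulDl !addr0. Qed.
Fact tmulr0 x : tmul x 0 = 0.
Proof. by apply: (addrI (tmul x 0)); rewrite -tmulDr !addr0. Qed.

Fact tmulA : associative tmul.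
Proof.
move=> x y z; elim/tens_ind: x => [|x x' hx hx'|a b]; rewrite ?tmul0r ?tmulDl ?hx ?hx' //.
elim/tens_ind: y => [|y y' hy hy'|a' b']; rewrite ?(tmul0r, tmulr0) ?(tmulDl, tmulDr) ?hy ?hy' //.
elim/tens_ind: z => [|z z' hz hz'|a'' b'']; rewrite ?tmulr0 ?tmulDr ?hz ?hz' //.
by rewrite !tmul_pure !mulrA.
Qed.

Fact tmul1r : left_id (1 ⊗ 1) tmul.
Proof.
move=> x; elim/tens_ind: x => [|x x' hx hx'|a b]; rewrite ?tmulr0 ?tmulDr ?hx ?hx' //.
by rewrite tmul_pure !mul1r.
Qed.
Fact tmulr1 : right_id (1 ⊗ 1) tmul.
Proof.
move=> x; elim/tens_ind: x => [|x x' hx hx'|a b]; rewrite ?tmul0r ?tmulDl ?hx ?hx' //.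
by rewrite tmul_pure !mulr1.
Qed.
HB.instance Definition _ :=
  GRing.Zmodule_isPzRing.Build (tens A B) tmulA tmul1r tmulr1 tmulDl tmulDr.

Lemma tensM (a a' : A) (b b' : B) : (a ⊗ b) * (a' ⊗ b') = (a * a') ⊗ (b * b').
Proof. exact: tmul_pure. Qed.
Lemma tens1 : 1 = 1 ⊗ 1 :> tens A B. Proof. by []. Qed.
End TensorAlgebra.

HB.mixin Record hasStar (C : numClosedFieldType) A of GRing.Algebra C A := {
  star : A -> A;
  starD : {morph star : x y / x + y};
  starZ : forall (c : C) x, star (c *: x) = c^* *: star x;
  starM : forall x y, star (x * y) = star y * star x;
  starK : involutive star
}.
#[short(type="starAlgType")]
HB.structure Definition StarAlgebra C := {A of hasStar C A & GRing.Algebra C A}.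

Section AlgebraNotions.
Variable C : numClosedFieldType.

Definition tstar (A B : starAlgType C) : tens A B -> tens A B :=
  tmap (@star C A) (@star C B).

Definition preserves_star (A B : starAlgType C) (f : A -> B) : Prop :=
  forall a, f (star a) = star (f a).

Definition bilinear_map (U V W : lmodType C) (f : U -> V -> W) : Prop :=
  (forall v, linear (f^~ v)) /\ (forall u, linear (f u)).

Definition subalgebra (A : algType C) (P : A -> Prop) : Prop :=
  [/\ P 1, forall x y, P x -> P y -> P (x + y),
      forall c x, P x -> P (c *: x) & forall x y, P x -> P y -> P (x * y)].

Definition generated_by (A : algType C) (gen : A -> Prop) : Prop :=
  forall P : A -> Prop, subalgebra P -> (forall x, gen x -> P x) -> forall x, P x.

End AlgebraNotions.

(* A compact matrix quantum group, through its Hopf *-algebra of polynomial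
   functions: generated by the entries of the fundamental representation
   [fund] and their adjoints, and carrying a Haar state. *)
Record cmqg (C : numClosedFieldType) := Cmqg {
  pol :> starAlgType C;
  cop : {lrmorphism pol -> tens pol pol};
  counit : {lrmorphism pol -> C^o};
  antipode : {linear pol -> pol};
  haar : {linear pol -> C^o};
  fund_dim : nat;
  fund : 'M[pol]_fund_dim;
  cop_star : forall a, cop (star a) = tstar (cop a);
  counit_star : forall a, counit (star a) = ((counit a : C)^* : C);
  cop_assoc : forall a, tmap id cop (cop a) = tassoc (tmap cop id (cop a));
  cop_counitl : forall a, tlift (fun a1 a2 => (counit a1 : C) *: a2) (cop a) = a;
  cop_counitr : forall a, tlift (fun a1 a2 => (counit a2 : C) *: a1) (cop a) = a;
  antipodel : forall a,
    tlift (fun a1 a2 => antipode a1 * a2) (cop a) = (counit a : C) *: 1;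
  antipoder : forall a,
    tlift (fun a1 a2 => a1 * antipode a2) (cop a) = (counit a : C) *: 1;
  antipodeM : forall a b, antipode (a * b) = antipode b * antipode a;
  antipode_star : forall a, antipode (star (antipode (star a))) = a;
  cop_fund : forall i j, cop (fund i j) = \sum_k fund i k ⊗ fund k j;
  fund_gen : generated_by (fun a : pol => exists i j, a = fund i j \/ a = star (fund i j));
  haar_invl : forall a, tlift (fun a1 a2 => (haar a1 : C) *: a2) (cop a) = (haar a : C) *: 1;
  haar_invr : forall a, tlift (fun a1 a2 => (haar a2 : C) *: a1) (cop a) = (haar a : C) *: 1;
  haar1 : haar 1 = 1;
  haar_ge0 : forall a, 0 <= (haar (star a * a) : C);
  haar_eq0 : forall a, haar (star a * a) = 0 -> a = 0
}.

(* a^(1) ⊗ a^(2) ⊗ a^(3) *)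
Definition cop3 (C : numClosedFieldType) (G : cmqg C) (a : G) : tens G (tens G G) :=
  tmap id (cop G) (cop G a).

Notation cplx R := (complex_complex__canonical__Num_ClosedField R).

Section CStar.
Variable R : realType.
Local Notation C := (cplx R).

Record cstar_algebra := CstarAlgebra {
  ca :> starAlgType C;
  ca_norm : ca -> R;
  ca_normD : forall x y, ca_norm (x + y) <= ca_norm x + ca_norm y;
  ca_normZ : forall c x, ca_norm (c *: x) = complex.Re `|c| * ca_norm x;
  ca_norm_eq0 : forall x, ca_norm x = 0 -> x = 0;
  ca_normM : forall x y, ca_norm (x * y) <= ca_norm x * ca_norm y;
  ca_norm_star : forall x, ca_norm (star x * x) = ca_norm x ^+ 2;
  ca_complete : forall u : nat -> ca,
    (forall e : R, 0 < e -> exists N, forall k l, (N <= k)%N -> (N <= l)%N ->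
       ca_norm (u k - u l) < e) ->
    exists x, forall e : R, 0 < e -> exists N, forall k, (N <= k)%N -> ca_norm (u k - x) < e
}.

Definition ca_pos (A : cstar_algebra) (x : A) : Prop := exists y : A, x = star y * y.

Record faithful_state (A : cstar_algebra) := FaithfulState {
  fs_fun :> {linear A -> C^o};
  fs1 : fs_fun 1 = 1;
  fs_ge0 : forall x, 0 <= (fs_fun (star x * x) : C);
  fs_eq0 : forall x, fs_fun (star x * x) = 0 -> x = 0
}.

(* Quantum principal G-bundle over M, with the measure theory on the base. *)
Record qpb (G : cmqg C) := Qpb {
  total :> starAlgType C;
  base : starAlgType C;
  incl : {lrmorphism base -> total};
  incl_inj : injective incl;
  incl_star : preserves_star incl;
  bcoact : {lrmorphism total -> tens total G};
  bcoact_star : forall b, bcoact (star b) = tstar (bcoact b);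
  bcoact_assoc : forall b, tmap id (cop G) (bcoact b) = tassoc (tmap bcoact id (bcoact b));
  bcoact_counit : forall b, tlift (fun b0 c => (counit G c : C) *: b0) (bcoact b) = b;
  bcoact_inv : forall b, bcoact b = b ⊗ 1 <-> exists v, b = incl v;
  (* surjectivity of q ⊗ b |-> q F(b); the balancing over the base plays no
     role in the image *)
  bcoact_free : forall x : tens total G,
    exists s : seq (total * total), x = \sum_(p <- s) (p.1 ⊗ 1) * bcoact p.2;
  base_cstar : cstar_algebra;
  base_emb : {lrmorphism base -> base_cstar};
  base_emb_inj : injective base_emb;
  base_emb_star : preserves_star base_emb;
  base_dense : forall (x : base_cstar) (e : R), 0 < e ->
    exists v, ca_norm (x - base_emb v) < e;
  base_state : faithful_state base_cstar;
  fiber_int : {linear total -> base};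
  fiber_intE : forall b,
    incl (fiber_int b) = tlift (fun b0 c => (haar G c : C) *: b0) (bcoact b);
  fiber_int_ge0 : forall b, ca_pos (base_emb (fiber_int (star b * b)));
  fiber_int_eq0 : forall b, fiber_int (star b * b) = 0 -> b = 0
}.

Definition total_state (G : cmqg C) (P : qpb G) (b : P) : C :=
  base_state P (base_emb P (fiber_int P b)).

End CStar.

Section CoordinateSpace.
Variables (C : numClosedFieldType) (G : cmqg C).

Record coord_space := CoordSpace {
  cs :> vectType C;
  cs_dim : nat;
  cs_basis : cs_dim.-tuple cs;
  cs_basisP : basis_of fullv cs_basis;
  cstar : cs -> cs;
  cstarD : {morph cstar : x y / x + y};
  cstarZ : forall (c : C) x, cstar (c *: x) = c^* *: cstar x;
  cstarK : involutive cstar;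
  circ : cs -> G -> cs;
  circ_bilin : bilinear_map circ;
  circ1 : forall x, circ x 1 = x;
  circM : forall x a b, circ x (a * b) = circ (circ x a) b;
  coact : {linear cs -> tens cs G};
  coact_assoc : forall x, tmap id (cop G) (coact x) = tassoc (tmap coact id (coact x));
  coact_counit : forall x, tlift (fun y c => (counit G c : C) *: y) (coact x) = x;
  coact_star : forall x, coact (cstar x) = tmap cstar (@star C G) (coact x);
  circ_star : forall x a, cstar (circ x a) = circ (cstar x) (star (antipode G a));
  coact_circ : forall x a,
    coact (circ x a) =
    tlift (fun y c =>
      tlift (fun a1 a23 =>
        tlift (fun a2 a3 => circ y a2 ⊗ (antipode G a1 * c * a3)) a23) (cop3 a)) (coact x)
}.

Variable V : coord_space.

Definition theta (i : 'I_(cs_dim V)) : V := tnth (cs_basis V) i.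

Definition braid_tau : tens V V -> tens V V :=
  tlift (fun eta th => tlift (fun th' c => th' ⊗ circ eta c) (coact V th)).

(* the operations *, ∘ and ϰ on V ⊗ V *)
Definition cstar2 : tens V V -> tens V V :=
  tlift (fun x y => cstar y ⊗ cstar x).
Definition circ2 (z : tens V V) (a : G) : tens V V :=
  tlift (fun x y => tlift (fun a1 a2 => circ x a1 ⊗ circ y a2) (cop G a)) z.
Definition coact2 : tens V V -> tens (tens V V) G :=
  tlift (fun x y =>
    tlift (fun x' c => tlift (fun y' d => (x' ⊗ y') ⊗ (c * d)) (coact V y)) (coact V x)).

End CoordinateSpace.

(* f acting on the first two factors of V ⊗ V ⊗ U, tensors being nested to
   the right. *)
Definition on12 (K : comNzRingType) (V U : lmodType K) (f : tens V V -> tens V V)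
    (x : tens V (tens V U)) : tens V (tens V U) :=
  tassoc (tmap f id (tassocV x)).

Section HilbertSpace.
Variable R : realType.
Local Notation C := (cplx R).

(* symmetric partial sums over -n <= k < n *)
Definition zsum (f : int -> R) : nat -> R :=
  fun n => \sum_(k < n) (f (Posz k) + f (Negz k)).

Definition l2 (x : int -> C) : Prop :=
  cvgn (zsum (fun k => complex.Re (x k) ^+ 2 + complex.Im (x k) ^+ 2)).

Definition l2_dot (x y : int -> C) : C :=
  Complex (limn (zsum (fun k => complex.Re ((x k)^* * y k))))
          (limn (zsum (fun k => complex.Im ((x k)^* * y k)))).

Definition l2_dense (D : (int -> C) -> Prop) : Prop :=
  forall x, l2 x -> forall e : R, 0 < e ->
  exists2 y, D y & complex.Re (l2_dot (x - y) (x - y)) < e.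

Record realization (S : starAlgType C) := Realization {
  dom : (int -> C) -> Prop;
  dom_l2 : forall x, dom x -> l2 x;
  dom0 : dom 0;
  domP : forall c x y, dom x -> dom y -> dom (c *: x + y);
  dom_dense : l2_dense dom;
  act : S -> (int -> C) -> (int -> C);
  act_dom : forall q x, dom x -> dom (act q x);
  act_linear : forall q c x y, dom x -> dom y ->
    act q (c *: x + y) = c *: act q x + act q y;
  actP : forall c p q x, dom x -> act (c *: p + q) x = c *: act p x + act q x;
  act1 : forall x, dom x -> act 1 x = x;
  actM : forall p q x, dom x -> act (p * q) x = act p (act q x);
  act_star : forall q x y, dom x -> dom y ->
    l2_dot x (act q y) = l2_dot (act (star q) x) y;
  act_inj : forall q, (forall x, dom x -> act q x = 0) -> q = 0;
  act_cyclic : exists2 x, dom x & l2_dense (fun y => exists q, y = act q x);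
  act_separating : exists2 x, dom x & forall q, act q x = 0 -> q = 0
}.

Definition op_ge0 (S : starAlgType C) (H : realization S) (q : S) : Prop :=
  forall x, dom H x -> 0 <= l2_dot x (act H q x).

Definition op_gt0 (S : starAlgType C) (H : realization S) (q : S) : Prop :=
  op_ge0 H q /\ q <> 0.

End HilbertSpace.

Section QuantumMetric.
Variables (R : realType).
Local Notation C := (cplx R).
Variables (G : cmqg C) (V : coord_space G).

Record quantum_metric := QuantumMetric {
  sigma : {linear tens V V -> tens V V};
  sigmaV : {linear tens V V -> tens V V};
  sigmaK : cancel sigma sigmaV;
  sigmaVK : cancel sigmaV sigma;
  sigma_braid : forall x : tens V (tens V V),
    on12 sigma (tmap id sigma (on12 sigma x)) = tmap id sigma (on12 sigma (tmap id sigma x));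
  sigma_star : forall z, sigma (cstar2 z) = cstar2 (sigma z);
  sigma_circ : forall z a, sigma (circ2 z a) = circ2 (sigma z) a;
  sigma_coact : forall z, coact2 (sigma z) = tmap sigma id (coact2 z);

  Sig : starAlgType C;
  met : {linear tens V V -> Sig};
  met_sigma : forall z, met (sigma z) = met z;
  met_star : forall x y, star (met (x ⊗ y)) = met (cstar y ⊗ cstar x);
  met2 : tens V (tens V (tens V V)) -> Sig :=
    fun z => tlift (fun a b => met a * met b) (tassocV z);
  met2_sigma_l : forall z,
    met2 z = met2 (tmap id (on12 sigma)
                    (tassoc (tmap sigmaV sigma
                      (tassocV (tmap id (on12 sigmaV) z)))));
  met2_sigma_r : forall z,
    met2 z = met2 (tmap id (on12 sigma)
                    (tassoc (tmap sigma sigmaV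
                      (tassocV (tmap id (on12 sigmaV) z)))));
  met_mx : 'M[Sig]_(cs_dim V) := \matrix_(i, j) met (theta i ⊗ theta j);
  met_inv : 'M[Sig]_(cs_dim V);
  met_mulV : met_mx *m met_inv = 1%:M;
  met_Vmul : met_inv *m met_mx = 1%:M;
  Sig_gen : generated_by (fun q : Sig => exists i j, q = met_mx i j \/ q = met_inv i j);

  nu : {linear tens V Sig -> tens Sig V};
  nu_mx : Sig -> 'M[Sig]_(cs_dim V);
  nu_mx_linear : forall i j, linear (fun q => nu_mx q i j);
  nu_mx1 : nu_mx 1 = 1%:M;
  nu_mxM : forall p q, nu_mx (p * q) = nu_mx p *m nu_mx q;
  nuE : forall i q, nu (theta i ⊗ q) = \sum_j nu_mx q i j ⊗ theta j;
  nu_met : forall x : tens V (tens V V),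
    nu (tmap id met x) = tmap met id (tassocV (tmap id sigma (on12 sigmaV x)));

  Sig_real : realization Sig;

  scirc : Sig -> G -> Sig;
  scirc_bilin : bilinear_map scirc;
  scirc1 : forall q, scirc q 1 = q;
  scircM : forall q a b, scirc q (a * b) = scirc (scirc q a) b;
  scirc_unit : forall a, scirc 1 a = (counit G a : C) *: 1;
  scirc_mul : forall p q a,
    scirc (p * q) a = tlift (fun a1 a2 => scirc p a1 * scirc q a2) (cop G a);
  scirc_met : forall z a, scirc (met z) a = met (circ2 z a);
  scoact : {lrmorphism Sig -> tens Sig G};
  scoact_star : forall q, scoact (star q) = tstar (scoact q);
  scoact_assoc : forall q, tmap id (cop G) (scoact q) = tassoc (tmap scoact id (scoact q));
  scoact_counit : forall q, tlift (fun p c => (counit G c : C) *: p) (scoact q) = q;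
  scoact_met : forall z, scoact (met z) = tmap met id (coact2 z)
}.

Variable M : quantum_metric.

(* The tensor algebra of the Sig-bimodule Sig ⊗ V, that is Sig ⊗ V^⊗ with the
   product determined by θ q = ν(θ ⊗ q). *)
Record tensor_algebra := TensorAlgebra {
  ta :> starAlgType C;
  taS : {lrmorphism Sig M -> ta};
  taV : {linear V -> ta};
  taS_star : preserves_star taS;
  taV_star : forall x, taV (cstar x) = star (taV x);
  ta_nu : forall x q, taV x * taS q = tlift (fun p y => taS p * taV y) (nu M (x ⊗ q));
  ta_word : seq 'I_(cs_dim V) -> ta := fun u => \prod_(i <- u) taV (theta i);
  ta_span : forall x, exists s : seq (Sig M * seq 'I_(cs_dim V)),
    x = \sum_(p <- s) taS p.1 * ta_word p.2;
  ta_free : forall (s : seq (seq 'I_(cs_dim V))) (c : seq 'I_(cs_dim V) -> Sig M),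
    uniq s -> \sum_(u <- s) taS (c u) * ta_word u = 0 -> {in s, forall u, c u = 0};
  tcirc : ta -> G -> ta;
  tcirc_bilin : bilinear_map tcirc;
  tcirc1 : forall x, tcirc x 1 = x;
  tcircM : forall x a b, tcirc x (a * b) = tcirc (tcirc x a) b;
  tcirc_mul : forall x y a,
    tcirc (x * y) a = tlift (fun a1 a2 => tcirc x a1 * tcirc y a2) (cop G a);
  tcirc_S : forall q a, tcirc (taS q) a = taS (scirc q a);
  tcirc_V : forall x a, tcirc (taV x) a = taV (circ x a);
  tcoact : {lrmorphism ta -> tens ta G};
  tcoact_S : forall q, tcoact (taS q) = tmap taS id (scoact M q);
  tcoact_V : forall x, tcoact (taV x) = tmap taV id (coact V x)
}.

Section TensorOperators.
Variable T : tensor_algebra.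

Definition taVV : tens V V -> T := tlift (fun x y => taV T x * taV T y).

(* x is an n-tensor with coefficients in Sig, resp. a scalar n-tensor *)
Definition tdeg (n : nat) (x : T) : Prop :=
  exists c : n.-tuple 'I_(cs_dim V) -> Sig M, x = \sum_u taS T (c u) * ta_word T u.
Definition tdeg0 (n : nat) (x : T) : Prop :=
  exists c : n.-tuple 'I_(cs_dim V) -> C, x = \sum_u c u *: ta_word T u.

(* F is the Sig-bilinear extension of f acting on factors i and i.+1,
   counted from 0 *)
Definition local_ext (f : tens V V -> tens V V) (i : nat) (F : T -> T) : Prop :=
  forall u z v, tdeg i u -> F (u * taVV z * v) = u * taVV (f z) * v.
Definition local_ext0 (f : tens V V -> tens V V) (i : nat) (F : T -> T) : Prop :=
  forall k u z v, tdeg0 i u -> tdeg0 k v -> F (u * taVV z * v) = u * taVV (f z) * v.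

End TensorOperators.

Definition adj_tperm (n : nat) : nat -> 'S_n :=
  match n with
  | 0 => fun=> 1%g
  | _.+1 => fun i => tperm (inord i) (inord i.+1)
  end.

Definition perm_len (n : nat) (p : 'S_n) : nat :=
  #|[set ij : 'I_n * 'I_n | (ij.1 < ij.2)%N && (p ij.2 < p ij.1)%N]|.

(* s_i1 o ... o s_ik is a minimal decomposition of p; the reversal accounts for
   the product of permutations being in diagrammatic order *)
Definition reduced_word (n : nat) (p : 'S_n) (s : seq nat) : Prop :=
  [/\ all (fun i => i.+1 < n)%N s, p = (\prod_(i <- rev s) adj_tperm n i)%g
    & size s = perm_len p].

Record exterior_algebra := ExteriorAlgebra {
  ten : tensor_algebra;
  (* g on n-tensors, with values 0 between tensors of different degrees *)
  tmet : ten -> ten -> Sig M;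
  tmetDl : forall x y z, tmet (x + y) z = tmet x z + tmet y z;
  tmetDr : forall x y z, tmet x (y + z) = tmet x y + tmet x z;
  tmetSl : forall q x y, tmet (taS ten q * x) y = q * tmet x y;
  tmetSm : forall q x y, tmet (x * taS ten q) y = tmet x (taS ten q * y);
  tmetSr : forall q x y, tmet x (y * taS ten q) = tmet x y * q;
  tmet1 : tmet 1 1 = 1;
  tmet_rec : forall (psi xi : ten) (x y : V),
    tmet (psi * taV ten x) (taV ten y * xi) = tmet psi (taS ten (met M (x ⊗ y)) * xi);
  tmet_deg : forall n k x y, @tdeg ten n x -> @tdeg ten k y -> n <> k -> tmet x y = 0;
  met_pos : forall x, @tdeg ten 1 x -> x <> 0 -> op_gt0 (Sig_real M) (tmet (star x) x);

  sigmaT : nat -> {linear ten -> ten};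
  sigmaTP : forall i, local_ext (sigma M) i (sigmaT i);
  tauT : nat -> {linear ten -> ten};
  tauTP : forall i, local_ext0 (@braid_tau C G V) i (tauT i);
  sigma_perm : forall n, 'S_n -> ten -> ten;
  sigma_permP : forall n (p : 'S_n) s x, reduced_word p s -> @tdeg ten n x ->
    sigma_perm p x = foldr (fun i => sigmaT i) x s;
  asym : {linear ten -> ten};
  asymE : forall n x, @tdeg ten n x ->
    asym x = \sum_(p : 'S_n) (-1) ^+ perm_len p *: sigma_perm p x;
  asym_pos : forall n x, @tdeg ten n x -> op_ge0 (Sig_real M) (tmet (star x) (asym x));
  asym_tau : forall n x, @tdeg0 ten n x ->
    (exists2 y, @tdeg0 ten n y & x = asym y) <->
    (forall i, (i.+1 < n)%N -> tauT i x = - x);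

  (* the quotient by ker asym *)
  ext : starAlgType C;
  ext_pi : {lrmorphism ten -> ext};
  ext_pi_surj : forall y, exists x, y = ext_pi x;
  ext_pi_ker : forall x, ext_pi x = 0 <-> asym x = 0;
  ext_pi_star : preserves_star ext_pi;
  extS : Sig M -> ext := fun q => ext_pi (taS ten q);
  wcirc : ext -> G -> ext;
  wcirc_pi : forall x a, wcirc (ext_pi x) a = ext_pi (tcirc x a);
  wcoact : {linear ext -> tens ext G};
  wcoact_pi : forall x, wcoact (ext_pi x) = tmap ext_pi id (tcoact ten x);
  wmet : ext -> ext -> Sig M;
  wmetE : forall x y, wmet (ext_pi x) (ext_pi y) = tmet x (asym y);

  top_deg : nat;
  vol : ext;
  vol_deg : exists2 x, @tdeg0 ten top_deg x & vol = ext_pi x;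
  vol_neq0 : vol <> 0;
  vol_span : forall x, @tdeg0 ten top_deg x -> exists c : C, ext_pi x = c *: vol;
  ext_top : forall k x, (top_deg < k)%N -> @tdeg0 ten k x -> ext_pi x = 0;
  vol_coact : wcoact vol = vol ⊗ 1;
  lambda : {lrmorphism G -> C^o};
  lambda_central : forall a,
    tlift (fun a1 a2 => (lambda a1 : C) *: a2) (cop G a) =
    tlift (fun a1 a2 => (lambda a2 : C) *: a1) (cop G a);
  vol_circ : forall a, wcirc vol a = (lambda a : C) *: vol;
  vol_aut : {lrmorphism Sig M -> Sig M};
  vol_aut_bij : bijective vol_aut;
  vol_autE : forall q, vol * extS q = extS (vol_aut q) * vol;
  (* coefficient of vol in the component of degree top_deg *)
  vol_coef : {linear ext -> Sig M};
  vol_coef_vol : forall q, vol_coef (extS q * vol) = q;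
  vol_coef_deg : forall k x, @tdeg ten k x -> k <> top_deg -> vol_coef (ext_pi x) = 0;
  is_hodge : (ext -> ext) -> Prop := fun h =>
    (forall k x, (k <= top_deg)%N -> @tdeg ten k x ->
       exists2 y, @tdeg ten (top_deg - k) y & h (ext_pi x) = ext_pi y) /\
    (forall x y, wmet x y = vol_coef (x * h y));
  hodge : {linear ext -> ext};
  hodgeP : is_hodge hodge;
  hodge_uniq : forall h : {linear ext -> ext}, is_hodge h -> h =1 hodge
}.

End QuantumMetric.

Section HorizontalForms.
Variables (R : realType).
Local Notation C := (cplx R).
Variables (G : cmqg C) (P : qpb G) (V : coord_space G) (M : quantum_metric V).
Variable E : exterior_algebra M.
Local Notation W := (ext E).

Definition wedge_dot (x y : W) : Sig M := wmet (star x) y.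

Local Notation hor := (tens P W).

Definition hor_mul (x y : hor) : hor :=
  tlift (fun q th => tlift (fun b et =>
    tlift (fun bk ck => (q * bk) ⊗ (wcirc th ck * et)) (bcoact P b)) y) x.

(* star th is the ungraded involution of the exterior algebra *)
Definition hor_star : hor -> hor :=
  tlift (fun b th => tlift (fun bk ck => star bk ⊗ wcirc (star th) (star ck)) (bcoact P b)).

Definition hor_coact : hor -> tens hor G :=
  tlift (fun b th => tlift (fun bk ck => tlift (fun thl dl =>
    (bk ⊗ thl : hor) ⊗ (ck * dl)) (wcoact E th)) (bcoact P b)).

Definition hor_hodge : hor -> hor := tmap id (hodge E).

Definition hor_int : hor -> Sig M :=
  tlift (fun b th => total_state b *: vol_coef E th).

(* Sig as a subalgebra of the horizontal forms; its left and right actions are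
   the products with these elements *)
Definition hor_S (q : Sig M) : hor := 1 ⊗ extS E q.

Definition hor_dot (phi psi : hor) : Sig M :=
  hor_int (hor_mul (hor_star phi) (hor_hodge psi)).



Lemma wcirc_bilin : bilinear_map (wcirc (e := E)).
Proof.
have [cl cr] := tcirc_bilin (ten E).
split=> [a c x y|x c a b].
  have [[x' ->] [y' ->]] := (ext_pi_surj x, ext_pi_surj y).
  by rewrite -linearP !wcirc_pi cl linearP.
by have [x' ->] := ext_pi_surj x; rewrite !wcirc_pi cr linearP.
Qed.

Lemma wcircDl (x y : W) (a : G) : wcirc (x + y) a = wcirc x a + wcirc y a.
Proof. by have [wl _] := wcirc_bilin; have := wl a 1 x y; rewrite !scale1r. Qed.
Lemma wcircDr (x : W) (a b : G) : wcirc x (a + b) = wcirc x a + wcirc x b.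
Proof. by have [_ wr] := wcirc_bilin; have := wr x 1 a b; rewrite !scale1r. Qed.
Lemma wcircZl c (x : W) (a : G) : wcirc (c *: x) a = c *: wcirc x a.
Proof.
have w0 : wcirc (0 : W) a = 0 by apply: (addrI (wcirc 0 a)); rewrite -wcircDl !addr0.
by have [wl _] := wcirc_bilin; have := wl a c x 0; rewrite w0 !addr0.
Qed.
Lemma wcircZr c (x : W) (a : G) : wcirc x (c *: a) = c *: wcirc x a.
Proof.
have w0 : wcirc x 0 = 0 by apply: (addrI (wcirc x 0)); rewrite -wcircDr !addr0.
by have [_ wr] := wcirc_bilin; have := wr x c a 0; rewrite w0 !addr0.
Qed.

Let pl (u u' : P) (v : W) : (u + u') ⊗ v = u ⊗ v + u' ⊗ v.
Proof. by have [+ _ _] := tpure_balanced P W; apply. Qed.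
Let pr (u : P) (v v' : W) : u ⊗ (v + v') = u ⊗ v + u ⊗ v'.
Proof. by have [_ + _] := tpure_balanced P W; apply. Qed.
Let pz c (u : P) (v : W) : (c *: u) ⊗ v = u ⊗ (c *: v).
Proof. by have [_ _ +] := tpure_balanced P W; apply. Qed.

Lemma hor_mul_pure (q b : P) (th et : W) :
  hor_mul (q ⊗ th) (b ⊗ et) =
  tlift (fun bk ck => (q * bk) ⊗ (wcirc th ck * et) : hor) (bcoact P b).
Proof.
have inb q' (th' et' : W) :
    balanced (fun bk (ck : G) => (q' * bk) ⊗ (wcirc th' ck * et') : hor).
  split=> [u u' v|u v v'|c u v]; first by rewrite mulrDr pl.
    by rewrite wcircDr mulrDl pr.
  by rewrite wcircZr -scalerAl -scalerAr pz.
rewrite /hor_mul tlift_pure ?tlift_pure //.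
- split=> [u u' v|u v v'|c u v]; first by rewrite raddfD tliftD.
    by rewrite -tlift_addf; apply: eq_tlift => bk ck; rewrite mulrDr pr.
  rewrite linearZ /= tliftZ //; apply: eq_tlift => bk ck.
  by rewrite -scalerAr -scalerAr pz.
- split=> [u u' v|u v v'|c u v]; rewrite -?tlift_addf; apply: eq_tlift => bb ee.
  + by rewrite -tlift_addf; apply: eq_tlift => bk ck; rewrite mulrDl pl.
  + by rewrite -tlift_addf; apply: eq_tlift => bk ck; rewrite wcircDl mulrDl pr.
  + by apply: eq_tlift => bk ck; rewrite wcircZl -!scalerAl pz.
Qed.

Lemma hor_star_pure (b : P) (th : W) :
  hor_star (b ⊗ th) =
  tlift (fun bk ck => star bk ⊗ wcirc (star th) (star ck) : hor) (bcoact P b).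
Proof.
have inb (th' : W) :
    balanced (fun bk (ck : G) => star bk ⊗ wcirc (star th') (star ck) : hor).
  split=> [u u' v|u v v'|c u v]; first by rewrite starD pl.
    by rewrite starD wcircDr pr.
  by rewrite !starZ wcircZr pz.
rewrite /hor_star tlift_pure //.
split=> [u u' v|u v v'|c u v]; first by rewrite raddfD tliftD.
  by rewrite -tlift_addf; apply: eq_tlift => bk ck; rewrite starD wcircDl pr.
rewrite linearZ /= tliftZ //; apply: eq_tlift => bk ck.
by rewrite !starZ wcircZl pz.
Qed.

Lemma hor_coact_pure (b : P) (th : W) :
  hor_coact (b ⊗ th) =
  tlift (fun bk ck => tlift (fun thl dl => (bk ⊗ thl : hor) ⊗ (ck * dl)) (wcoact E th))
    (bcoact P b).
Proof.
have [tl tr tz] := tpure_balanced hor G.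
have inb bk ck : balanced (fun thl (dl : G) => (bk ⊗ thl : hor) ⊗ (ck * dl)).
  split=> [u u' v|u v v'|c u v].
    - by rewrite pr tl.
    - by rewrite mulrDr tr.
  by rewrite -pz tpureZ tz -scalerAr.
have outb (th' : W) : balanced (fun bk (ck : G) =>
    tlift (fun thl dl => (bk ⊗ thl : hor) ⊗ (ck * dl)) (wcoact E th')).
  split=> [u u' v|u v v'|c u v]; rewrite -?tlift_addf; apply: eq_tlift => th2 d.
  - by rewrite pl tl.
  - by rewrite mulrDl tr.
  - by rewrite tpureZ tz -scalerAl.
rewrite /hor_coact tlift_pure //.
split=> [u u' v|u v v'|c u v]; first by rewrite raddfD tliftD.
  by rewrite -tlift_addf; apply: eq_tlift => bk ck; rewrite raddfD tliftD.
rewrite linearZ /= tliftZ //; apply: eq_tlift => bk ck.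
rewrite linearZ /= tliftZ //; apply: eq_tlift => th2 d.
by rewrite pz.
Qed.

Lemma hor_hodge_pure (b : P) (th : W) : hor_hodge (b ⊗ th) = b ⊗ hodge E th.
Proof.
rewrite /hor_hodge /tmap tlift_pure //.
by split=> [u u' v|u v v'|c u v]; rewrite ?pl ?raddfD ?pr // linearZ pz.
Qed.

Lemma total_stateP c (b b' : P) :
  total_state (c *: b + b') = c * total_state b + total_state b'.
Proof. by rewrite /total_state !linearP. Qed.

Lemma hor_int_pure (b : P) (th : W) :
  hor_int (b ⊗ th) = total_state b *: vol_coef E th.
Proof.
have t0 : total_state (0 : P) = 0 by rewrite /total_state !raddf0.
rewrite /hor_int tlift_pure //; split=> [u u' v|u v v'|c u v].
- by rewrite -[u]scale1r total_stateP mul1r scale1r scalerDl.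
- by rewrite raddfD scalerDr.
- by rewrite -[c *: u]addr0 total_stateP t0 addr0 linearZ scalerA mulrC.
Qed.

Lemma hor_int_vol (b : P) (q : Sig M) :
  hor_int (b ⊗ (extS E q * vol E)) = total_state b *: q.
Proof. by rewrite hor_int_pure vol_coef_vol. Qed.

Lemma hor_int_deg (b : P) k (x : ten E) :
  tdeg k x -> (k < top_deg E)%N -> hor_int (b ⊗ ext_pi E x) = 0.
Proof.
move=> xk km; rewrite hor_int_pure (vol_coef_deg (e := E) xk) ?scaler0 //.
by move=> kE; rewrite kE ltnn in km.
Qed.

Record scalar_product (sp : hor -> hor -> Sig M) : Prop := ScalarProduct {
  sp_addl : forall x y z, sp (x + y) z = sp x z + sp y z;
  sp_addr : forall x y z, sp x (y + z) = sp x y + sp x z;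
  sp_mulr : forall x y q, sp x (hor_mul y (hor_S q)) = sp x y * q;
  sp_mull : forall x y q, sp (hor_mul x (hor_S q)) y = star q * sp x y;
  sp_adj : forall x y q, sp (hor_mul (hor_S q) x) y = sp x (hor_mul (hor_S (star q)) y);
  sp_herm : forall x y, star (sp x y) = sp y x;
  sp_ge0 : forall x, op_ge0 (Sig_real M) (sp x x);
  sp_eq0 : forall x, sp x x = 0 -> x = 0
}.

Definition covariant_product (sp : hor -> hor -> Sig M) : Prop :=
  forall (phi psi : hor) (s t : seq (hor * G)),
  hor_coact phi = \sum_(k <- s) k.1 ⊗ k.2 ->
  hor_coact psi = \sum_(l <- t) l.1 ⊗ l.2 ->
  \sum_(k <- s) \sum_(l <- t) sp k.1 l.1 ⊗ (star k.2 * l.2) = scoact M (sp phi psi).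

End HorizontalForms.

(* Main.v *)
(* The coaction F is multiplicative and the state w_P is G-invariant, so that
   (w_P x id) F(b^* q) = w_P(b^* q) 1. This removes all the twists by the right
   action from the product of pure tensors, whose scalar product is therefore
   w_P(b^* q) <th, et>.

   The form <th, et> = g(th^*, A et) is hermitian because A is positive
   (polarization), and definite because, by Cauchy-Schwarz for all the vector
   states of the realization, <th, th> = 0 forces g(y, A th) = 0 for all y, while
   g is nondegenerate on tensors, the metric matrix being invertible. Positivity
   on the tensor product follows after orthogonalizing the left legs of a tensor.

   The adjointness of the left action of Sigma comes from the identities
   (q o a)^* = q^* o k(a)^* and w_P(b_0^* d) k(b_1)^* = w_P(b^* d_0) d_1, and the
   covariance from that of g and from the commutation of A with the coaction. *)
Require Import Defs.
From HB Require Import structures.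
From mathcomp Require Import all_boot all_order all_fingroup all_algebra.
From mathcomp Require Import boolp classical_sets functions reals topology normedtype sequences.
From mathcomp Require Import complex ring lra zify.
Set Implicit Arguments.
Unset Strict Implicit.
Unset Printing Implicit Defensive.
Import Order.TTheory GRing.Theory Num.Theory.
Local Open Scope ring_scope.

(** * Tensor products *)

Section TensorLemmas.
Variable K : comNzRingType.

(** Several facts that the argument uses are given only in a weaker form, and this shapes the
    development. The rule for the adjoint of q o a is assumed on V but not on Sigma. It passes to
    the values of g at once. The entries of the inverse metric matrix are reached through uniqueness
    of convolution inverses, and this needs the antipode to reverse the coproduct, which the same
    uniqueness yields. The antisymmetrizer is specified on homogeneous tensors through reduced words
    of permutations. Its Sigma-linearity and its commutation with the coaction are therefore read
    off from local braidings, once reduced words are known to exist. Sigma acts by possibly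
    unbounded operators on a common domain, and the scalar product of l^2 is a limit. Identities are
    thus proved on the domain with convergence in hand, and an element of Sigma is shown to vanish
    through its quadratic form x |-> <x, q x>. Tensors are classes of formal sums, so a map out of a
    tensor product computes as expected only once it is known to be balanced; hence the many side
    goals of that kind. *)

Lemma tpureDl (U V : lmodType K) (u u' : U) (v : V) : (u + u') ⊗ v = u ⊗ v + u' ⊗ v.
Proof. by have [+ _ _] := tpure_balanced U V; apply. Qed.

Lemma tpureDr (U V : lmodType K) (u : U) (v v' : V) : u ⊗ (v + v') = u ⊗ v + u ⊗ v'.
Proof. by have [_ + _] := tpure_balanced U V; apply. Qed.

Lemma tpureZr (U V : lmodType K) c (u : U) (v : V) : u ⊗ (c *: v) = c *: (u ⊗ v).
Proof. by rewrite -tpureZ; have [_ _ ->] := tpure_balanced U V. Qed.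

Lemma tpure0l (U V : lmodType K) (v : V) : (0 : U) ⊗ v = 0.
Proof. by rewrite -(scale0r 0) tpureZ scale0r. Qed.

Lemma tpure0r (U V : lmodType K) (u : U) : u ⊗ (0 : V) = 0.
Proof. by rewrite -(scale0r 0) tpureZr scale0r. Qed.

Lemma tpure_suml (U V : lmodType K) I (r : seq I) (F : I -> U) (v : V) :
  (\sum_(i <- r) F i) ⊗ v = \sum_(i <- r) F i ⊗ v.
Proof.
elim: r => [|i r ih]; last by rewrite !big_cons tpureDl ih.
by rewrite !big_nil tpure0l.
Qed.

Lemma tens_seqE (U V : lmodType K) (x : tens U V) :
  x = \sum_(p <- tseq x) p.1 ⊗ p.2.
Proof. by rewrite -tsumE tseqK. Qed.

Lemma linear_pred0 (U V : lmodType K) (f : U -> V) : linear f -> f 0 = 0.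
Proof. by move=> fl; have := fl (-1) 0 0; rewrite scaler0 addr0 scaleN1r addNr. Qed.

Lemma linear_predD (U V : lmodType K) (f : U -> V) : linear f -> {morph f : x y / x + y}.
Proof. by move=> fl x y; rewrite -{1}[x]scale1r fl scale1r. Qed.

Lemma linear_predZ (U V : lmodType K) (f : U -> V) c x : linear f -> f (c *: x) = c *: f x.
Proof. by move=> fl; rewrite -[c *: x]addr0 fl (linear_pred0 fl) addr0. Qed.

Section Balanced.
Variables (U V : lmodType K) (Z : zmodType).

Lemma tlift_sum (f : U -> V -> Z) I (r : seq I) (F : I -> tens U V) :
  balanced f -> tlift f (\sum_(i <- r) F i) = \sum_(i <- r) tlift f (F i).
Proof.
move=> fb; elim: r => [|i r ih]; first by rewrite !big_nil tlift0.
by rewrite !big_cons tliftD // ih.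
Qed.

Lemma tlift_sumE (f : U -> V -> Z) I (r : seq I) (F : I -> U) (G : I -> V) :
  balanced f -> tlift f (\sum_(i <- r) F i ⊗ G i) = \sum_(i <- r) f (F i) (G i).
Proof.
by move=> fb; rewrite tlift_sum //; apply: eq_bigr => i _; rewrite tlift_pure.
Qed.

Lemma raddf_tlift (Z' : zmodType) (L : Z -> Z') (f : U -> V -> Z) x :
  {morph L : a b / a + b} -> L (tlift f x) = tlift (fun u v => L (f u v)) x.
Proof.
move=> LD; have L0 : L 0 = 0 by apply: (addrI (L 0)); rewrite -LD !addr0.
exact: (big_morph L LD L0).
Qed.

Lemma tlift_tlift (X Y : lmodType K) (f : U -> V -> Z) (g : X -> Y -> tens U V) x :
  balanced f -> tlift f (tlift g x) = tlift (fun a b => tlift f (g a b)) x.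
Proof. by move=> fb; apply: tlift_sum. Qed.

Lemma tlift_tmap (X Y : lmodType K) (f : U -> V -> Z) (g : X -> U) (h : Y -> V) x :
  balanced f -> tlift f (tmap g h x) = tlift (fun a b => f (g a) (h b)) x.
Proof.
by move=> fb; rewrite tlift_tlift //; apply: eq_tlift => a b; rewrite tlift_pure.
Qed.

Lemma exchange_tlift (X Y : lmodType K) (f : U -> V -> X -> Y -> Z) x y :
  tlift (fun u v => tlift (f u v) y) x = tlift (fun a b => tlift (fun u v => f u v a b) x) y.
Proof. exact: exchange_big. Qed.

Lemma balanced_sum I (r : seq I) (f : I -> U -> V -> Z) :
  (forall i, balanced (f i)) -> balanced (fun u v => \sum_(i <- r) f i u v).
Proof.
move=> fb; split=> [u u' v|u v v'|c u v]; rewrite -?big_split; apply: eq_bigr => i _.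
- by have [-> _ _] := fb i.
- by have [_ -> _] := fb i.
- by have [_ _ ->] := fb i.
Qed.

Lemma balanced_tlift (X Y : lmodType K) (f : U -> V -> X -> Y -> Z) t :
  (forall x y, balanced (fun u v => f u v x y)) -> balanced (fun u v => tlift (f u v) t).
Proof. by move=> fb; apply: (balanced_sum _ (fun p => fb p.1 p.2)). Qed.

Lemma balanced_comp (Z' : zmodType) (L : Z -> Z') (f : U -> V -> Z) :
  {morph L : a b / a + b} -> balanced f -> balanced (fun u v => L (f u v)).
Proof.
move=> LD [fl fr fz]; split=> [u u' v|u v v'|c u v]; first by rewrite fl LD.
  by rewrite fr LD.
by rewrite fz.
Qed.

(** [tliftZ] leaves a scalar of [u] on the leg [x]; moving it on to [v] takes balance in [(x, v)]
    with [y] fixed, while balance in [(x, y)] makes the inner lift well defined. *)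
Lemma balanced_tlift_l (X Y : lmodType K) (F : U -> tens X Y) (f : X -> Y -> V -> Z) :
  linear F -> (forall v, balanced (fun x y => f x y v)) ->
  (forall y, balanced (fun x v => f x y v)) ->
  balanced (fun u v => tlift (fun x y => f x y v) (F u)).
Proof.
move=> Fl f12 f13.
split=> [u u' v|u v v'|c u v].
- by rewrite (linear_predD Fl) tliftD.
- by rewrite -tlift_addf; apply: eq_tlift => x y; have [_ -> _] := f13 y.
- rewrite (linear_predZ _ _ Fl) tliftZ //; apply: eq_tlift => x y.
  by have [_ _ ->] := f13 y.
Qed.

Lemma balanced_tlift_r (X Y : lmodType K) (F : V -> tens X Y) (f : U -> X -> Y -> Z) :
  linear F -> (forall u, balanced (f u)) ->
  (forall y, balanced (fun u x => f u x y)) ->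
  balanced (fun u v => tlift (f u) (F v)).
Proof.
move=> Fl f12 f13.
split=> [u u' v|u v v'|c u v].
- by rewrite -tlift_addf; apply: eq_tlift => x y; have [-> _ _] := f13 y.
- by rewrite (linear_predD Fl) tliftD.
- rewrite (linear_predZ _ _ Fl) tliftZ //; apply: eq_tlift => x y.
  by have [_ _ ->] := f13 y.
Qed.

End Balanced.

Lemma linear_tlift (U V W : lmodType K) (f : U -> V -> W) :
  balanced f -> (forall c u v, f (c *: u) v = c *: f u v) -> linear (tlift f).
Proof.
move=> fb fZ c x y; rewrite tliftD // tliftZ //; congr (_ + _).
rewrite [RHS](raddf_tlift (L := fun z => c *: z)); last exact: scalerDr.
exact: eq_tlift.
Qed.

Lemma tens_linear_eq (U V W : lmodType K) (f g : tens U V -> W) :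
  {morph f : x y / x + y} -> {morph g : x y / x + y} ->
  (forall u v, f (u ⊗ v) = g (u ⊗ v)) -> f =1 g.
Proof.
move=> fD gD fg; elim/tens_ind => [|x y fgx fgy|//].
  have f0 : f 0 = 0 by apply: (addrI (f 0)); rewrite -fD !addr0.
  by rewrite f0; apply: (addrI (g 0)); rewrite -gD !addr0.
by rewrite fD gD fgx fgy.
Qed.

Lemma tmap_linear (U V X Y : lmodType K) (f : {linear U -> X}) (g : {linear V -> Y}) :
  linear (tmap f g : tens U V -> tens X Y).
Proof.
apply: linear_tlift => [|c u v]; last by rewrite linearZ tpureZ.
split=> [a a' b|a b b'|c a b].
- by rewrite raddfD tpureDl.
- by rewrite raddfD tpureDr.
- by rewrite !linearZ tpureZ tpureZr.
Qed.

(* Lets coassociativity be used as in Sweedler's notation. *)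
Lemma coassocE (X A : lmodType K) (Z : zmodType) (F : {linear X -> tens X A})
    (D : {linear A -> tens A A}) (x : X) (f : X -> A -> A -> Z) :
  tmap id D (F x) = tassoc (tmap F id (F x)) ->
  (forall a, balanced (fun x b => f x b a)) -> (forall x, balanced (f x)) ->
  tlift (fun x' a => tlift (f x') (D a)) (F x) =
  tlift (fun x' a => tlift (fun x'' b => f x'' b a) (F x')) (F x).
Proof.
move=> /(congr1 (tlift (fun y => tlift (f y)))) FD f12 f23.
have ob : balanced (fun y => tlift (f y)).
  split=> [u u' v|u v v'|c u v].
  - by rewrite -tlift_addf; apply: eq_tlift => a b; have [-> _ _] := f12 b.
  - by rewrite tliftD.
  - by rewrite tliftZ //; apply: eq_tlift => a b; have [_ _ ->] := f12 b.
move: FD; rewrite tlift_tmap // => ->.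
have ab (w : A) : balanced (fun (u : X) (v : A) => u ⊗ (v ⊗ w)).
  by split=> [? ? ?|? ? ?|? ? ?]; rewrite ?tpureDl ?tpureDr // ?tpureZ !tpureZr.
have ab2 : balanced (fun (y : tens X A) (w : A) => tlift (fun u v => u ⊗ (v ⊗ w)) y).
  split=> [u u' v|u v v'|c u v]; rewrite ?tliftD //.
    by rewrite -tlift_addf; apply: eq_tlift => a b; rewrite !tpureDr.
  by rewrite tliftZ //; apply: eq_tlift => a b; rewrite tpureZ !tpureZr.
rewrite /tassoc tlift_tmap // tlift_tlift //; apply: eq_tlift => y a.
by rewrite tlift_tlift //; apply: eq_tlift => y' a'; rewrite !tlift_pure.
Qed.

End TensorLemmas.

(** * Invariance of the state and the product of pure tensors *)

Lemma linear_formZ (K : comNzRingType) (U : lmodType K) (f : {linear U -> K^o}) k u :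
  f (k *: u) = (k * f u : K).
Proof. exact: linearZ. Qed.

Section Invariance.
Variables (R : realType) (G : cmqg (cplx R)) (P : qpb G).
Local Notation C := (cplx R).
Implicit Types (b : P) (c : G).

Lemma total_state_linear : linear (@total_state R G P : P -> C^o).
Proof. by move=> c x y; rewrite total_stateP. Qed.

Lemma total_stateZ (k : C) b : total_state (k *: b) = k * total_state b.
Proof. exact: (linear_predZ _ _ total_state_linear). Qed.

(** Right invariance of the integral over the fibres, from coassociativity of F and left invariance
    of h. The G-leg is tested against a functional [f], so that the identity stays inside the
    base. *)
Lemma fiber_int_inv (f : {linear G -> C^o}) b :
  fiber_int P (tlift (fun b0 c => (f c : C) *: b0) (bcoact P b)) = (f 1 : C) *: fiber_int P b.
Proof.
have hb : balanced (fun (b0 : P) c => (haar G c : C) *: b0).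
  split=> [? ? ?|? ? ?|k ? ?]; first by rewrite scalerDr.
    by rewrite raddfD scalerDl.
  by rewrite linear_formZ scalerA mulrC.
apply: (@incl_inj R G P); rewrite fiber_intE linearZ /= fiber_intE.
rewrite (@raddf_tlift _ _ _ _ _ (bcoact P)); last exact: raddfD.
rewrite tlift_tlift //.
under eq_tlift => x a.
  rewrite linearZ /= tliftZ //.
  over.
rewrite (raddf_tlift (L := fun z => (f 1 : C) *: z)); last exact: scalerDr.
apply: etrans (esym (coassocE
  (f := fun y a' a => (haar G a' : C) *: ((f a : C) *: y)) (bcoact_assoc b) _ _)) _.
- move=> a; split=> [? ? ?|? ? ?|k ? ?]; first by rewrite !scalerDr.
    by rewrite raddfD scalerDl.
  by rewrite linear_formZ !scalerA [_ * k]mulrC mulrA.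
- move=> y; split=> [? ? ?|? ? ?|k ? ?]; first by rewrite raddfD scalerDl.
    by rewrite raddfD scalerDl scalerDr.
  by rewrite !linear_formZ !scalerA mulrCA mulrA.
- apply: eq_tlift => y a.
  (* The scalar h(a^(1)) f(a^(2)) is [f] applied to the element h(a^(1)) a^(2), which left
     invariance turns into h(a) 1. *)
  have -> : tlift (fun a' a0 => (haar G a' : C) *: ((f a0 : C) *: y)) (cop G a) =
      (f (tlift (fun a' a0 => (haar G a' : C) *: a0) (cop G a)) : C) *: y.
    rewrite (raddf_tlift (L := fun z : G => (f z : C) *: y)).
      by apply: eq_tlift => a' a0; rewrite linear_formZ scalerA.
    by move=> u v; rewrite raddfD scalerDl.
  by rewrite haar_invl linear_formZ scalerA mulrC.
Qed.

(* The Haar state is faithful, so the functionals [h(d^* -)] separate points. *)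
Lemma total_state_inv b :
  tlift (fun b0 c => (total_state b0 : C) *: c) (bcoact P b) = (total_state b : C) *: 1.
Proof.
apply/eqP; rewrite -subr_eq0; apply/eqP; set d := _ - _.
pose f0 (c : G) : C^o := haar G (star d * c).
have fl : linear f0 by move=> k x y; rewrite /f0 mulrDr -scalerAr linearP.
have [f fE] : {f : {linear G -> C^o} | f =1 f0}.
  pose f : {linear G -> C^o} := HB.pack f0 (GRing.isLinear.Build _ _ _ _ f0 fl).
  by exists f.
apply: haar_eq0; rewrite -/(f0 d) -fE /d linearB /= linear_formZ.
rewrite (@raddf_tlift _ _ _ _ _ f); last exact: raddfD.
have /esym : total_state (tlift (fun b0 c => (f c : C) *: b0) (bcoact P b)) =
    f 1 * total_state b by rewrite /total_state fiber_int_inv !linearZ.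
rewrite mulrC => ->; apply/eqP; rewrite subr_eq0; apply/eqP.
rewrite (@raddf_tlift _ _ _ _ _ (@total_state R G P)); last first.
  exact: (linear_predD total_state_linear).
by apply: eq_tlift => x a; rewrite linear_formZ total_stateZ mulrC.
Qed.

End Invariance.

(** * Involution and scalars on tensor products of algebras *)

Section TensorAlgebraLemmas.
Variables (C : numClosedFieldType).

Lemma tlift_tensM (A B : algType C) (Z : zmodType) (f : A -> B -> Z) (x y : tens A B) :
  balanced f ->
  tlift f (x * y) = tlift (fun u v => tlift (fun u' v' => f (u * u') (v * v')) y) x.
Proof.
move=> fb; rewrite [x * y]/(tmul x y) /tmul tlift_tlift //; apply: eq_tlift => u v.
by rewrite tlift_tlift //; apply: eq_tlift => u' v'; rewrite tlift_pure.
Qed.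

Lemma balanced_star (A B : starAlgType C) (Z : zmodType) (f : A -> B -> Z) :
  balanced f -> balanced (fun u v => f (star u) (star v)).
Proof.
move=> [fl fr fz]; split=> [? ? ?|? ? ?|k ? ?]; first by rewrite starD fl.
  by rewrite starD fr.
by rewrite !starZ fz.
Qed.

Lemma tlift_tstar (A B : starAlgType C) (Z : zmodType) (f : A -> B -> Z) (x : tens A B) :
  balanced f -> tlift f (tstar x) = tlift (fun u v => f (star u) (star v)) x.
Proof. exact: tlift_tmap. Qed.

Lemma tstar_pure (A B : starAlgType C) (a : A) (b : B) :
  tstar (a ⊗ b) = star a ⊗ star b.
Proof.
rewrite /tstar /tmap tlift_pure //.
exact: (balanced_star (tpure_balanced A B)).
Qed.

Lemma tstarD (A B : starAlgType C) (x y : tens A B) : tstar (x + y) = tstar x + tstar y.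
Proof. by rewrite /tstar /tmap tliftD //; exact: (balanced_star (tpure_balanced A B)). Qed.

Lemma tstar0 (A B : starAlgType C) : tstar (0 : tens A B) = 0.
Proof. by apply: (addrI (tstar 0)); rewrite -tstarD !addr0. Qed.

Lemma tstarM (A B : starAlgType C) (x y : tens A B) : tstar (x * y) = tstar y * tstar x.
Proof.
elim/tens_ind: x => [|x x' hx hx'|a b]; first by rewrite mul0r tstar0 mulr0.
  by rewrite mulrDl !tstarD mulrDr hx hx'.
elim/tens_ind: y => [|y y' hy hy'|a' b']; first by rewrite mulr0 tstar0 mul0r.
  by rewrite mulrDr !tstarD mulrDl hy hy'.
by rewrite tensM !tstar_pure tensM !starM.
Qed.

Lemma tensZl (A B : algType C) k (x y : tens A B) : (k *: x) * y = k *: (x * y).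
Proof.
elim/tens_ind: x => [|x x' hx hx'|a b]; first by rewrite scaler0 mul0r scaler0.
  by rewrite scalerDr !mulrDl hx hx' scalerDr.
elim/tens_ind: y => [|y y' hy hy'|a' b']; first by rewrite !mulr0 scaler0.
  by rewrite !mulrDr hy hy' scalerDr.
by rewrite -tpureZ !tensM -scalerAl tpureZ.
Qed.

Lemma tensZr (A B : algType C) k (x y : tens A B) : x * (k *: y) = k *: (x * y).
Proof.
elim/tens_ind: x => [|x x' hx hx'|a b]; first by rewrite !mul0r scaler0.
  by rewrite !mulrDl hx hx' scalerDr.
elim/tens_ind: y => [|y y' hy hy'|a' b']; first by rewrite scaler0 mulr0 scaler0.
  by rewrite scalerDr !mulrDr hy hy' scalerDr.
by rewrite -tpureZ !tensM -scalerAr tpureZ.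
Qed.

Lemma star0 (A : starAlgType C) : star (0 : A) = 0.
Proof. by apply: (addrI (star 0)); rewrite -starD !addr0. Qed.

Lemma star1 (A : starAlgType C) : star (1 : A) = 1.
Proof. by rewrite -[LHS]mulr1 -{2}[1]starK -starM mulr1 starK. Qed.

Lemma star_sum (A : starAlgType C) I (r : seq I) (F : I -> A) :
  star (\sum_(i <- r) F i) = \sum_(i <- r) star (F i).
Proof. exact: (big_morph _ (@starD C A) (star0 A)). Qed.

End TensorAlgebraLemmas.

(** * Products of horizontal forms and the value of the form on pure tensors *)

Section HorizontalProduct.
Variables (R : realType) (G : cmqg (cplx R)) (P : qpb G) (V : coord_space G).
Variables (M : quantum_metric V) (E : exterior_algebra M).
Local Notation C := (cplx R).
Local Notation W := (ext E).
Local Notation hor := (tens P W).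

Lemma wcircM (x : W) (a b : G) : wcirc x (a * b) = wcirc (wcirc x a) b.
Proof. by have [x' ->] := ext_pi_surj x; rewrite !wcirc_pi tcircM. Qed.

Lemma wcirc1 (x : W) : wcirc x (1 : G) = x.
Proof. by have [x' ->] := ext_pi_surj x; rewrite !wcirc_pi tcirc1. Qed.

Lemma hor_mulDl (x y z : hor) : hor_mul (x + y) z = hor_mul x z + hor_mul y z.
Proof.
rewrite /hor_mul tliftD //.
split=> [u u' v|u v v'|c u v]; rewrite -?tlift_addf; apply: eq_tlift => bb ee.
- by rewrite -tlift_addf; apply: eq_tlift => bk ck; rewrite mulrDl tpureDl.
- by rewrite -tlift_addf; apply: eq_tlift => bk ck; rewrite wcircDl mulrDl tpureDr.
- by apply: eq_tlift => bk ck; rewrite wcircZl -!scalerAl tpureZ tpureZr.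
Qed.

Lemma hor_mulDr (x y z : hor) : hor_mul x (y + z) = hor_mul x y + hor_mul x z.
Proof.
rewrite /hor_mul -tlift_addf; apply: eq_tlift => q th; rewrite tliftD //.
apply: (balanced_tlift_l (F := bcoact P)
  (f := fun bk ck et => (q * bk) ⊗ (wcirc th ck * et))); first exact: linearP.
- move=> et; split=> [u u' v|u v v'|c u v].
  + by rewrite mulrDr tpureDl.
  + by rewrite wcircDr mulrDl tpureDr.
  + by rewrite wcircZr -scalerAl -scalerAr tpureZ tpureZr.
- move=> c; split=> [u u' v|u v v'|k u v].
  + by rewrite mulrDr tpureDl.
  + by rewrite mulrDr tpureDr.
  + by rewrite -!scalerAr tpureZ tpureZr.
Qed.

Lemma hor_starD (x y : hor) : hor_star (x + y) = hor_star x + hor_star y.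
Proof.
rewrite /hor_star tliftD //.
apply: (balanced_tlift_l (F := bcoact P)
  (f := fun bk ck th => star bk ⊗ wcirc (star th) (star ck) : hor)); first exact: linearP.
- move=> th; split=> [u u' v|u v v'|c u v].
  + by rewrite starD tpureDl.
  + by rewrite starD wcircDr tpureDr.
  + by rewrite !starZ wcircZr tpureZ tpureZr.
- move=> a; split=> [u u' v|u v v'|c u v].
  + by rewrite starD tpureDl.
  + by rewrite starD wcircDl tpureDr.
  + by rewrite !starZ wcircZl tpureZ tpureZr.
Qed.

Lemma hor_hodgeD (x y : hor) : hor_hodge (x + y) = hor_hodge x + hor_hodge y.
Proof. exact: (linear_predD (tmap_linear (idfun : {linear P -> P}) (hodge E))). Qed.

Lemma hor_intD (x y : hor) : hor_int (x + y) = hor_int x + hor_int y.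
Proof.
rewrite /hor_int tliftD //; split=> [u u' v|u v v'|c u v].
- by rewrite (linear_predD (@total_state_linear _ _ _)) scalerDl.
- by rewrite raddfD scalerDr.
- by rewrite total_stateZ [vol_coef _ (_ *: _)]linearZ /= scalerA mulrC.
Qed.

Lemma hor_dotDl (x y z : hor) : hor_dot (x + y) z = hor_dot x z + hor_dot y z.
Proof. by rewrite /hor_dot hor_starD hor_mulDl hor_intD. Qed.

Lemma hor_dotDr (x y z : hor) : hor_dot x (y + z) = hor_dot x y + hor_dot x z.
Proof. by rewrite /hor_dot hor_hodgeD hor_mulDr hor_intD. Qed.

Lemma hor_dot_pure (b q : P) (th et : W) :
  hor_dot (b ⊗ th) (q ⊗ et) = total_state (star b * q) *: wedge_dot th et.
Proof.
(* [L] gathers all that depends on the G-leg: acting on th^* by c_k^* and then by d_l is acting by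
   c_k^* d_l, which is the G-leg of F(b^* q). *)
pose L (a : G) := vol_coef E (wcirc (star th) a * hodge E et).
have LD : {morph L : a a' / a + a'}.
  by move=> a a'; rewrite /L wcircDr mulrDl raddfD.
have LZ k a : L (k *: a) = k *: L a by rewrite /L wcircZr -scalerAl linearZ.
have Lb : balanced (fun (y : P) e => total_state y *: L e).
  split=> [u u' v|u v v'|c u v].
  - by rewrite (linear_predD (@total_state_linear _ _ _)) scalerDl.
  - by rewrite LD scalerDr.
  - by rewrite total_stateZ LZ scalerA mulrC.
transitivity (tlift (fun y e => total_state y *: L e) (bcoact P (star b * q))).
  rewrite rmorphM /= bcoact_star tlift_tensM // tlift_tstar; last first.
    apply: balanced_tlift => x y; split=> [u u' v|u v v'|c u v].
    - by rewrite mulrDl (linear_predD (@total_state_linear _ _ _)) scalerDl.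
    - by rewrite mulrDl LD scalerDr.
    - by rewrite -!scalerAl total_stateZ LZ scalerA mulrC.
  rewrite /hor_dot hor_hodge_pure hor_star_pure.
  rewrite (raddf_tlift (L := fun z => hor_mul z _)); last by move=> ? ?; apply: hor_mulDl.
  rewrite (raddf_tlift _ _ hor_intD); apply: eq_tlift => b0 c.
  rewrite hor_mul_pure (raddf_tlift _ _ hor_intD); apply: eq_tlift => q0 d.
  by rewrite hor_int_pure /L wcircM.
transitivity (L (tlift (fun b0 c => (total_state b0 : C) *: c) (bcoact P (star b * q)))).
  by rewrite (raddf_tlift _ _ LD); apply: eq_tlift => b0 c; rewrite LZ.
(* Invariance replaces the G-leg by 1, so the twist disappears, and the defining property of the
   Hodge operator turns j(th^*, star et) into g_wedge(th^*, et). *)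
rewrite total_state_inv LZ /L wcirc1; congr (_ *: _).
by have [_ hE] := hodgeP E; rewrite /wedge_dot hE.
Qed.

End HorizontalProduct.

(** * Antipode and involution *)

Section Antipode.
Variables (C : numClosedFieldType) (G : cmqg C).
Local Notation S := (antipode G).
Local Notation eps := (counit G).

Lemma copM_assocE (Z : zmodType) (f : G -> G -> G -> Z) a :
  (forall c, balanced (fun x b => f x b c)) -> (forall x, balanced (f x)) ->
  tlift (fun x c => tlift (f x) (cop G c)) (cop G a) =
  tlift (fun x c => tlift (fun y b => f y b c) (cop G x)) (cop G a).
Proof. by move=> f12 f23; apply: coassocE => //; exact: cop_assoc. Qed.

(** In the convolution algebra of maps from G to B, f = f * (g * h) = (f * g) * h = h. The central
    map [iota] supplies the scalars, so that B may be any ring: [tens G G] and a matrix ring over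
    Sigma are the two cases needed. *)
Lemma convolution_inverse_uniq (B : pzRingType) (iota : C -> B) (f g h : G -> B) :
  (forall k x, iota k * x = x * iota k) ->
  {morph f : a b / a + b} -> (forall k a, f (k *: a) = iota k * f a) ->
  {morph g : a b / a + b} -> (forall k a, g (k *: a) = iota k * g a) ->
  {morph h : a b / a + b} -> (forall k a, h (k *: a) = iota k * h a) ->
  (forall a, tlift (fun u v => f u * g v) (cop G a) = iota (eps a)) ->
  (forall a, tlift (fun u v => g u * h v) (cop G a) = iota (eps a)) ->
  f =1 h.
Proof.
move=> iC fD fZ gD gZ hD hZ fg gh a.
have bM (p q : G -> B) : {morph p : a b / a + b} -> (forall k a, p (k *: a) = iota k * p a) ->
    {morph q : a b / a + b} -> (forall k a, q (k *: a) = iota k * q a) ->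
    balanced (fun u v => p u * q v).
  move=> pD pZ qD qZ; split=> [u u' v|u v v'|k u v]; rewrite ?pD ?mulrDl ?qD ?mulrDr //.
  by rewrite pZ qZ iC mulrA.
transitivity (tlift (fun x c => tlift (fun y b => f x * g y * h b) (cop G c)) (cop G a)).
  rewrite -{1}(cop_counitr a) (raddf_tlift _ _ fD); apply: eq_tlift => x c.
  rewrite fZ iC -gh (raddf_tlift (L := fun z => f x * z)); last exact: mulrDr.
  by apply: eq_tlift => y b; rewrite mulrA.
rewrite copM_assocE.
- rewrite -[in RHS](cop_counitl a) (raddf_tlift _ _ hD); apply: eq_tlift => x c.
  rewrite hZ -fg (raddf_tlift (L := fun z => z * h c)) //.
  by move=> ? ?; rewrite mulrDl.
- move=> c; apply: (balanced_comp (L := fun z => z * h c)); last exact: bM.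
  by move=> ? ?; rewrite mulrDl.
- move=> x; split=> [u u' v|u v v'|k u v].
  + by rewrite gD mulrDr mulrDl.
  + by rewrite hD mulrDr.
  + by rewrite gZ hZ iC !mulrA.
Qed.

(** The counit applied to S(a^(1)) a^(2) = eps(a) 1 gives eps(S(a^(1))) eps(a^(2)) = eps(a), and the
    left side is eps(S(a)) by the counit axiom. *)
Lemma counit_antipode a : eps (S a) = eps a.
Proof.
have /(congr1 eps) := antipodel a.
rewrite linear_formZ rmorph1 mulr1 => <-; rewrite -{1}(cop_counitr a).
rewrite (raddf_tlift (L := fun z => eps (S z))); last by move=> ? ?; rewrite !raddfD.
rewrite (raddf_tlift (L := eps)); last exact: raddfD.
by apply: eq_tlift => x c; rewrite linearZ linear_formZ rmorphM mulrC.
Qed.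

(** Both sides are convolution inverses of the coproduct in [tens G G]: the flipped map is a left
    inverse, the coproduct after S a right one. *)
Lemma cop_antipode a :
  cop G (S a) = tlift (fun a1 a2 => S a2 ⊗ S a1) (cop G a).
Proof.
have Sb : balanced (fun a1 a2 : G => S a2 ⊗ S a1).
  split=> [u u' v|u v v'|k u v].
  - by rewrite raddfD tpureDr.
  - by rewrite raddfD tpureDl.
  - by rewrite !linearZ tpureZ tpureZr.
pose f a : tens G G := tlift (fun a1 a2 => S a2 ⊗ S a1) (cop G a).
have fl : linear f.
  move=> k x y; rewrite /f linearP; apply: linear_tlift => // c u v.
  by rewrite linearZ tpureZr.
pose iota (k : C) : tens G G := k *: (1 ⊗ 1).
have iC k x : iota k * x = x * iota k by rewrite /iota tensZl tensZr -!tens1 mul1r mulr1.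
have iE k x : k *: x = iota k * x by rewrite /iota tensZl -tens1 mul1r.
apply: esym; move: a; apply: (convolution_inverse_uniq (iota := iota) (g := cop G)) => //.
- exact: linear_predD fl.
- by move=> k a; rewrite -iE; exact: linear_predZ fl.
- exact: raddfD.
- by move=> k a; rewrite -iE linearZ.
- by move=> ? ?; rewrite !raddfD.
- by move=> k a; rewrite -iE !linearZ.
(* In Sweedler notation this is S(a^(2)) a^(3) ⊗ S(a^(1)) a^(4), with x, y, z, d standing for the
   four legs in order. *)
- move=> a; transitivity (tlift (fun x c => tlift (fun y b =>
      tlift (fun z d => (S y * z) ⊗ (S x * d)) (cop G b)) (cop G c)) (cop G a)).
    have eqf x : (fun y b => tlift (fun z d => (S y * z) ⊗ (S x * d) : tens G G) (cop G b)) =2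
       (fun y b => (S y ⊗ S x) * cop G b).
      move=> y b; rewrite {2}[cop G b]tens_seqE mulr_sumr; apply: eq_bigr => p _.
      by rewrite tensM.
    rewrite copM_assocE.
    + apply: eq_tlift => x c; rewrite /f (raddf_tlift (L := fun z => z * _)).
        by apply: eq_tlift => y b; rewrite eqf.
      by move=> ? ?; rewrite mulrDl.
    + move=> c; split=> [u u' v|u v v'|k u v]; rewrite !eqf.
      * by rewrite raddfD tpureDr mulrDl.
      * by rewrite raddfD tpureDl mulrDl.
      * by rewrite !linearZ tpureZ tpureZr.
    + move=> x; split=> [u u' v|u v v'|k u v]; rewrite !eqf.
      * by rewrite raddfD tpureDl mulrDl.
      * by rewrite raddfD mulrDr.
      * by rewrite !linearZ tpureZ tensZr tensZl.
  (* The inner pair S(a^(2)) a^(3) collapses to a counit; the outer pair S(a^(1)) a^(2) that remains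
     collapses next. *)
  transitivity (tlift (fun x c => 1 ⊗ (S x * c) : tens G G) (cop G a)).
    apply: eq_tlift => x c; rewrite copM_assocE.
    + transitivity (tlift (fun y b => (eps y : C) *: (1 ⊗ (S x * b) : tens G G)) (cop G c)).
        apply: eq_tlift => y b; rewrite -tpureZ -antipodel.
        rewrite (raddf_tlift (L := fun z => z ⊗ _)) // => ? ?; exact: tpureDl.
      rewrite -{2}(cop_counitl c) (raddf_tlift (L := fun z => 1 ⊗ (S x * z))).
        by apply: eq_tlift => y b; rewrite -scalerAr tpureZr.
      by move=> ? ?; rewrite mulrDr tpureDr.
    + move=> d; split=> [u u' v|u v v'|k u v].
      * by rewrite raddfD mulrDl tpureDl.
      * by rewrite mulrDr tpureDl.
      * by rewrite linearZ -scalerAl -scalerAr.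
    + move=> y; split=> [u u' v|u v v'|k u v].
      * by rewrite mulrDr tpureDl.
      * by rewrite mulrDr tpureDr.
      * by rewrite -!scalerAr tpureZ tpureZr.
  rewrite /iota -tpureZr -antipodel.
  by rewrite (raddf_tlift (L := fun z => 1 ⊗ z)) // => ? ?; exact: tpureDr.
- move=> a; transitivity (cop G ((eps a : C) *: 1)); last by rewrite linearZ rmorph1.
  rewrite -antipoder (raddf_tlift (L := cop G)); last exact: raddfD.
  by apply: eq_tlift => x c; rewrite rmorphM.
Qed.

Lemma cop_star_antipode a :
  cop G (star (S a)) = tlift (fun a1 a2 => star (S a2) ⊗ star (S a1)) (cop G a).
Proof.
rewrite cop_star cop_antipode (raddf_tlift (L := @tstar _ _ _)); last exact: tstarD.
by apply: eq_tlift => x c; rewrite tstar_pure.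
Qed.

End Antipode.

(** * The action on Sigma and the involution *)

Section ActionStar.
Variables (R : realType) (G : cmqg (cplx R)) (V : coord_space G) (M : quantum_metric V).
Local Notation C := (cplx R).
Local Notation S := (antipode G).
Local Notation eps := (counit G).

Lemma circDl (x y : V) (a : G) : circ (x + y) a = circ x a + circ y a.
Proof. by have [cl _] := circ_bilin V; rewrite (linear_predD (cl a)). Qed.
Lemma circDr (x : V) (a b : G) : circ x (a + b) = circ x a + circ x b.
Proof. by have [_ cr] := circ_bilin V; rewrite (linear_predD (cr x)). Qed.
Lemma circZl k (x : V) (a : G) : circ (k *: x) a = k *: circ x a.
Proof. by have [cl _] := circ_bilin V; rewrite (linear_predZ _ _ (cl a)). Qed.
Lemma circZr k (x : V) (a : G) : circ x (k *: a) = k *: circ x a.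
Proof. by have [_ cr] := circ_bilin V; rewrite (linear_predZ _ _ (cr x)). Qed.

Lemma scircDl (p q : Sig M) (a : G) : scirc (p + q) a = scirc p a + scirc q a.
Proof. by have [cl _] := scirc_bilin M; rewrite (linear_predD (cl a)). Qed.
Lemma scircDr (q : Sig M) (a b : G) : scirc q (a + b) = scirc q a + scirc q b.
Proof. by have [_ cr] := scirc_bilin M; rewrite (linear_predD (cr q)). Qed.
Lemma scircZl k (q : Sig M) (a : G) : scirc (k *: q) a = k *: scirc q a.
Proof. by have [cl _] := scirc_bilin M; rewrite (linear_predZ _ _ (cl a)). Qed.
Lemma scircZr k (q : Sig M) (a : G) : scirc q (k *: a) = k *: scirc q a.
Proof. by have [_ cr] := scirc_bilin M; rewrite (linear_predZ _ _ (cr q)). Qed.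
Lemma scirc_sum I (r : seq I) (F : I -> Sig M) (a : G) :
  scirc (\sum_(i <- r) F i) a = \sum_(i <- r) scirc (F i) a.
Proof.
have s0 : scirc (0 : Sig M) a = 0 by apply: (addrI (scirc 0 a)); rewrite -scircDl !addr0.
apply: (big_morph (fun q => scirc q a)) => // p q; exact: scircDl.
Qed.

Lemma circ2_pure (x y : V) (a : G) :
  circ2 (x ⊗ y) a = tlift (fun a1 a2 => circ x a1 ⊗ circ y a2) (cop G a).
Proof.
rewrite /circ2 tlift_pure //; apply: balanced_tlift => b c.
split=> [u u' v|u v v'|k u v].
- by rewrite circDl tpureDl.
- by rewrite circDl tpureDr.
- by rewrite !circZl tpureZ tpureZr.
Qed.

(* Both actions of G make Sig M a module algebra. They agree on the entries of
   the metric matrix, hence also on those of its inverse, where each of them is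
   the convolution inverse of the same map. *)
Definition scirc_alt (q : Sig M) (a : G) : Sig M := star (scirc (star q) (star (S a))).

Lemma scirc_altDl p q a : scirc_alt (p + q) a = scirc_alt p a + scirc_alt q a.
Proof. by rewrite /scirc_alt starD scircDl starD. Qed.
Lemma scirc_altDr p a b : scirc_alt p (a + b) = scirc_alt p a + scirc_alt p b.
Proof. by rewrite /scirc_alt raddfD starD scircDr starD. Qed.
Lemma scirc_altZl k q a : scirc_alt (k *: q) a = k *: scirc_alt q a.
Proof. by rewrite /scirc_alt starZ scircZl starZ conjCK. Qed.
Lemma scirc_altZr k q a : scirc_alt q (k *: a) = k *: scirc_alt q a.
Proof. by rewrite /scirc_alt linearZ starZ scircZr starZ conjCK. Qed.
Lemma scirc_alt_sum I (r : seq I) (F : I -> Sig M) (a : G) :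
  scirc_alt (\sum_(i <- r) F i) a = \sum_(i <- r) scirc_alt (F i) a.
Proof. by rewrite /scirc_alt star_sum scirc_sum star_sum. Qed.

Lemma scirc_alt1 a : scirc_alt 1 a = (eps a : C) *: 1.
Proof.
by rewrite /scirc_alt star1 scirc_unit starZ star1 counit_star conjCK counit_antipode.
Qed.

(** Two reversals cancel: the involution reverses the product of Sigma, and a |-> S(a)^* reverses
    the coproduct. *)
Lemma scirc_altM p q a :
  scirc_alt (p * q) a = tlift (fun a1 a2 => scirc_alt p a1 * scirc_alt q a2) (cop G a).
Proof.
rewrite /scirc_alt starM scirc_mul cop_star_antipode tlift_tlift; last first.
  split=> [u u' v|u v v'|k u v].
  - by rewrite scircDr mulrDl.
  - by rewrite scircDr mulrDr.
  - by rewrite !scircZr -scalerAl -scalerAr.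
rewrite (raddf_tlift (L := @star _ _)); last exact: starD.
apply: eq_tlift => x c; rewrite tlift_pure ?starM //.
split=> [u u' v|u v v'|k u v].
- by rewrite scircDr mulrDl.
- by rewrite scircDr mulrDr.
- by rewrite !scircZr -scalerAl -scalerAr.
Qed.

(** The involution swaps the arguments of g, and a |-> S(a)^* swaps the legs of the coproduct, so
    the order is restored; on each vector the rule is [circ_star]. *)
Lemma scirc_alt_met z a : scirc_alt (met M z) a = scirc (met M z) a.
Proof.
move: z; apply: tens_linear_eq => [x y|x y|x y].
- by rewrite raddfD scirc_altDl.
- by rewrite raddfD scircDl.
rewrite /scirc_alt met_star !scirc_met !circ2_pure cop_star_antipode.
rewrite tlift_tlift; last first.
  split=> [u u' v|u v v'|k u v].
  - by rewrite circDr tpureDl.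
  - by rewrite circDr tpureDr.
  - by rewrite !circZr tpureZ tpureZr.
rewrite (raddf_tlift (L := fun z => star (met M z))); last first.
  by move=> ? ?; rewrite raddfD starD.
rewrite (raddf_tlift (L := met M)); last exact: raddfD.
apply: eq_tlift => u v; rewrite tlift_pure; last first.
  split=> [? ? ?|? ? ?|k ? ?].
  - by rewrite circDr tpureDl.
  - by rewrite circDr tpureDr.
  - by rewrite !circZr tpureZ tpureZr.
by rewrite -!circ_star met_star !cstarK.
Qed.

Lemma mulmx_scalarE n (A : 'M[Sig M]_n) k :
  A *m (k%:A)%:M = ((k%:A)%:M : 'M[Sig M]_n) *m A.
Proof.
rewrite mul_scalar_mx; apply/matrixP => i j; rewrite !mxE (bigD1 j) //= mxE eqxx mulr1n.
rewrite big1 => [|l /negbTE lj]; last by rewrite mxE lj mulr0n mulr0.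
by rewrite addr0 -scalerAl -scalerAr mul1r mulr1.
Qed.

Lemma scirc_alt_inv i j a : scirc_alt (met_inv M i j) a = scirc (met_inv M i j) a.
Proof.
pose mxa (act : Sig M -> G -> Sig M) (A : 'M[Sig M]_(cs_dim V)) (a : G) :
  'M[Sig M]_(cs_dim V) := \matrix_(i, j) act (A i j) a.
pose iota (k : C) : 'M[Sig M]_(cs_dim V) := (k%:A)%:M.
have mxaD act A : (forall q a b, act q (a + b) = act q a + act q b) ->
    {morph mxa act A : a b / a + b}.
  by move=> aD x y; apply/matrixP => k l; rewrite !mxE aD.
have mxaZ act A : (forall k q a, act q (k *: a) = k *: act q a) ->
    forall k a, mxa act A (k *: a) = iota k * mxa act A a.
  move=> aZ k x; rewrite [_ * _]mul_scalar_mx; apply/matrixP => m l.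
  by rewrite !mxE aZ -scalerAl mul1r.
(* The module algebra law turns a matrix product into a convolution product, so mutually inverse
   matrices over Sigma give convolution-inverse maps from G to matrices. *)
have mxaM act A B : (forall q r a, act (q * r) a =
      tlift (fun a1 a2 => act q a1 * act r a2) (cop G a)) ->
    (forall I (r : seq I) (F : I -> Sig M) a,
       act (\sum_(i <- r) F i) a = \sum_(i <- r) act (F i) a) ->
    (forall a, act 1 a = (eps a : C) *: 1) ->
    A *m B = 1%:M ->
    forall a, tlift (fun u v => mxa act A u * mxa act B v) (cop G a) = iota (eps a).
  move=> aM asum a1 AB x; apply/matrixP => k l.
  have act0 y : act 0 y = 0.
    by have := asum void [::] (fun=> 0) y; rewrite !big_nil.
  have -> : iota (eps x) k l = act ((1%:M : 'M[Sig M]_(cs_dim V)) k l) x.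
    by rewrite !mxE; case: (k == l); rewrite ?mulr1n ?a1 ?mulr0n ?act0.
  rewrite -AB mxE asum /tlift /fsum summxE.
  under [RHS]eq_bigr => m _ do rewrite aM /tlift /fsum.
  rewrite exchange_big; apply: eq_bigr => p _.
  have -> : mxa act A p.1 * mxa act B p.2 = mxa act A p.1 *m mxa act B p.2 by [].
  rewrite mxE.
  by apply: eq_bigr => m _; rewrite !mxE.
have mxaE : mxa scirc_alt (met_mx M) =1 mxa (@scirc _ _ _ M) (met_mx M).
  by move=> x; apply/matrixP => k l; rewrite !mxE scirc_alt_met.
have := @convolution_inverse_uniq _ G _ iota (mxa scirc_alt (met_inv M))
  (mxa (@scirc _ _ _ M) (met_mx M)) (mxa (@scirc _ _ _ M) (met_inv M)).
move=> /(_ (fun k x => esym (mulmx_scalarE x k))).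
move=> /(_ (mxaD _ _ scirc_altDr) (mxaZ _ _ scirc_altZr)).
move=> /(_ (mxaD _ _ scircDr) (mxaZ _ _ scircZr) (mxaD _ _ scircDr) (mxaZ _ _ scircZr)).
(* The maps built from the metric matrix are the same for both actions; this common map has one left
   inverse from [scirc_alt] and one right inverse from [scirc]. *)
move=> h; have /(_ a) /matrixP /(_ i j) : mxa scirc_alt (met_inv M) =1 mxa (@scirc _ _ _ M) (met_inv M).
  apply: h => x.
    under eq_tlift => u v do rewrite -mxaE.
    apply: mxaM; [exact: scirc_altM|exact: scirc_alt_sum|exact: scirc_alt1|exact: met_Vmul].
  by apply: mxaM; [exact: scirc_mul|exact: scirc_sum|exact: scirc_unit|exact: met_mulV].
by rewrite !mxE.
Qed.

Lemma scirc_altE q a : scirc_alt q a = scirc q a.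
Proof.
move: q a; apply: (@Sig_gen R G V M) => [|q [i [j [->|->]]] a].
- split=> [a|p q hp hq a|k q hq a|p q hp hq a].
  + by rewrite scirc_alt1 scirc_unit.
  + by rewrite scirc_altDl scircDl hp hq.
  + by rewrite scirc_altZl scircZl hq.
  + by rewrite scirc_altM scirc_mul; apply: eq_tlift => x y; rewrite hp hq.
- by rewrite mxE scirc_alt_met.
- exact: scirc_alt_inv.
Qed.

Lemma scirc_star (q : Sig M) (a : G) : star (scirc q a) = scirc (star q) (star (S a)).
Proof. by rewrite -scirc_altE /scirc_alt starK. Qed.

End ActionStar.

(** * Positivity of operators *)

Section Sesquilinear.
Variable C : numClosedFieldType.
Variables (T Z : lmodType C) (D : T -> Prop) (s : T -> T -> Z).
Hypothesis DP : forall c x y, D x -> D y -> D (c *: x + y).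
Hypothesis sr : forall c x y z, D x -> D y -> D z -> s x (c *: y + z) = c *: s x y + s x z.
Hypothesis sl : forall c x y z, D x -> D y -> D z -> s (c *: x + y) z = c^* *: s x z + s y z.

(** Expanding s at c y + x leaves c s(x,y) + c^* s(y,x) = 0, and c = 1, c = i separate the two
    terms. [D] allows for the domain of unbounded operators, and values in a module [Z] cover
    Sigma-valued forms as well as complex ones. *)
Lemma polarization x y : (forall z, D z -> s z z = 0) -> D x -> D y -> s x y = 0.
Proof.
move=> s0 Dx Dy.
have key c : c *: s x y + c^* *: s y x = 0.
  have Dc : D (c *: y + x) by exact: DP.
  have := s0 _ Dc; rewrite sr // !sl // !s0 // !scalerDr.
  by rewrite !scaler0 add0r addr0 addrC.
have := key 1; rewrite rmorph1 !scale1r => /eqP; rewrite addr_eq0 => /eqP xy.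
have := key 'i; rewrite conjCi xy scalerN scaleNr -opprD => /eqP; rewrite oppr_eq0.
rewrite -mulr2n -scaler_nat scalerA => /eqP /(congr1 ( *:%R (2 * 'i)^-1)).
by rewrite scalerA mulVf ?mulf_neq0 ?pnatr_eq0 ?neq0Ci // scale1r scaler0 => ->; rewrite oppr0.
Qed.

End Sesquilinear.

Section PositiveForm.
Variables (C : numClosedFieldType) (T : lmodType C) (s : T -> T -> C).
Hypothesis sr : forall c x y z, s x (c *: y + z) = c * s x y + s x z.
Hypothesis sl : forall c x y z, s (c *: x + y) z = c^* * s x z + s y z.
Hypothesis s_ge0 : forall x, 0 <= s x x.

(** The difference of the two sides is again sesquilinear, and on the diagonal it vanishes because
    s(z,z) is real. *)
Lemma positive_form_herm x y : s y x = (s x y)^*.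
Proof.
apply/eqP; rewrite -subr_eq0; apply/eqP.
apply: (polarization (Z := C^o) (D := fun=> True) (s := fun y x => s y x - (s x y)^*)) => //.
- move=> c a b d _ _ _; rewrite sr sl rmorphD rmorphM /= conjCK.
  by rewrite opprD addrACA -mulrBr /GRing.scale.
- move=> c a b d _ _ _; rewrite sr sl rmorphD rmorphM /=.
  by rewrite opprD addrACA -mulrBr /GRing.scale.
- by move=> z _; rewrite (CrealP (ger0_real (s_ge0 z))) subrr.
Qed.

(** The degenerate case of Cauchy-Schwarz: along y - t s(y,x)^* x the form is affine in the real
    parameter t, hence constant if it is to stay nonnegative. *)
Lemma positive_form_null x y : s x x = 0 -> s y x = 0.
Proof.
move=> x0; apply/eqP; apply: contraT => yx0.
have n0 : 0 < `|s y x| ^+ 2 by rewrite exprn_gt0 ?normr_gt0.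
have key (t : C) : t \is Num.real -> 0 <= s y y - 2 * (t * `|s y x| ^+ 2).
  move=> tr; have := s_ge0 (- (t * (s y x)^*) *: x + y).
  rewrite sr !sl x0 mulr0 add0r (positive_form_herm y x) rmorphN rmorphM /= conjCK.
  rewrite (CrealP tr); congr (0 <= _); rewrite normCK; ring.
have yr : s y y \is Num.real by exact: ger0_real.
(* This t makes the affine function equal to -1. *)
have := key ((s y y + 1) / (2 * `|s y x| ^+ 2)).
rewrite ger0_real; last by rewrite divr_ge0 ?addr_ge0 ?mulr_ge0 ?exprn_ge0 ?normr_ge0.
rewrite mulrCA -mulrA mulVf ?mulr1; last by rewrite mulf_neq0 ?pnatr_eq0 ?lt0r_neq0.
by rewrite opprD addrA subrr add0r oppr_ge0 ler10 => /(_ isT).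
Qed.

End PositiveForm.

(** * Summation over the integers and the scalar product of l^2 *)

Section Summation.
Import numFieldNormedType.Exports.
Variable R : realType.
Local Notation C := (cplx R).
Local Open Scope classical_set_scope.

Implicit Types f g : int -> R.

Lemma zsumD (f g : int -> R) : zsum (fun k => f k + g k) = zsum f \+ zsum g.
Proof. by apply/funext => n; rewrite /zsum /= -big_split; apply: eq_bigr => k _; rewrite addrACA. Qed.

Lemma zsumZ (c : R) (f : int -> R) : zsum (fun k => c * f k) = (fun n => c * zsum f n).
Proof. by apply/funext => n; rewrite /zsum mulr_sumr; apply: eq_bigr => k _; rewrite mulrDr. Qed.

(** A limit [limn] carries no information without convergence, so the algebra of sums below goes
    through this predicate. *)
Definition zsummable (f : int -> R) := cvgn (zsum f).

Lemma zsummableD f g : zsummable f -> zsummable g -> zsummable (fun k => f k + g k).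
Proof. by move=> cf cg; rewrite /zsummable zsumD; apply: is_cvgD. Qed.

Lemma zsummableZ c f : zsummable f -> zsummable (fun k => c * f k).
Proof. by move=> cf; rewrite /zsummable zsumZ; apply: is_cvgMl_tmp. Qed.

Lemma zsum_series f : zsum f = series (fun k => f (Posz k) + f (Negz k)).
Proof. by apply/funext => n; rewrite /zsum /series /= big_mkord. Qed.

Lemma zsummable_le f g : (forall k, `|f k| <= g k) -> zsummable g -> zsummable f.
Proof.
move=> fg; rewrite /zsummable !zsum_series => cg; apply: normed_cvg.
apply: series_le_cvg cg => n.
- by rewrite normr_ge0.
- by rewrite addr_ge0 // (le_trans _ (fg _)).
- by rewrite (le_trans (ler_normD _ _)) // lerD.
Qed.

Lemma lim_zsumD f g : zsummable f -> zsummable g ->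
  limn (zsum (fun k => f k + g k)) = limn (zsum f) + limn (zsum g).
Proof. by move=> cf cg; rewrite zsumD; apply: limD. Qed.

Lemma lim_zsumZ c f : zsummable f ->
  limn (zsum (fun k => c * f k)) = c * limn (zsum f).
Proof. by move=> cf; rewrite zsumZ; apply: cvg_lim => //; apply: cvgMl_tmp. Qed.

Definition csummable (f : int -> C) :=
  zsummable (fun k => complex.Re (f k)) /\ zsummable (fun k => complex.Im (f k)).

Definition csum (f : int -> C) : C :=
  Complex (limn (zsum (fun k => complex.Re (f k)))) (limn (zsum (fun k => complex.Im (f k)))).

Lemma csumP c (f g : int -> C) : csummable f -> csummable g ->
  csum (fun k => c * f k + g k) = c * csum f + csum g.
Proof.
move=> [f1 f2] [g1 g2]; rewrite /csum; case: c => a b.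
have zB (h1 h2 : int -> R) u v : zsummable h1 -> zsummable h2 ->
    zsummable (fun k => u * h1 k + v * h2 k) /\
    limn (zsum (fun k => u * h1 k + v * h2 k)) = u * limn (zsum h1) + v * limn (zsum h2).
  move=> s1 s2; split; first by apply: zsummableD; apply: zsummableZ.
  by rewrite lim_zsumD ?lim_zsumZ //; apply: zsummableZ.
have [s1 e1] := zB _ _ a (- b) f1 f2; have [s2 e2] := zB _ _ a b f2 f1.
have -> : (fun k => complex.Re (Complex a b * f k + g k)) =
    (fun k => (a * complex.Re (f k) + (- b) * complex.Im (f k)) + complex.Re (g k)).
  by apply/funext => k; case: (f k) => x y; case: (g k) => z t /=; rewrite mulNr.
have -> : (fun k => complex.Im (Complex a b * f k + g k)) =
    (fun k => (a * complex.Im (f k) + b * complex.Re (f k)) + complex.Im (g k)).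
  by apply/funext => k; case: (f k) => x y; case: (g k) => z t /=; rewrite [b * x]mulrC.
rewrite (lim_zsumD s1 g1) (lim_zsumD s2 g2) e1 e2 mulNr.
by apply/eqP; rewrite eq_complex /= [b * _]mulrC !eqxx.
Qed.

Lemma csum_conj (f : int -> C) : csummable f -> csum (fun k => (f k)^*) = (csum f)^*.
Proof.
move=> [f1 f2]; rewrite /csum.
have -> : (fun k => complex.Im ((f k)^*)) = (fun k => (-1) * complex.Im (f k)).
  by apply/funext => k; case: (f k) => x y /=; rewrite mulN1r.
have -> : (fun k => complex.Re ((f k)^*)) = (fun k => complex.Re (f k)).
  by apply/funext => k; case: (f k).
by rewrite lim_zsumZ // mulN1r.
Qed.

Lemma l2_dotE (x y : int -> C) : l2_dot x y = csum (fun k => (x k)^* * y k).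
Proof. by []. Qed.

Lemma l2_csummable (x y : int -> C) : l2 x -> l2 y -> csummable (fun k => (x k)^* * y k).
Proof.
move=> lx ly; have := zsummableD lx ly => lxy.
split; apply: zsummable_le lxy => k; case: (x k) => a b; case: (y k) => c d /=.
(* For the real part ac + bd, these squares give 2 |ac + bd| <= a^2 + b^2 + c^2 + d^2; the squares
   of the next case do the same for ad - bc. *)
- have := (sqr_ge0 (a + c), sqr_ge0 (b + d), sqr_ge0 (a - c), sqr_ge0 (b - d)).
  have := (sqr_ge0 a, sqr_ge0 b, sqr_ge0 c, sqr_ge0 d).
  case=> [[[? ?] ?] ?] [[[? ?] ?] ?].
  by rewrite ler_norml; apply/andP; split; nra.
- have := (sqr_ge0 (a + d), sqr_ge0 (b + c), sqr_ge0 (a - d), sqr_ge0 (b - c)).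
  have := (sqr_ge0 a, sqr_ge0 b, sqr_ge0 c, sqr_ge0 d).
  case=> [[[? ?] ?] ?] [[[? ?] ?] ?].
  by rewrite ler_norml; apply/andP; split; nra.
Qed.

Lemma l2_dot_linear c (x y z : int -> C) : l2 x -> l2 y -> l2 z ->
  l2_dot x (c *: y + z) = c * l2_dot x y + l2_dot x z.
Proof.
move=> lx ly lz; rewrite !l2_dotE -csumP; try exact: l2_csummable.
by congr csum; apply/funext => k; rewrite mulrDr /GRing.scale /= mulrCA.
Qed.

Lemma l2_dot_conj (x y : int -> C) : l2 x -> l2 y -> l2_dot y x = (l2_dot x y)^*.
Proof.
move=> lx ly; rewrite !l2_dotE -csum_conj; last exact: l2_csummable.
by congr csum; apply/funext => k; rewrite rmorphM /= conjCK mulrC.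
Qed.

Lemma l2_dot_antilinear c (x y z : int -> C) : l2 (c *: x + y) -> l2 x -> l2 y -> l2 z ->
  l2_dot (c *: x + y) z = c^* * l2_dot x z + l2_dot y z.
Proof.
move=> lxy lx ly lz; rewrite l2_dot_conj // l2_dot_linear // rmorphD rmorphM /=.
by rewrite -!l2_dot_conj.
Qed.

Lemma l2_dot_eq0 (x : int -> C) : l2 x -> l2_dot x x = 0 -> x = 0.
Proof.
move=> lx /eqP; rewrite eq_complex /= => /andP[/eqP x0 _].
pose f k := complex.Re (x k) ^+ 2 + complex.Im (x k) ^+ 2.
have f0 k : 0 <= f k by rewrite addr_ge0 ?sqr_ge0.
have xE : (fun k => complex.Re ((x k)^* * x k)) = f.
  apply/funext => k; rewrite /f; case: (x k) => a b /=.
  by rewrite mulNr opprK !expr2.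
rewrite xE in x0.
(* The partial sums increase from 0 to the limit 0, so all of them, and hence all grouped terms,
   vanish. *)
have nd : nondecreasing_seq (zsum f).
  by apply/nondecreasing_seqP => n; rewrite /zsum big_ord_recr lerDl addr_ge0.
have le0 n : zsum f n <= 0 by rewrite -x0; apply: nondecreasing_cvgn_le.
have fz n : f (Posz n) + f (Negz n) = 0.
  apply/eqP; rewrite eq_le addr_ge0 // andbT.
  apply: le_trans (le0 n.+1); rewrite /zsum big_ord_recr /= lerDr.
  by apply: sumr_ge0 => i _; rewrite addr_ge0.
have fk k : f k = 0.
  case: k => n; move/eqP: (fz n); rewrite paddr_eq0 // => /andP[/eqP ? /eqP ?] //.
apply/funext => k; apply/eqP; rewrite eq_complex /=.
by move/eqP: (fk k); rewrite /f paddr_eq0 ?sqr_ge0 // !sqrf_eq0.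
Qed.

End Summation.

(** * Positive elements of a realized star-algebra *)

Section OperatorPositivity.
Variables (R : realType) (S : starAlgType (cplx R)) (H : realization S).
Local Notation C := (cplx R).

Let dot (q : S) (x y : int -> C) : C := l2_dot x (Defs.act H q y).

Let dot_r q c x y z : Defs.dom H x -> Defs.dom H y -> Defs.dom H z ->
  dot q x (c *: y + z) = c * dot q x y + dot q x z.
Proof.
move=> Dx Dy Dz; rewrite /dot Defs.act_linear // l2_dot_linear //; apply: (@Defs.dom_l2 R S H) => //;
exact: Defs.act_dom.
Qed.

Let dot_l q c x y z : Defs.dom H x -> Defs.dom H y -> Defs.dom H z ->
  dot q (c *: x + y) z = c^* * dot q x z + dot q y z.
Proof.
move=> Dx Dy Dz; rewrite /dot l2_dot_antilinear //; apply: (@Defs.dom_l2 R S H) => //.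
  exact: Defs.domP.
exact: Defs.act_dom.
Qed.

Lemma op_dotP c p q x : Defs.dom H x ->
  l2_dot x (Defs.act H (c *: p + q) x) = c * l2_dot x (Defs.act H p x) + l2_dot x (Defs.act H q x).
Proof.
move=> Dx; rewrite Defs.actP // l2_dot_linear //; apply: (@Defs.dom_l2 R S H) => //; exact: Defs.act_dom.
Qed.

(** Polarization gives <y, q x> = 0 for all y in the domain. The domain is stable under the action,
    so y = q x is allowed and q x = 0; the realization is faithful. *)
Lemma op_dot0_eq0 q : (forall x, Defs.dom H x -> l2_dot x (Defs.act H q x) = 0) -> q = 0.
Proof.
move=> q0; apply: (Defs.act_inj (r := H)) => x Dx; apply: l2_dot_eq0.
  by apply: (@Defs.dom_l2 R S H); apply: Defs.act_dom.
have Dy := Defs.act_dom q Dx.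
exact: (polarization (Z := C^o) (D := Defs.dom H) (s := dot q) (@Defs.domP _ _ H) (dot_r q) (dot_l q)).
Qed.

(** On the diagonal <x, q^* x> is the conjugate of <x, q x>, which is real; the quadratic form then
    determines q^* - q. *)
Lemma op_ge0_star q : op_ge0 H q -> star q = q.
Proof.
move=> q0; apply/eqP; rewrite -subr_eq0; apply/eqP; apply: op_dot0_eq0 => x Dx.
have l2q p : l2 (Defs.act H p x) by apply: (@Defs.dom_l2 R S H); apply: Defs.act_dom.
rewrite addrC -scaleN1r op_dotP // [X in _ + X]Defs.act_star // starK [X in _ + X]l2_dot_conj //; last exact: (@Defs.dom_l2 R S H).
by rewrite (CrealP (ger0_real (q0 _ Dx))) mulN1r addNr.
Qed.

Lemma op_dot0 x : Defs.dom H x -> l2_dot x (Defs.act H 0 x) = 0.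
Proof.
move=> Dx; have -> : (0 : S) = (-1) *: 0 + 0 by rewrite scaler0 addr0.
by rewrite op_dotP // mulN1r addNr.
Qed.

Lemma op_ge00 : op_ge0 H 0.
Proof. by move=> x Dx; rewrite op_dot0. Qed.

Lemma op_ge0P (c : C) p q : 0 <= c -> op_ge0 H p -> op_ge0 H q -> op_ge0 H (c *: p + q).
Proof. by move=> c0 p0 q0 x Dx; rewrite op_dotP // addr_ge0 ?mulr_ge0 ?p0 ?q0. Qed.

Lemma op_ge0_addr_eq0 (c : C) p q : 0 < c -> op_ge0 H p -> op_ge0 H q ->
  c *: p + q = 0 -> p = 0 /\ q = 0.
Proof.
move=> c0 p0 q0 pq.
have q00 : q = 0.
  apply: op_dot0_eq0 => x Dx; apply/eqP; rewrite eq_le q0 // andbT.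
  have : l2_dot x (Defs.act H (c *: p + q) x) = 0 by rewrite pq op_dot0.
  rewrite op_dotP // => /eqP; rewrite addrC addr_eq0 => /eqP ->.
  by rewrite oppr_le0 mulr_ge0 ?(ltW c0) ?p0.
split=> //; move: pq; rewrite q00 addr0 => /(congr1 ( *:%R c^-1)).
by rewrite scalerA mulVf ?gt_eqF // scale1r scaler0.
Qed.

End OperatorPositivity.

(** * Reduced words *)

Section ReducedWords.
Variable n : nat.
Implicit Types p q : 'S_n.+1.

Definition inversions p : {set 'I_n.+1 * 'I_n.+1} :=
  [set ij : 'I_n.+1 * 'I_n.+1 | (ij.1 < ij.2)%N && (p ij.2 < p ij.1)%N].

Lemma adj_tpermE i (a : 'I_n.+1) : (i < n)%N ->
  nat_of_ord (adj_tperm n.+1 i a) =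
    (if nat_of_ord a == i then i.+1 else if nat_of_ord a == i.+1 then i else a).
Proof.
move=> ltin; have vi : nat_of_ord (inord i : 'I_n.+1) = i by rewrite inordK // ltnW.
have vi1 : nat_of_ord (inord i.+1 : 'I_n.+1) = i.+1 by rewrite inordK.
rewrite /adj_tperm; case: tpermP => [->|->|/eqP ai /eqP ai1].
- by rewrite vi vi1 eqxx.
- by rewrite vi vi1 eqn_leq ltnn eqxx.
- by rewrite -[X in _ == X]vi val_eqE (negbTE ai) -[X in _ == X]vi1 val_eqE (negbTE ai1).
Qed.

Lemma adj_tpermK i : involutive (adj_tperm n.+1 i).
Proof. by rewrite /adj_tperm => a; rewrite tpermK. Qed.

Lemma adj_tperm_mono i (a b : 'I_n.+1) : (i < n)%N -> (a < b)%N ->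
  ~~ ((a == i :> nat) && (b == i.+1 :> nat)) ->
  (adj_tperm n.+1 i a < adj_tperm n.+1 i b)%N.
Proof. by move=> ltin; rewrite !adj_tpermE //; repeat case: eqP => /=; lia. Qed.

(** Applying the transposition to both coordinates maps the inversions of [adj_tperm n.+1 i * p]
    injectively to those of [p]; only the descent (i, i+1) itself is missed, since an adjacent
    transposition keeps the order of every other pair. *)
Lemma perm_len_descent p i : (i < n)%N -> (p (inord i.+1) < p (inord i))%N ->
  perm_len p = (perm_len (adj_tperm n.+1 i * p)).+1.
Proof.
move=> ltin pi; set t := adj_tperm n.+1 i; set q := (t * p)%g.
have vi : nat_of_ord (inord i : 'I_n.+1) = i by rewrite inordK // ltnW.
have vi1 : nat_of_ord (inord i.+1 : 'I_n.+1) = i.+1 by rewrite inordK.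
have qE a : q a = p (t a) by rewrite permM.
pose tt (ij : 'I_n.+1 * 'I_n.+1) := (t ij.1, t ij.2).
have ttK : involutive tt by case=> a b; rewrite /tt /= !adj_tpermK.
pose d : 'I_n.+1 * 'I_n.+1 := (inord i, inord i.+1).
have neqd (ij : 'I_n.+1 * 'I_n.+1) : ij != d ->
    ~~ ((ij.1 == i :> nat) && (ij.2 == i.+1 :> nat)).
  apply: contra => /andP[/eqP a /eqP b]; case: ij a b => /= a b ai bi.
  by apply/eqP; congr (_, _); apply: val_inj; rewrite /= ?vi ?vi1.
have -> : perm_len p = #|inversions p| by [].
have -> : perm_len q = #|inversions q| by [].
(* The preimage of [d] would be (i+1, i), which is not an increasing pair. *)
have dn : d \notin tt @: inversions q.
  apply/negP => /imsetP[ij]; rewrite inE => /andP[lt _] /(congr1 tt).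
  rewrite ttK => ijd; move: lt; rewrite -ijd /= !adj_tpermE // vi vi1.
  by repeat case: eqP => /=; lia.
have -> : inversions p = d |: (tt @: inversions q); last first.
  by rewrite cardsU1 dn card_imset //; apply: inv_inj.
apply/setP => ij; rewrite !inE.
have [->|nd] := eqVneq ij d; first by rewrite /= vi vi1 ltnSn pi.
apply/andP/imsetP => [[lt lp]|[kl]].
  exists (tt ij); last by rewrite ttK.
  by rewrite inE /= !qE !adj_tpermK lp andbT adj_tperm_mono // neqd.
rewrite inE !qE => /andP[lt lp] ijE.
have kd : kl != d.
  apply: contraTneq lp => ->; rewrite -leqNgt /t /=.
  have -> : adj_tperm n.+1 i (inord i) = inord i.+1.
    by apply: val_inj; rewrite /= adj_tpermE // vi vi1 eqxx.
  have -> : adj_tperm n.+1 i (inord i.+1) = inord i.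
    by apply: val_inj; rewrite /= adj_tpermE // vi vi1 eqxx; case: eqP => //; lia.
  exact: ltnW.
by rewrite ijE /= lp; split=> //; rewrite adj_tperm_mono // neqd.
Qed.

Lemma perm_len0 p : (forall i, (i < n)%N -> (p (inord i) < p (inord i.+1))%N) ->
  p = 1%g /\ perm_len p = 0%N.
Proof.
move=> pm; have mono (a b : 'I_n.+1) : (a < b)%N -> (p a < p b)%N.
  case: b => b lb /=; elim: b lb => // b ih lb ab.
  have -> : Ordinal lb = inord b.+1 by apply: val_inj; rewrite /= inordK.
  have lb' : (b < n.+1)%N by exact: ltnW.
  apply: leq_trans (pm b lb); rewrite ltnS.
  have -> : inord b = Ordinal lb' by apply: val_inj; rewrite /= inordK.
  move: ab; rewrite ltnS leq_eqVlt => /orP[/eqP ab|ab]; last by rewrite ltnW // ih.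
  by have -> : a = Ordinal lb' by exact: val_inj.
split; last first.
  apply/eqP; rewrite cards_eq0; apply/eqP/setP => -[a b]; rewrite !inE /=.
  by apply/negP => /andP[/mono ab]; rewrite ltnNge ltnW.
have ge (a : 'I_n.+1) : (a <= p a)%N.
  case: a => a; elim: a => // a ih la; have := ih (ltnW la) => /= h.
  by apply: leq_ltn_trans h _; apply: mono.
(* The values of [p] have the same total as the indices and dominate them termwise, so none can
   exceed its index. *)
have le (a : 'I_n.+1) : (p a <= a)%N.
  have : (\sum_(a : 'I_n.+1) a = \sum_(a : 'I_n.+1) p a)%N.
    by rewrite [LHS](reindex_inj (@perm_inj _ p)).
  rewrite (bigD1 a) //= [in RHS](bigD1 a) //= => h.
  have : (\sum_(b < n.+1 | b != a) b <= \sum_(b < n.+1 | b != a) p b)%N.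
    by apply: leq_sum => b _.
  by rewrite -(leq_add2l (p a)) -h leq_add2r.
by apply/permP => a; apply: val_inj; apply/eqP; rewrite perm1 /= eqn_leq le ge.
Qed.

End ReducedWords.

(** Sorting by adjacent transpositions: each removed descent lowers the number of inversions by
    exactly one, so the word found has minimal length. [sigma_permP] says something about a
    permutation only through such a word. *)
Lemma reduced_word_exists n (p : 'S_n) : exists s, reduced_word p s.
Proof.
case: n p => [|n] p.
  exists [::]; split=> //; first by rewrite big_nil; apply/permP; case.
  by apply/esym/eqP; rewrite cards_eq0; apply/eqP/setP => -[[]].
have [k] := ubnP (perm_len p); elim: k p => // k ih p lk.
have [/existsP[i pi]|] := boolP [exists i : 'I_n, (p (inord i.+1) < p (inord i))%N]; last first.
  rewrite negb_exists => /forallP np; have [|p1 l0] := @perm_len0 n p.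
    move=> i li; have := np (Ordinal li); rewrite -leqNgt leq_eqVlt => /orP[/eqP /val_inj|//].
    move/perm_inj => /(congr1 val); rewrite /= !inordK ?ltnS //; last exact: ltnW.
    by move/eqP; rewrite eqn_leq ltnn andbF.
  by exists [::]; split; rewrite ?big_nil ?p1 // -p1 l0.
have li := ltn_ord i; have lp := perm_len_descent li pi.
have [|s [s1 s2 s3]] := ih (adj_tperm n.+1 i * p)%g; first by rewrite -ltnS -lp.
(* [reduced_word] multiplies the reversed word, so the leftmost factor is the last letter. *)
exists (rcons s i); split.
- by rewrite all_rcons s1 andbT ltnS.
- rewrite rev_rcons big_cons -s2 mulgA.
  have -> : (adj_tperm n.+1 i * adj_tperm n.+1 i = 1)%g.
    by apply/permP => a; rewrite permM perm1 adj_tpermK.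
  by rewrite mul1g.
- by rewrite size_rcons s3 lp.
Qed.

(** * Homogeneous tensors and the antisymmetrizer *)

Section TensorDegree.
Variables (R : realType) (G : cmqg (cplx R)) (V : coord_space G) (M : quantum_metric V).
Variable T : tensor_algebra M.
Local Notation C := (cplx R).
Local Notation Sg := (Sig M).
Local Notation word := (ta_word T).
Implicit Types (n m : nat) (x y : T) (q : Sg).

Lemma word_nil : word [::] = 1.
Proof. by rewrite /ta_word big_nil. Qed.

Lemma word_cons i u : word (i :: u) = taV T (theta i) * word u.
Proof. by rewrite /ta_word big_cons. Qed.

Lemma word_cat u v : word (u ++ v) = word u * word v.
Proof. by rewrite /ta_word big_cat. Qed.

Lemma theta_span (x : V) : exists c : 'I_(cs_dim V) -> C, x = \sum_i c i *: theta i.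
Proof.
exists (fun i => coord (cs_basis V) i x).
rewrite {1}(coord_basis (cs_basisP V) (memvf x)).
by apply: eq_bigr => i _; rewrite /theta (tnth_nth 0).
Qed.

Lemma taSZ k q : taS T (k *: q) = k *: taS T q.
Proof. exact: linearZ. Qed.

Lemma taVZ k (v : V) : taV T (k *: v) = k *: taV T v.
Proof. exact: linearZ. Qed.

Lemma taV_sum I (r : seq I) (F : I -> V) :
  taV T (\sum_(i <- r) F i) = \sum_(i <- r) taV T (F i).
Proof. exact: raddf_sum. Qed.

Lemma tdeg_sum n I (r : seq I) (P : pred I) (F : I -> T) :
  (forall i, P i -> tdeg n (F i)) -> tdeg n (\sum_(i <- r | P i) F i).
Proof.
move=> Fn; apply: big_ind => //.
  by exists (fun=> 0); rewrite big1 // => u _; rewrite raddf0 mul0r.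
move=> _ _ [c ->] [d ->]; exists (fun u => c u + d u).
by rewrite -big_split; apply: eq_bigr => u _; rewrite raddfD mulrDl.
Qed.

Lemma tdeg0_ n : tdeg n (0 : T).
Proof. by exists (fun=> 0); rewrite big1 // => u _; rewrite raddf0 mul0r. Qed.

Lemma tdegD n x y : tdeg n x -> tdeg n y -> tdeg n (x + y).
Proof.
move=> xn yn; have -> : x + y = \sum_(b : bool) (if b then x else y).
  by rewrite big_bool.
by apply: tdeg_sum => -[].
Qed.

Lemma tdeg_Sl n q x : tdeg n x -> tdeg n (taS T q * x).
Proof.
move=> [c ->]; exists (fun u => q * c u); rewrite mulr_sumr.
by apply: eq_bigr => u _; rewrite rmorphM mulrA.
Qed.

Lemma tdegZ n k x : tdeg n x -> tdeg n (k *: x).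
Proof.
move=> /(tdeg_Sl (k *: 1)); by rewrite taSZ rmorph1 -scalerAl mul1r.
Qed.

Lemma tdeg_word (u : seq 'I_(cs_dim V)) : tdeg (size u) (word u).
Proof.
exists (fun v => if v == in_tuple u then 1 else 0).
rewrite (bigD1 (in_tuple u)) //= eqxx rmorph1 mul1r big1 ?addr0 //.
by move=> v /negbTE ->; rewrite raddf0 mul0r.
Qed.

Lemma tdeg_ind n (Q : T -> Prop) :
  (forall x y, Q x -> Q y -> Q (x + y)) -> Q 0 ->
  (forall q (u : n.-tuple 'I_(cs_dim V)), Q (taS T q * word u)) ->
  forall x, tdeg n x -> Q x.
Proof. by move=> QD Q0 Qw x [c ->]; apply: big_ind => // u _. Qed.

Lemma ta_ind (Q : T -> Prop) :
  (forall x y, Q x -> Q y -> Q (x + y)) -> Q 0 ->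
  (forall n x, tdeg n x -> Q x) -> forall x, Q x.
Proof.
move=> QD Q0 Qn x; have [s ->] := ta_span x; apply: big_ind => // p _.
by apply: (Qn (size p.2)); apply: tdeg_Sl; apply: tdeg_word.
Qed.

Lemma tdeg_S q : tdeg 0 (taS T q).
Proof. by rewrite -[taS T q]mulr1 -word_nil; apply: tdeg_Sl; apply: (tdeg_word [::]). Qed.

Lemma tdeg0P x : tdeg 0 x -> exists q, x = taS T q.
Proof.
move: x; apply: tdeg_ind => [_ _ [p ->] [q ->]||q u].
- by exists (p + q); rewrite raddfD.
- by exists 0; rewrite raddf0.
- by exists q; rewrite (tuple0 u) word_nil mulr1.
Qed.

Lemma tdeg_Vl n (v : V) x : tdeg n x -> tdeg n.+1 (taV T v * x).
Proof.
move: x; apply: tdeg_ind => [x y hx hy||q u].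
- by rewrite mulrDr; apply: tdegD.
- by rewrite mulr0; apply: tdeg0_.
rewrite mulrA ta_nu /tlift /fsum mulr_suml; apply: tdeg_sum => p _.
rewrite -mulrA; apply: tdeg_Sl.
have [c ->] := theta_span p.2; rewrite taV_sum mulr_suml; apply: tdeg_sum => i _.
rewrite taVZ -scalerAl -word_cons; apply: tdegZ.
by have := tdeg_word (i :: u); rewrite /= size_tuple.
Qed.

Lemma tdegM n m x y : tdeg n x -> tdeg m y -> tdeg (n + m) (x * y).
Proof.
move=> xn ym; move: x xn; apply: tdeg_ind => [x x' hx hx'||q u].
- by rewrite mulrDl; apply: tdegD.
- by rewrite mul0r; apply: tdeg0_.
rewrite -mulrA; apply: tdeg_Sl; rewrite -[in tdeg _](size_tuple u).
elim: (tval u) => [|i w ih]; first by rewrite word_nil mul1r.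
by rewrite word_cons -mulrA /=; apply: tdeg_Vl.
Qed.

Lemma tdeg_Sr n q x : tdeg n x -> tdeg n (x * taS T q).
Proof. by move=> xn; rewrite -[n]addn0; apply: tdegM => //; apply: tdeg_S. Qed.

Lemma tdeg_V (v : V) : tdeg 1 (taV T v).
Proof.
rewrite -[taV T v]mulr1 -word_nil; apply: tdeg_Vl; exact: (tdeg_word [::]).
Qed.

Lemma tdeg_VV z : tdeg 2 (taVV T z).
Proof.
rewrite /taVV /tlift /fsum; apply: tdeg_sum => p _.
exact: (tdegM (tdeg_V _) (tdeg_V _)).
Qed.

Lemma tdeg_star n x : tdeg n x -> tdeg n (star x).
Proof.
move: x; apply: tdeg_ind => [x y hx hy||q u].
- by rewrite starD; apply: tdegD.
- by rewrite star0; apply: tdeg0_.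
rewrite starM -taS_star; apply: tdeg_Sr; rewrite -[in tdeg _](size_tuple u).
elim: (tval u) => [|i w ih].
  by rewrite word_nil star1 -(rmorph1 (taS T)); apply: tdeg_S.
by rewrite word_cons starM -taV_star /= -addn1; apply: tdegM => //; apply: tdeg_V.
Qed.

(* The twisting can be inverted because the involution exchanges the two sides. *)
Lemma taSV q (v : V) : exists s : seq (V * Sg),
  taS T q * taV T v = \sum_(p <- s) taV T p.1 * taS T p.2.
Proof.
exists [seq (cstar p.2, star p.1) | p <- tseq (nu M (cstar v ⊗ star q))].
rewrite big_map -[LHS]starK starM -taS_star -taV_star ta_nu /tlift /fsum star_sum.
by apply: eq_bigr => p _; rewrite starM -taV_star -taS_star.
Qed.

(** The normal form has its coefficient in front of the first letter; [taSV] moves it behind, which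
    leaves a bare basis vector on the left. *)
Lemma tdegS_l n x : tdeg n.+1 x -> exists2 F : 'I_(cs_dim V) -> T,
  forall i, tdeg n (F i) & x = \sum_i taV T (theta i) * F i.
Proof.
pose Q x := exists2 F : 'I_(cs_dim V) -> T,
  forall i, tdeg n (F i) & x = \sum_i taV T (theta i) * F i.
have QD a b : Q a -> Q b -> Q (a + b).
  move=> [F Fn ->] [F' Fn' ->]; exists (fun i => F i + F' i).
    by move=> i; apply: tdegD.
  by rewrite -big_split; apply: eq_bigr => i _; rewrite mulrDr.
have Q0 : Q 0.
  exists (fun=> 0); first by move=> i; apply: tdeg0_.
  by rewrite big1 // => i _; rewrite mulr0.
move: x; apply: tdeg_ind => // q u.
case/tupleP: u => i u; rewrite /= word_cons mulrA.
have [s ->] := taSV q (theta i); rewrite mulr_suml; apply: (big_ind Q) => // p _.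
rewrite -mulrA; have [c ->] := theta_span p.1.
exists (fun j => c j *: (taS T p.2 * word u)).
  by move=> j; apply: tdegZ; apply: tdeg_Sl; have := tdeg_word u; rewrite size_tuple.
by rewrite taV_sum mulr_suml; apply: eq_bigr => j _; rewrite taVZ -scalerAl -scalerAr.
Qed.

Lemma tdegS_r n x : tdeg n.+1 x -> exists2 F : 'I_(cs_dim V) -> T,
  forall i, tdeg n (F i) & x = \sum_i F i * taV T (theta i).
Proof.
pose Q x := exists2 F : 'I_(cs_dim V) -> T,
  forall i, tdeg n (F i) & x = \sum_i F i * taV T (theta i).
have QD a b : Q a -> Q b -> Q (a + b).
  move=> [F Fn ->] [F' Fn' ->]; exists (fun i => F i + F' i).
    by move=> i; apply: tdegD.
  by rewrite -big_split; apply: eq_bigr => i _; rewrite mulrDl.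
have Q0 : Q 0.
  exists (fun=> 0); first by move=> i; apply: tdeg0_.
  by rewrite big1 // => i _; rewrite mul0r.
move: x; apply: tdeg_ind => // q [u /= /eqP un].
case/lastP: u un => // u i; rewrite size_rcons => -[un].
rewrite -cats1 word_cat word_cons word_nil mulr1 mulrA.
exists (fun j => if j == i then taS T q * word u else 0).
  move=> j; case: (j == i); last exact: tdeg0_.
  by apply: tdeg_Sl; rewrite -un; apply: tdeg_word.
rewrite (bigD1 i) //= eqxx big1 ?addr0 // => j /negbTE ->; exact: mul0r.
Qed.

Lemma taVV_pure (a b : V) : taVV T (a ⊗ b) = taV T a * taV T b.
Proof.
rewrite /taVV tlift_pure //; split=> [? ? ?|? ? ?|k ? ?].
- by rewrite raddfD mulrDl.
- by rewrite raddfD mulrDr.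
- by rewrite !taVZ -scalerAl -scalerAr.
Qed.

Lemma tdeg_local_ind n i (Q : T -> Prop) : (i.+1 < n)%N ->
  (forall x y, Q x -> Q y -> Q (x + y)) -> Q 0 ->
  (forall u z v, tdeg i u -> tdeg (n - i.+2) v -> Q (u * taVV T z * v)) ->
  forall x, tdeg n x -> Q x.
Proof.
move=> lin QD Q0 Qw; apply: tdeg_ind => // q u.
have su : size u = n := size_tuple u.
have li : (i < size u)%N by rewrite su ltnW.
have li1 : (i.+1 < size u)%N by rewrite su.
(* [drop_nth] needs a default letter; the word is nonempty and provides one. *)
have [j _] : exists j : 'I_(cs_dim V), true by case: (tval u) li => // j; exists j.
rewrite -(cat_take_drop i u) word_cat (drop_nth j) // (drop_nth j) //.
rewrite !word_cons [X in _ * (_ * X)]mulrA -taVV_pure !mulrA; apply: Qw.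
  by apply: tdeg_Sl; have := tdeg_word (take i u); rewrite size_take li.
by have := tdeg_word (drop i.+2 u); rewrite size_drop su.
Qed.

Definition homogeneous_decomposition x := exists N (F : 'I_N -> T),
  (forall i : 'I_N, tdeg i (F i)) /\ x = \sum_i F i.

Lemma homogeneous_decompositionP x : homogeneous_decomposition x.
Proof.
have [s ->] := ta_span x.
pose N := (\max_(p <- s) size p.2).+1.
exists N, (fun i : 'I_N => \sum_(p <- s | size p.2 == i) taS T p.1 * word p.2); split.
  by move=> i; apply: tdeg_sum => p /eqP <-; apply: tdeg_Sl; apply: tdeg_word.
under [RHS]eq_bigr do rewrite big_mkcond.
rewrite exchange_big !big_seq; apply: eq_bigr => p ps.
have pN : (size p.2 < N)%N by rewrite ltnS; apply: (leq_bigmax_seq (F := fun p : Sg * seq 'I_(cs_dim V) => size p.2)).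
rewrite (bigD1 (Ordinal pN)) //= eqxx big1 ?addr0 // => i.
by rewrite -val_eqE /= eq_sym => /negbTE ->.
Qed.

End TensorDegree.

(** * Sigma-linearity and degree of the antisymmetrizer *)

Section Antisymmetrizer.
Variables (R : realType) (G : cmqg (cplx R)) (V : coord_space G) (M : quantum_metric V).
Variable E : exterior_algebra M.
Local Notation C := (cplx R).
Local Notation T := (ten E).
Implicit Types (n m i : nat) (x y : T) (q : Sig M).

Lemma sigmaT_tdeg n i x : (i.+1 < n)%N -> tdeg n x -> tdeg n (sigmaT E i x).
Proof.
move=> lin; move: x; apply: (tdeg_local_ind lin) => [x y hx hy||u z v ui vn].
- by rewrite raddfD; apply: tdegD.
- by rewrite raddf0; apply: tdeg0_.
have -> : n = (i + 2 + (n - i.+2))%N by rewrite addn2 subnKC.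
by rewrite sigmaTP //; apply: tdegM => //; apply: tdegM => //; apply: tdeg_VV.
Qed.

(** [sigmaTP] admits every tensor of degree i with coefficients in Sigma as left factor, so [q] is
    absorbed there; on the right it joins the unrestricted factor. *)
Lemma sigmaT_Sl n i q x : (i.+1 < n)%N -> tdeg n x ->
  sigmaT E i (taS T q * x) = taS T q * sigmaT E i x.
Proof.
move=> lin; move: x; apply: (tdeg_local_ind lin) => [x y hx hy||u z v ui vn].
- by rewrite mulrDr !raddfD /= mulrDr hx hy.
- by rewrite mulr0 !raddf0 mulr0.
by rewrite !mulrA !sigmaTP ?mulrA //; apply: tdeg_Sl.
Qed.

Lemma sigmaT_Sr n i q x : (i.+1 < n)%N -> tdeg n x ->
  sigmaT E i (x * taS T q) = sigmaT E i x * taS T q.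
Proof.
move=> lin; move: x; apply: (tdeg_local_ind lin) => [x y hx hy||u z v ui vn].
- by rewrite mulrDl !raddfD /= mulrDl hx hy.
- by rewrite mul0r !raddf0 mul0r.
by rewrite -mulrA !sigmaTP // mulrA.
Qed.

Definition sigma_word (s : seq nat) x := foldr (fun i => sigmaT E i) x s.

Lemma sigma_word_linear s : linear (sigma_word s).
Proof. by move=> k x y; elim: s => //= i s ->; rewrite linearP. Qed.

Lemma sigma_word_tdeg n s x : all (fun i => i.+1 < n)%N s -> tdeg n x -> tdeg n (sigma_word s x).
Proof. by elim: s => //= i s ih /andP[li ls] xn; apply: sigmaT_tdeg => //; apply: ih. Qed.

Lemma sigma_word_Sl n s q x : all (fun i => i.+1 < n)%N s -> tdeg n x ->
  sigma_word s (taS T q * x) = taS T q * sigma_word s x.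
Proof.
elim: s => //= i s ih /andP[li ls] xn; rewrite ih //.
by rewrite (sigmaT_Sl _ li) //; apply: sigma_word_tdeg.
Qed.

Lemma sigma_word_Sr n s q x : all (fun i => i.+1 < n)%N s -> tdeg n x ->
  sigma_word s (x * taS T q) = sigma_word s x * taS T q.
Proof.
elim: s => //= i s ih /andP[li ls] xn; rewrite ih //.
by rewrite (sigmaT_Sr _ li) //; apply: sigma_word_tdeg.
Qed.

(** [sigma_perm] is a bare function known only through reduced words. One chosen word per
    permutation presents the antisymmetrizer as a combination of composites of local braidings,
    which are linear. *)
Lemma asym_wordE n : exists2 s : 'S_n -> seq nat,
  forall p, all (fun i => i.+1 < n)%N (s p) &
  forall x, tdeg n x -> asym E x = \sum_p (-1) ^+ perm_len p *: sigma_word (s p) x.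
Proof.
have [s sP] := choice (@reduced_word_exists n).
exists s => [p|x xn]; first by have [] := sP p.
rewrite (asymE xn); apply: eq_bigr => p _; congr (_ *: _).
exact: sigma_permP.
Qed.

Lemma asym_tdeg n x : tdeg n x -> tdeg n (asym E x).
Proof.
move=> xn; have [s sn ->] := asym_wordE n => //.
by apply: tdeg_sum => p _; apply: tdegZ; apply: sigma_word_tdeg.
Qed.

Lemma asym_Sl q x : asym E (taS T q * x) = taS T q * asym E x.
Proof.
move: x; apply: ta_ind => [x y hx hy||n x xn].
- by rewrite mulrDr !raddfD /= mulrDr hx hy.
- by rewrite mulr0 !raddf0 mulr0.
have [s sn asE] := asym_wordE n; rewrite !asE //; last exact: tdeg_Sl.
rewrite mulr_sumr; apply: eq_bigr => p _.
by rewrite (sigma_word_Sl _ (sn p)) // scalerAr.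
Qed.

Lemma asym_Sr q x : asym E (x * taS T q) = asym E x * taS T q.
Proof.
move: x; apply: ta_ind => [x y hx hy||n x xn].
- by rewrite mulrDl !raddfD /= mulrDl hx hy.
- by rewrite mul0r !raddf0 mul0r.
have [s sn asE] := asym_wordE n; rewrite !asE //; last exact: tdeg_Sr.
rewrite mulr_suml; apply: eq_bigr => p _.
by rewrite (sigma_word_Sr _ (sn p)) // scalerAl.
Qed.

End Antisymmetrizer.

(** * The scalar product of the exterior algebra *)

Section MetricTensors.
Variables (R : realType) (G : cmqg (cplx R)) (V : coord_space G) (M : quantum_metric V).
Variable E : exterior_algebra M.
Local Notation C := (cplx R).
Local Notation T := (ten E).
Local Notation W := (ext E).
Local Notation tm := (@tmet R G V M E).
Local Notation real := (Sig_real M).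
Implicit Types (n m : nat) (x y z : T) (q : Sig M).

Lemma tmetZl k x y : tm (k *: x) y = k *: tm x y.
Proof.
by have := tmetSl (k *: 1) x y; rewrite taSZ rmorph1 -!scalerAl !mul1r.
Qed.

Lemma tmetZr k x y : tm x (k *: y) = k *: tm x y.
Proof.
by have := tmetSr (k *: 1) x y; rewrite taSZ rmorph1 -!scalerAr !mulr1.
Qed.

Lemma tmet0r x : tm x 0 = 0.
Proof. by rewrite -(scale0r 0) tmetZr scale0r. Qed.

Lemma tmet0l x : tm 0 x = 0.
Proof. by rewrite -(scale0r 0) tmetZl scale0r. Qed.

Lemma tmet_sumr I (r : seq I) (P : pred I) x (F : I -> T) :
  tm x (\sum_(i <- r | P i) F i) = \sum_(i <- r | P i) tm x (F i).
Proof. by apply: (big_morph (tm x)) => [a b|]; [exact: tmetDr|exact: tmet0r]. Qed.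

Lemma tmet_suml I (r : seq I) (P : pred I) x (F : I -> T) :
  tm (\sum_(i <- r | P i) F i) x = \sum_(i <- r | P i) tm (F i) x.
Proof. by apply: (big_morph (tm^~ x)) => [a b|]; [exact: tmetDl|exact: tmet0l]. Qed.

Lemma tmet_SS p q : tm (taS T p) (taS T q) = p * q.
Proof.
by rewrite -[taS T p]mulr1 -[taS T q]mul1r tmetSl tmetSr tmet1 mul1r.
Qed.

(* Peels off the first letter: the metric matrix has a left inverse. *)
Lemma tmet_nondeg_deg n z : tdeg n z -> (forall y, tdeg n y -> tm y z = 0) -> z = 0.
Proof.
elim: n z => [|n ih] z zn z0.
  have [q zq] := tdeg0P zn; move: z0; rewrite zq => /(_ _ (tdeg_S _ 1)).
  by rewrite tmet_SS mul1r => ->; rewrite raddf0.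
have [F Fn zF] := tdegS_l zn.
(* Testing z against y theta_i contracts theta_i with the first letter of z, so the induction
   hypothesis applies to the combination of the F j with coefficients g(theta_i, theta_j). *)
have gF i : \sum_j taS T (met_mx M i j) * F j = 0.
  apply: ih => [|y yn]; first by apply: tdeg_sum => j _; apply: tdeg_Sl.
  have : tdeg n.+1 (y * taV T (theta i)) by rewrite -addn1; apply: tdegM => //; apply: tdeg_V.
  move/z0; rewrite zF !tmet_sumr; apply: etrans.
  by apply: eq_bigr => j _; rewrite tmet_rec mxE.
rewrite zF big1 // => k _.
suff -> : F k = 0 by rewrite mulr0.
have : \sum_i taS T (met_inv M k i) * (\sum_j taS T (met_mx M i j) * F j) = 0.
  by rewrite big1 // => i _; rewrite gF mulr0.
under eq_bigr => i _.
  rewrite mulr_sumr; under eq_bigr => j _ do rewrite mulrA -rmorphM.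
  over.
rewrite exchange_big (bigD1 k) //= -mulr_suml -raddf_sum.
have mk j : \sum_i met_inv M k i * met_mx M i j = (1%:M : 'M[Sig M]_(cs_dim V)) k j.
  by rewrite -met_Vmul mxE.
rewrite mk mxE eqxx mulr1n /= rmorph1 mul1r big1 ?addr0 // => j /negbTE jk.
by rewrite -mulr_suml -raddf_sum mk mxE eq_sym jk mulr0n raddf0 mul0r.
Qed.

Lemma tmet_nondeg z : (forall y, tm y z = 0) -> z = 0.
Proof.
have [N [F [Fn ->]]] := homogeneous_decompositionP z => z0.
rewrite big1 // => i _; apply: (tmet_nondeg_deg (Fn i)) => y yi.
rewrite -(z0 y) tmet_sumr (bigD1 i) //= big1 ?addr0 // => j ji.
by apply: (tmet_deg yi (Fn j)) => ij; move: ji; rewrite -val_eqE /= ij eqxx.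
Qed.

Definition asym_dot x y := tm (star x) (asym E y).

Lemma asym_dotDl x y z : asym_dot (x + y) z = asym_dot x z + asym_dot y z.
Proof. by rewrite /asym_dot starD tmetDl. Qed.

Lemma asym_dotDr x y z : asym_dot x (y + z) = asym_dot x y + asym_dot x z.
Proof. by rewrite /asym_dot raddfD tmetDr. Qed.

Lemma asym_dotZl k x y : asym_dot (k *: x) y = k^* *: asym_dot x y.
Proof. by rewrite /asym_dot starZ tmetZl. Qed.

Lemma asym_dotZr k x y : asym_dot x (k *: y) = k *: asym_dot x y.
Proof. by rewrite /asym_dot linearZ tmetZr. Qed.

(** Positivity is assumed in each degree only; the involution and the antisymmetrizer preserve
    degrees and g vanishes between different ones, so no cross terms appear. *)
Lemma asym_dot_ge0 x : op_ge0 real (asym_dot x x).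
Proof.
have [N [F [Fn ->]]] := homogeneous_decompositionP x.
have -> : asym_dot (\sum_i F i) (\sum_i F i) = \sum_i asym_dot (F i) (F i).
  rewrite /asym_dot star_sum tmet_suml; apply: eq_bigr => i _.
  rewrite raddf_sum tmet_sumr (bigD1 i) //= big1 ?addr0 // => j ji.
  apply: (tmet_deg (tdeg_star (Fn i)) (asym_tdeg (Fn j))) => ij.
  by move: ji; rewrite -val_eqE /= ij eqxx.
elim/big_ind: _ => [|p q hp hq|i _]; first exact: op_ge00.
  by rewrite -[p]scale1r; apply: op_ge0P.
exact: asym_pos.
Qed.

Lemma asym_dot_star x y : star (asym_dot x y) = asym_dot y x.
Proof.
apply/eqP; rewrite eq_sym -subr_eq0; apply/eqP.
apply: (polarization (D := fun=> True) (s := fun y x => asym_dot y x - star (asym_dot x y))) => //.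
- move=> c a b d _ _ _; rewrite asym_dotDr asym_dotDl asym_dotZr asym_dotZl.
  by rewrite starD starZ conjCK opprD addrACA scalerBr.
- move=> c a b d _ _ _; rewrite asym_dotDr asym_dotDl asym_dotZr asym_dotZl.
  by rewrite starD starZ opprD addrACA scalerBr.
- by move=> z _; rewrite (op_ge0_star (asym_dot_ge0 z)) subrr.
Qed.

(* Cauchy-Schwarz, applied to every vector state of the realization. *)
Lemma asym_dot_eq0 x : asym_dot x x = 0 -> asym E x = 0.
Proof.
move=> x0; apply: tmet_nondeg => y; rewrite -[y]starK.
apply: (op_dot0_eq0 (H := real)) => xi Dxi.
pose s (a b : T) : C := l2_dot xi (Defs.act real (asym_dot a b) xi).
apply: (@positive_form_null C T s _ _ _ x (star y)).
- by move=> c a b d; rewrite /s asym_dotDr asym_dotZr op_dotP.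
- by move=> c a b d; rewrite /s asym_dotDl asym_dotZl op_dotP.
- by move=> a; apply: asym_dot_ge0.
- by rewrite /s x0 op_dot0.
Qed.

Lemma wedge_dot_pi x y : wedge_dot (ext_pi E x) (ext_pi E y) = asym_dot x y.
Proof. by rewrite /wedge_dot -ext_pi_star wmetE. Qed.

Lemma wedge_dotDl (a b c : W) : wedge_dot (a + b) c = wedge_dot a c + wedge_dot b c.
Proof.
have [[a' ->] [b' ->] [c' ->]] := And3 (ext_pi_surj a) (ext_pi_surj b) (ext_pi_surj c).
by rewrite -raddfD !wedge_dot_pi asym_dotDl.
Qed.

Lemma wedge_dotDr (a b c : W) : wedge_dot a (b + c) = wedge_dot a b + wedge_dot a c.
Proof.
have [[a' ->] [b' ->] [c' ->]] := And3 (ext_pi_surj a) (ext_pi_surj b) (ext_pi_surj c).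
by rewrite -raddfD !wedge_dot_pi asym_dotDr.
Qed.

Lemma wedge_dotZl k (a b : W) : wedge_dot (k *: a) b = k^* *: wedge_dot a b.
Proof.
have [[a' ->] [b' ->]] := conj (ext_pi_surj a) (ext_pi_surj b).
by rewrite -linearZ !wedge_dot_pi asym_dotZl.
Qed.

Lemma wedge_dotZr k (a b : W) : wedge_dot a (k *: b) = k *: wedge_dot a b.
Proof.
have [[a' ->] [b' ->]] := conj (ext_pi_surj a) (ext_pi_surj b).
by rewrite -linearZ !wedge_dot_pi asym_dotZr.
Qed.

Lemma wedge_dot_star (a b : W) : star (wedge_dot a b) = wedge_dot b a.
Proof.
have [[a' ->] [b' ->]] := conj (ext_pi_surj a) (ext_pi_surj b).
by rewrite !wedge_dot_pi asym_dot_star.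
Qed.

Lemma wedge_dot_ge0 (a : W) : op_ge0 real (wedge_dot a a).
Proof. by have [a' ->] := ext_pi_surj a; rewrite wedge_dot_pi; apply: asym_dot_ge0. Qed.

(** The null tensors lie in the kernel of the antisymmetrizer, which is what the exterior algebra
    divides out. *)
Lemma wedge_dot_eq0 (a : W) : wedge_dot a a = 0 -> a = 0.
Proof.
have [a' ->] := ext_pi_surj a; rewrite wedge_dot_pi => /asym_dot_eq0 a0.
exact/ext_pi_ker.
Qed.

Lemma wedge_dotSr (a b : W) q : wedge_dot a (b * extS E q) = wedge_dot a b * q.
Proof.
have [[a' ->] [b' ->]] := conj (ext_pi_surj a) (ext_pi_surj b).
by rewrite /extS -rmorphM !wedge_dot_pi /asym_dot asym_Sr tmetSr.
Qed.

(** The involution moves q^* to the right end of a^*, [tmetSm] carries it across the metric, and the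
    antisymmetrizer commutes with left coefficients. *)
Lemma wedge_dot_adj (a b : W) q :
  wedge_dot (extS E q * a) b = wedge_dot a (extS E (star q) * b).
Proof.
have [[a' ->] [b' ->]] := conj (ext_pi_surj a) (ext_pi_surj b).
by rewrite /extS -!rmorphM !wedge_dot_pi /asym_dot starM -taS_star asym_Sl tmetSm.
Qed.

End MetricTensors.

(** * Covariance *)

Section Coaction.
Variables (R : realType) (G : cmqg (cplx R)) (V : coord_space G) (M : quantum_metric V).
Local Notation C := (cplx R).

Lemma coact2_inner (c : G) (x : V) : balanced (fun (y : V) (d : G) => (x ⊗ y) ⊗ (c * d)).
Proof.
split=> [? ? ?|? ? ?|k ? ?]; rewrite ?tpureDr ?tpureDl ?mulrDr ?tpureDr //.
by rewrite -scalerAr !tpureZr tpureZ.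
Qed.

Lemma coact2_middle (z : tens V G) :
  balanced (fun (x : V) c => tlift (fun (y : V) (d : G) => (x ⊗ y) ⊗ (c * d)) z).
Proof.
apply: balanced_tlift => a b.
split=> [? ? ?|? ? ?|k ? ?]; rewrite ?tpureDl ?tpureDr ?mulrDl ?tpureDl ?tpureDr //.
by rewrite -scalerAl !tpureZr !tpureZ.
Qed.

Lemma coact2_outer : balanced (fun x y : V =>
  tlift (fun x' c => tlift (fun y' d => (x' ⊗ y') ⊗ (c * d)) (coact V y)) (coact V x)).
Proof.
split=> [u u' v|u v v'|k u v].
- by rewrite raddfD tliftD //; apply: coact2_middle.
- rewrite -tlift_addf; apply: eq_tlift => a b.
  by rewrite raddfD tliftD //; apply: coact2_inner.
- rewrite linearZ tliftZ; last exact: coact2_middle.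
  apply: eq_tlift => a b; rewrite linearZ tliftZ; last exact: coact2_inner.
  by apply: eq_tlift => a' b'; rewrite tpureZ !tpureZr.
Qed.

Lemma coact2_pure (x y : V) : coact2 (x ⊗ y) =
  tlift (fun x' c => tlift (fun y' d => (x' ⊗ y') ⊗ (c * d)) (coact V y)) (coact V x).
Proof. by rewrite /coact2 tlift_pure //; apply: coact2_outer. Qed.

Lemma coact2D (z z' : tens V V) : coact2 (z + z') = coact2 z + coact2 z'.
Proof. by rewrite /coact2 tliftD //; apply: coact2_outer. Qed.

Variable E : exterior_algebra M.
Local Notation T := (ten E).
Local Notation W := (ext E).
Local Notation TG := (tens T G).
Local Notation tm := (@tmet R G V M E).
Implicit Types (n m i : nat) (x y : T) (q : Sig M) (X Y : TG).

Definition tVVG (a : tens (tens V V) G) : TG := tmap (taVV T) id a.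

Lemma taVV_linear : linear (taVV T).
Proof.
apply: linear_tlift => [|c u v]; last by rewrite taVZ -scalerAl.
split=> [? ? ?|? ? ?|k ? ?].
- by rewrite raddfD mulrDl.
- by rewrite raddfD mulrDr.
- by rewrite !taVZ -scalerAl -scalerAr.
Qed.

Lemma tmap_idD (U U' : lmodType C) (f : U -> U') : linear f ->
  {morph (tmap f id : tens U G -> tens U' G) : a b / a + b}.
Proof.
move=> fl a b; rewrite /tmap tliftD //; split=> [? ? ?|? ? ?|k ? ?].
- by rewrite (linear_predD fl) tpureDl.
- by rewrite tpureDr.
- by rewrite (linear_predZ _ _ fl) tpureZ tpureZr.
Qed.

Lemma tmap_id_pure (U U' : lmodType C) (f : U -> U') u (a : G) : linear f ->
  tmap f id (u ⊗ a) = f u ⊗ a.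
Proof.
move=> fl; rewrite /tmap tlift_pure //; split=> [? ? ?|? ? ?|k ? ?].
- by rewrite (linear_predD fl) tpureDl.
- by rewrite tpureDr.
- by rewrite (linear_predZ _ _ fl) tpureZ tpureZr.
Qed.

Lemma tmap_id_comp (U U' U'' : lmodType C) (f : U -> U') (g : U' -> U'') (a : tens U G) :
  linear f -> linear g -> tmap g id (tmap f id a) = tmap (fun u => g (f u)) id a.
Proof.
move=> fl gl; have gfl : linear (fun u => g (f u)) by move=> k x y; rewrite fl gl.
move: a; apply: tens_linear_eq => [a b|a b|u a].
- by rewrite !tmap_idD.
- by rewrite tmap_idD.
- by rewrite !tmap_id_pure.
Qed.

Lemma tmap_id0 (U U' : lmodType C) (f : U -> U') : linear f ->
  tmap f id (0 : tens U G) = 0.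
Proof. by move=> fl; apply: (addrI (tmap f id 0)); rewrite -tmap_idD // !addr0. Qed.

Lemma tmap_id_sum (U U' : lmodType C) (f : U -> U') I (r : seq I) (F : I -> tens U G) :
  linear f -> tmap f id (\sum_(i <- r) F i) = \sum_(i <- r) tmap f id (F i).
Proof. by move=> fl; apply: (big_morph (tmap f id)); [exact: tmap_idD|exact: tmap_id0]. Qed.

(* The additive span of the [x ⊗ a] with [x] of degree [n], encoded by its
   induction principle. *)
Definition tdegG n X := forall Q : TG -> Prop,
  Q 0 -> (forall Y Z, Q Y -> Q Z -> Q (Y + Z)) ->
  (forall x a, tdeg n x -> Q (x ⊗ a)) -> Q X.

Lemma tdegG_pure n x (a : G) : tdeg n x -> tdegG n (x ⊗ a).
Proof. by move=> xn Q _ _; apply. Qed.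

Lemma tdegGD n X Y : tdegG n X -> tdegG n Y -> tdegG n (X + Y).
Proof. by move=> Xn Yn Q Q0 QD Qp; apply: (QD); [apply: Xn|apply: Yn]. Qed.

Lemma tdegG0 n : tdegG n 0.
Proof. by move=> Q. Qed.

Lemma tdegGM n m X Y : tdegG n X -> tdegG m Y -> tdegG (n + m) (X * Y).
Proof.
move=> Xn Ym; apply: (Xn (fun X => tdegG (n + m) (X * Y))) => [|X1 X2 h1 h2|x a xn].
    by rewrite mul0r; apply: tdegG0.
  by rewrite mulrDl; apply: tdegGD.
apply: (Ym (fun Y => tdegG (n + m) (_ * Y))) => [|Y1 Y2 h1 h2|y b yn].
    by rewrite mulr0; apply: tdegG0.
  by rewrite mulrDr; apply: tdegGD.
by rewrite tensM; apply: tdegG_pure; apply: tdegM.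
Qed.

Lemma tdegG_tmap (U : lmodType C) n (f : U -> T) (a : tens U G) :
  linear f -> (forall u, tdeg n (f u)) -> tdegG n (tmap f id a).
Proof.
move=> fl fn; elim/tens_ind: a => [|a b ha hb|u c].
- have -> : tmap f id (0 : tens U G) = 0 by exact: tmap_id0.
  exact: tdegG0.
- by rewrite tmap_idD //; apply: tdegGD.
- by rewrite tmap_id_pure //; apply: tdegG_pure.
Qed.

Lemma tcoact_tdeg n x : tdeg n x -> tdegG n (tcoact T x).
Proof.
have lS : linear (taS T) by exact: linearP.
have lV : linear (taV T) by exact: linearP.
have cS q : tdegG 0 (tcoact T (taS T q)).
  by rewrite tcoact_S; apply: tdegG_tmap => // p; apply: tdeg_S.
have cw w : tdegG (size w) (tcoact T (ta_word T w)).
  elim: w => [|i w ih]; first by rewrite word_nil -(rmorph1 (taS T)); apply: cS.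
  rewrite word_cons rmorphM /= -add1n; apply: tdegGM => //.
  by rewrite tcoact_V; apply: tdegG_tmap => // v; apply: tdeg_V.
move: x; apply: tdeg_ind => [x y hx hy||q u].
- by rewrite raddfD; apply: tdegGD.
- by rewrite raddf0; apply: tdegG0.
- by rewrite rmorphM; have := tdegGM (cS q) (cw u); rewrite size_tuple add0n.
Qed.

Lemma tcoact_VV z : tcoact T (taVV T z) = tVVG (coact2 z).
Proof.
have lVV := taVV_linear; move: z; apply: tens_linear_eq => [a b|a b|x y].
- by rewrite (linear_predD lVV) raddfD.
- by rewrite coact2D /tVVG tmap_idD.
rewrite taVV_pure rmorphM /= !tcoact_V coact2_pure /tVVG.
have lV : linear (taV T) by exact: linearP.
rewrite (tens_seqE (coact V x)) (tens_seqE (coact V y)).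
rewrite tlift_sumE; last exact: coact2_middle.
rewrite !tmap_id_sum // mulr_suml; apply: eq_bigr => p _.
rewrite tlift_sumE; last exact: coact2_inner.
rewrite tmap_id_sum // mulr_sumr; apply: eq_bigr => p' _.
by rewrite !tmap_id_pure // tensM taVV_pure.
Qed.

(** The locality of [sigmaTP], transported to tensors with a G-leg: it is applied after the three
    factors have been coacted upon. *)
Lemma sigmaT_tmapG i X z Y : tdegG i X ->
  tmap (sigmaT E i) id (X * tVVG z * Y) = X * tVVG (tmap (sigma M) id z) * Y.
Proof.
have ls : linear (sigmaT E i) by exact: linearP.
have lVV := taVV_linear; have lsM : linear (sigma M) by exact: linearP.
have t0 : tmap (sigmaT E i) id (0 : TG) = 0 by exact: tmap_id0.
move=> Xi; apply: (Xi (fun X =>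
  tmap (sigmaT E i) id (X * tVVG z * Y) = X * tVVG (tmap (sigma M) id z) * Y)) => [|X1 X2 h1 h2|x a xi]; first by rewrite !mul0r t0.
  by rewrite !mulrDl tmap_idD // h1 h2.
elim/tens_ind: Y => [|Y1 Y2 h1 h2|y b]; first by rewrite !mulr0 t0.
  by rewrite !mulrDr tmap_idD // h1 h2.
move: z; apply: tens_linear_eq => [u v|u v|z c].
- by rewrite /tVVG tmap_idD // !(mulrDr, mulrDl) tmap_idD.
- by rewrite /tVVG tmap_idD // tmap_idD // !(mulrDr, mulrDl).
by rewrite /tVVG !tmap_id_pure // !tensM tmap_id_pure // sigmaTP // -[in RHS]tmap_id_pure // tmap_id_pure.
Qed.

Lemma tcoact_sigmaT n i x : (i.+1 < n)%N -> tdeg n x ->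
  tcoact T (sigmaT E i x) = tmap (sigmaT E i) id (tcoact T x).
Proof.
have ls : linear (sigmaT E i) by exact: linearP.
move=> lin; move: x; apply: (tdeg_local_ind lin) => [x y hx hy||u z v ui vn].
- by rewrite !raddfD /= tmap_idD // hx hy.
- by rewrite !raddf0 tmap_id0.
rewrite sigmaTP // !rmorphM /= !tcoact_VV sigma_coact sigmaT_tmapG //.
exact: tcoact_tdeg.
Qed.

Lemma tcoact_sigma_word n s x : all (fun i => i.+1 < n)%N s -> tdeg n x ->
  tcoact T (sigma_word s x) = tmap (sigma_word (E := E) s) id (tcoact T x).
Proof.
move=> + xn; elim: s => [_|i s ih /= /andP[li ls]] /=.
  rewrite [RHS](@tens_linear_eq _ _ _ _ _ id) => [//|a b|//|u v].
    by rewrite tmap_idD // => k ? ?.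
  by rewrite tmap_id_pure // => k ? ?.
rewrite (tcoact_sigmaT li); last exact: sigma_word_tdeg.
rewrite ih // tmap_id_comp //; first exact: sigma_word_linear.
exact: linearP.
Qed.

Lemma tcoact_asym x : tcoact T (asym E x) = tmap (asym E) id (tcoact T x).
Proof.
have la : linear (asym E) by exact: linearP.
have t0 : tmap (asym E) id (0 : TG) = 0 by exact: tmap_id0.
move: x; apply: ta_ind => [x y hx hy||n x xn].
- by rewrite !raddfD /= tmap_idD // hx hy.
- by rewrite !raddf0 t0.
have [s sn asE] := asym_wordE E n.
rewrite asE // raddf_sum /=.
transitivity (\sum_p (-1) ^+ perm_len p *: tmap (sigma_word (E := E) (s p)) id (tcoact T x)).
  by apply: eq_bigr => p _; rewrite linearZ /= (tcoact_sigma_word (sn p)).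
have sl p := sigma_word_linear (E := E) (s p).
(* The expansion over words is valid only in degree n, so it is applied to the T-legs of the
   coaction, all of which have degree n. *)
have := tcoact_tdeg xn; set X := tcoact T x => Xn.
apply: (Xn (fun X => \sum_p (-1) ^+ perm_len p *:
  tmap (sigma_word (E := E) (s p)) id X = tmap (asym E) id X)) => [|X1 X2 h1 h2|y a yn].
- by rewrite t0 big1 // => p _; rewrite tmap_id0 // scaler0.
- rewrite tmap_idD // -h1 -h2 -big_split; apply: eq_bigr => p _ /=.
  by rewrite tmap_idD // scalerDr.
- rewrite tmap_id_pure // asE // tpure_suml; apply: eq_bigr => p _.
  by rewrite tmap_id_pure // tpureZ.
Qed.

(** Compatibility is given on Sigma and on V; both sides are antimultiplicative, so it propagates to
    words. *)
Lemma tcoact_star x : tcoact T (star x) = tstar (tcoact T x).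
Proof.
have t0 : tstar (0 : TG) = 0 by exact: tstar0.
have lS : linear (taS T) by exact: linearP.
have lV : linear (taV T) by exact: linearP.
have cS q : tcoact T (star (taS T q)) = tstar (tcoact T (taS T q)).
  rewrite -taS_star !tcoact_S scoact_star.
  elim/tens_ind: (scoact M q) => [|a b ha hb|p a].
  - have s0 : tstar (0 : tens (Sig M) G) = 0 by exact: tstar0.
    have m0 : tmap (taS T) id (0 : tens (Sig M) G) = 0 by exact: tmap_id0.
    by rewrite s0 m0 t0.
  - by rewrite tstarD !tmap_idD // tstarD ha hb.
  - by rewrite tstar_pure !tmap_id_pure // tstar_pure taS_star.
have cV (v : V) : tcoact T (star (taV T v)) = tstar (tcoact T (taV T v)).
  rewrite -taV_star !tcoact_V coact_star.
  have bs : balanced (fun (x : V) (c : G) => cstar x ⊗ star c).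
    split=> [? ? ?|? ? ?|k ? ?]; rewrite ?cstarD ?starD ?tpureDl ?tpureDr //.
    by rewrite cstarZ starZ tpureZ tpureZr.
  elim/tens_ind: (coact V v) => [|a b ha hb|p a].
  - have m0 : tmap (taV T) id (0 : tens V G) = 0 by exact: tmap_id0.
    by rewrite {2}/tmap tlift0 // m0 t0.
  - by rewrite {2}/tmap tliftD // !tmap_idD // tstarD -ha -hb.
  - by rewrite {2}/tmap tlift_pure // !tmap_id_pure // tstar_pure taV_star.
move: x; apply: ta_ind => [x y hx hy||n].
- by rewrite starD !raddfD /= tstarD hx hy.
- by rewrite star0 raddf0 t0.
apply: tdeg_ind => [x y hx hy||q u].
- by rewrite starD !raddfD /= tstarD hx hy.
- by rewrite star0 raddf0 t0.
rewrite starM !rmorphM tstarM /= cS; congr (_ * _).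
elim: (tval u) => [|i w ih].
  by rewrite word_nil star1; have := cS 1; rewrite -taS_star star1 rmorph1.
by rewrite word_cons starM !rmorphM tstarM /= cV ih.
Qed.

Definition tmetG X Y : tens (Sig M) G :=
  tlift (fun x a => tlift (fun y b => tm x y ⊗ (a * b)) Y) X.

Lemma tmetG_bal x a : balanced (fun y (b : G) => tm x y ⊗ (a * b)).
Proof.
split=> [? ? ?|? ? ?|k ? ?].
- by rewrite tmetDr tpureDl.
- by rewrite mulrDr tpureDr.
- by rewrite tmetZr -scalerAr tpureZ tpureZr.
Qed.

Lemma tmetG_bal2 Y : balanced (fun x (a : G) => tlift (fun y b => tm x y ⊗ (a * b)) Y).
Proof.
apply: balanced_tlift => y b; split=> [? ? ?|? ? ?|k ? ?].
- by rewrite tmetDl tpureDl.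
- by rewrite mulrDl tpureDr.
- by rewrite tmetZl -scalerAl tpureZ tpureZr.
Qed.

Lemma tmetGDl X X' Y : tmetG (X + X') Y = tmetG X Y + tmetG X' Y.
Proof. by rewrite /tmetG tliftD //; apply: tmetG_bal2. Qed.

Lemma tmetGDr X Y Y' : tmetG X (Y + Y') = tmetG X Y + tmetG X Y'.
Proof.
by rewrite /tmetG -tlift_addf; apply: eq_tlift => x a; rewrite tliftD //; apply: tmetG_bal.
Qed.

Lemma tmetG0l Y : tmetG 0 Y = 0.
Proof. by apply: (addrI (tmetG 0 Y)); rewrite -tmetGDl !addr0. Qed.

Lemma tmetG0r X : tmetG X 0 = 0.
Proof. by apply: (addrI (tmetG X 0)); rewrite -tmetGDr !addr0. Qed.

Lemma tmetG_suml I (r : seq I) (F : I -> TG) Y :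
  tmetG (\sum_(i <- r) F i) Y = \sum_(i <- r) tmetG (F i) Y.
Proof. by apply: (big_morph (tmetG^~ Y)) => [a b|]; [exact: tmetGDl|exact: tmetG0l]. Qed.

Lemma tmetG_sumr I (r : seq I) (F : I -> TG) X :
  tmetG X (\sum_(i <- r) F i) = \sum_(i <- r) tmetG X (F i).
Proof. by apply: (big_morph (tmetG X)) => [a b|]; [exact: tmetGDr|exact: tmetG0r]. Qed.

Lemma tmetG_pure x a y b : tmetG (x ⊗ a) (y ⊗ b) = tm x y ⊗ (a * b).
Proof. by rewrite /tmetG !tlift_pure //; [exact: tmetG_bal|exact: tmetG_bal2]. Qed.

Lemma tmetG_deg n m X Y : tdegG n X -> tdegG m Y -> n <> m -> tmetG X Y = 0.
Proof.
move=> Xn Ym nm; apply: (Xn (fun X => tmetG X Y = 0)) => [|X1 X2 h1 h2|x a xn]; first exact: tmetG0l.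
  by rewrite tmetGDl h1 h2 addr0.
apply: (Ym (fun Y => tmetG _ Y = 0)) => [|Y1 Y2 h1 h2|y b ym]; first exact: tmetG0r.
  by rewrite tmetGDr h1 h2 addr0.
by rewrite tmetG_pure (tmet_deg xn ym nm) tpure0l.
Qed.

(** Covariance of g on V, [scoact_met], is what lets the contraction rule [tmet_rec] survive the
    coaction. *)
Lemma tmetG_rec X (v w : V) Y :
  tmetG (X * tcoact T (taV T v)) (tcoact T (taV T w) * Y) =
  tmetG X (tcoact T (taS T (met M (v ⊗ w))) * Y).
Proof.
have lS : linear (taS T) by exact: linearP.
have lV : linear (taV T) by exact: linearP.
have lm : linear (met M) by exact: linearP.
elim/tens_ind: X => [|X1 X2 h1 h2|x a]; first by rewrite mul0r !tmetG0l.
  by rewrite mulrDl !tmetGDl h1 h2.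
elim/tens_ind: Y => [|Y1 Y2 h1 h2|y b]; first by rewrite !mulr0 !tmetG0r.
  by rewrite !mulrDr !tmetGDr h1 h2.
rewrite !tcoact_V tcoact_S scoact_met coact2_pure.
rewrite (tens_seqE (coact V v)) (tens_seqE (coact V w)).
rewrite [X in tmap (met M) id X]tlift_sumE; last exact: coact2_middle.
rewrite (tmap_id_sum _ _ lm) !(tmap_id_sum _ _ lS) !(tmap_id_sum _ _ lV) [in LHS]mulr_sumr tmetG_suml [in RHS]mulr_suml [RHS]tmetG_sumr.
apply: eq_bigr => p _.
rewrite [X in tmap (met M) id X]tlift_sumE; last exact: coact2_inner.
rewrite (tmap_id_sum _ _ lm) (tmap_id_sum _ _ lS) !mulr_suml !tmetG_sumr.
apply: eq_bigr => p' _.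
by rewrite !tmap_id_pure // !tensM !tmetG_pure tmet_rec !mulrA.
Qed.

Lemma tmetG_coact x y : tmetG (tcoact T x) (tcoact T y) = scoact M (tm x y).
Proof.
have lS : linear (taS T) by exact: linearP.
move: x; apply: ta_ind => [x x' hx hx'||n x xn].
- by rewrite raddfD tmetGDl hx hx' tmetDl raddfD.
- by rewrite raddf0 tmetG0l tmet0l raddf0.
move: y; apply: ta_ind => [y y' hy hy'||m y ym].
- by rewrite raddfD tmetGDr hy hy' tmetDr raddfD.
- by rewrite raddf0 tmetG0r tmet0r raddf0.
have [nm|/eqP nm] := eqVneq n m; last first.
  rewrite (tmet_deg xn ym nm) raddf0.
  exact: (tmetG_deg (tcoact_tdeg xn) (tcoact_tdeg ym) nm).
rewrite -{}nm in ym; elim: n x y xn ym => [|n ih] x y xn yn.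
  have [[p ->] [q ->]] := (tdeg0P xn, tdeg0P yn); rewrite tmet_SS !tcoact_S rmorphM /=.
  elim/tens_ind: (scoact M p) => [|X1 X2 h1 h2|p' a].
  - have -> : tmap (taS T) id (0 : tens (Sig M) G) = 0 by exact: tmap_id0.
    by rewrite tmetG0l mul0r.
  - by rewrite tmap_idD // tmetGDl h1 h2 mulrDl.
  elim/tens_ind: (scoact M q) => [|X1 X2 h1 h2|q' b].
  - have -> : tmap (taS T) id (0 : tens (Sig M) G) = 0 by exact: tmap_id0.
    by rewrite tmetG0r mulr0.
  - by rewrite tmap_idD // tmetGDr h1 h2 mulrDr.
  - by rewrite !tmap_id_pure // tmetG_pure tmet_SS tensM.
(* The metric contracts the last letter of x with the first letter of y, hence the two different
   expansions. *)
have [F Fn ->] := tdegS_r xn; have [F' Fn' ->] := tdegS_l yn.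
rewrite !raddf_sum tmetG_suml tmet_suml raddf_sum; apply: eq_bigr => i _.
rewrite tmetG_sumr tmet_sumr raddf_sum; apply: eq_bigr => j _ /=.
rewrite tmet_rec -ih //; last exact: tdeg_Sl.
by rewrite !rmorphM /= tmetG_rec.
Qed.

(** Lifted to tensors, the coaction passes through the involution, which stars the first G-leg, and
    through the antisymmetrizer; covariance of g does the rest. *)
Lemma wedge_dot_coact (th et : W) :
  tlift (fun (t : W) (c : G) =>
    tlift (fun (e : W) (d : G) => wedge_dot t e ⊗ (star c * d)) (wcoact E et)) (wcoact E th) =
  scoact M (wedge_dot th et).
Proof.
have [[x ->] [y ->]] := (ext_pi_surj th, ext_pi_surj et).
rewrite wedge_dot_pi /asym_dot -tmetG_coact tcoact_star tcoact_asym !wcoact_pi.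
have b1 (t : W) (c : G) : balanced (fun (e : W) (d : G) => wedge_dot t e ⊗ (star c * d)).
  split=> [? ? ?|? ? ?|k ? ?].
  - by rewrite wedge_dotDr tpureDl.
  - by rewrite mulrDr tpureDr.
  - by rewrite wedge_dotZr -scalerAr tpureZ tpureZr.
rewrite tlift_tmap; last first.
  apply: balanced_tlift => y' d; split=> [? ? ?|? ? ?|k ? ?].
  - by rewrite wedge_dotDl tpureDl.
  - by rewrite starD mulrDl tpureDr.
  - by rewrite wedge_dotZl starZ -scalerAl tpureZ tpureZr.
rewrite /tmetG tlift_tstar; last exact: tmetG_bal2.
apply: eq_tlift => x' c; rewrite tlift_tmap // tlift_tmap; last exact: tmetG_bal.
by apply: eq_tlift => y' d; rewrite wedge_dot_pi.
Qed.

End Coaction.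

(** * The scalar product of horizontal forms *)

Section TotalState.
Variables (R : realType) (G : cmqg (cplx R)) (P : qpb G).
Local Notation C := (cplx R).
Local Notation S := (antipode G).
Implicit Types b d : P.

Lemma total_stateD b d : total_state (b + d) = total_state b + total_state d.
Proof. exact: (linear_predD (@total_state_linear _ _ _)). Qed.

Lemma total_state_ge0 b : 0 <= total_state (star b * b) :> C.
Proof. by rewrite /total_state; have [y ->] := fiber_int_ge0 b; apply: fs_ge0. Qed.

(** The fibre integral of b^* b becomes y^* y in the C*-algebra, so faithfulness of the state gives
    y = 0 and strict positivity of the integral gives b = 0. *)
Lemma total_state_eq0 b : total_state (star b * b) = 0 -> b = 0.
Proof.
rewrite /total_state; have [y yE] := fiber_int_ge0 b; rewrite yE => /fs_eq0 y0.
apply: fiber_int_eq0; apply: (@base_emb_inj R G P).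
by rewrite yE y0 mulr0 raddf0.
Qed.

Lemma total_state_gt0 b : b != 0 -> 0 < total_state (star b * b) :> C.
Proof.
move=> b0; rewrite lt0r total_state_ge0 andbT.
by apply: contra b0 => /eqP /total_state_eq0 ->.
Qed.

Lemma total_state_herm b d : total_state (star d * b) = (total_state (star b * d))^* :> C.
Proof.
apply: (positive_form_herm (s := fun b d : P => total_state (star b * d) : C)) => [c x y z|c x y z|x].
- by rewrite mulrDr -scalerAr total_stateD total_stateZ.
- by rewrite starD starZ mulrDl -scalerAl total_stateD total_stateZ.
- exact: total_state_ge0.
Qed.

Lemma total_state_inv2 b d :
  tlift (fun b0 c => tlift (fun d0 e => (total_state (star b0 * d0) : C) *: (star c * e))
    (bcoact P d)) (bcoact P b) = (total_state (star b * d) : C) *: 1.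
Proof.
rewrite -total_state_inv rmorphM /= bcoact_star.
have sb : balanced (fun (b0 : P) (c : G) => (total_state b0 : C) *: c).
  split=> [? ? ?|? ? ?|k ? ?]; first by rewrite total_stateD scalerDl.
    by rewrite scalerDr.
  by rewrite total_stateZ scalerA mulrC.
rewrite tlift_tensM // tlift_tstar //; apply: balanced_tlift => d0 e.
split=> [? ? ?|? ? ?|k ? ?]; first by rewrite mulrDl total_stateD scalerDl.
  by rewrite mulrDl scalerDr.
by rewrite -!scalerAl total_stateZ scalerA mulrC.
Qed.

(* Invariance of the state: [w(b_0^* d) S(b_1)^* = w(b^* d_0) d_1]. *)
Lemma total_state_antipode b d :
  tlift (fun b0 c => (total_state (star b0 * d) : C) *: star (S c)) (bcoact P b) =
  tlift (fun d0 c => (total_state (star b * d0) : C) *: c) (bcoact P d).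
Proof.
(* The sum of w(b_0^* d_0) S(b_2)^* b_1^* d_1 is evaluated in two ways: invariance of the state
   removes b_1^* d_1, and the antipode axiom removes b_1 S(b_2). *)
pose f b0 (c1 c2 : G) := tlift (fun d0 e =>
  (total_state (star b0 * d0) : C) *: (star (S c2) * (star c1 * e))) (bcoact P d).
transitivity (tlift (fun b0 c => tlift (f b0) (cop G c)) (bcoact P b)).
  rewrite (coassocE (bcoact_assoc b)).
  - apply: eq_tlift => b0 c2.
    have -> : tlift (fun x c1 => f x c1 c2) (bcoact P b0) = star (S c2) *
        tlift (fun b0 c => tlift (fun d0 e =>
          (total_state (star b0 * d0) : C) *: (star c * e)) (bcoact P d)) (bcoact P b0).
      rewrite (raddf_tlift (L := fun z => star (S c2) * z)); last exact: mulrDr.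
      apply: eq_tlift => x c1.
      rewrite (raddf_tlift (L := fun z => star (S c2) * z)); last exact: mulrDr.
      by apply: eq_tlift => y e; rewrite scalerAr.
    by rewrite total_state_inv2 -scalerAr mulr1.
  - move=> c2; apply: balanced_tlift => d0 e; split=> [? ? ?|? ? ?|k ? ?].
    + by rewrite starD mulrDl total_stateD scalerDl.
    + by rewrite starD mulrDl mulrDr scalerDr.
    + rewrite !starZ -!scalerAl total_stateZ -scalerAr.
      by rewrite scalerA mulrC.
  - move=> b0; apply: balanced_tlift => d0 e; split=> [? ? ?|? ? ?|k ? ?].
    + by rewrite starD mulrDl mulrDr scalerDr.
    + by rewrite raddfD starD mulrDl scalerDr.
    + by rewrite linearZ !starZ -!scalerAl -scalerAr.
pose N b0 := tlift (fun d0 e => (total_state (star b0 * d0) : C) *: e) (bcoact P d).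
have ND : {morph N : x y / x + y}.
  move=> x y; rewrite /N -tlift_addf; apply: eq_tlift => d0 e.
  by rewrite starD mulrDl total_stateD scalerDl.
have NZ k x : N (k *: x) = k^* *: N x.
  rewrite [RHS](raddf_tlift (L := fun z : G => k^* *: z)); last exact: scalerDr.
  by apply: eq_tlift => d0 e; rewrite starZ -scalerAl total_stateZ scalerA.
(* [N] is antilinear, so expanding b by the counit axiom produces conjugated counits, as the star of
   b_1 S(b_2) does. *)
rewrite -[RHS]/(N b) -{2}(bcoact_counit b) (raddf_tlift _ _ ND); apply: eq_tlift => b0 c.
rewrite NZ -counit_star.
transitivity (tlift (fun c1 c2 => star (S c2) * star c1 * N b0) (cop G c)).
  apply: eq_tlift => c1 c2.
  rewrite (raddf_tlift (L := fun z => _ * z)); last exact: mulrDr.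
  by apply: eq_tlift => d0 e; rewrite -scalerAr mulrA.
rewrite -(raddf_tlift (L := fun z => z * N b0)); last by move=> ? ?; rewrite mulrDl.
have -> : tlift (fun c1 c2 => star (S c2) * star c1) (cop G c) =
    tlift (fun c1 c2 => star (c1 * S c2)) (cop G c).
  by apply: eq_tlift => c1 c2; rewrite starM.
rewrite -(raddf_tlift (L := @star _ _)); last exact: starD.
by rewrite antipoder starZ star1 -scalerAl mul1r counit_star.
Qed.

End TotalState.

Section ScalarProduct.
Variables (R : realType) (G : cmqg (cplx R)) (P : qpb G) (V : coord_space G).
Variables (M : quantum_metric V) (E : exterior_algebra M).
Local Notation C := (cplx R).
Local Notation W := (ext E).
Local Notation hor := (tens P W).
Local Notation real := (Sig_real M).
Implicit Types (x y z : hor) (q : Sig M).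

Lemma hor_dot0l y : hor_dot 0 y = 0.
Proof. by apply: (addrI (hor_dot 0 y)); rewrite -hor_dotDl !addr0. Qed.

Lemma hor_dot0r x : hor_dot x 0 = 0.
Proof. by apply: (addrI (hor_dot x 0)); rewrite -hor_dotDr !addr0. Qed.

Lemma hor_mul0l y : hor_mul 0 y = 0 :> hor.
Proof. by apply: (addrI (hor_mul 0 y)); rewrite -hor_mulDl !addr0. Qed.

Lemma hor_mul0r x : hor_mul x 0 = 0 :> hor.
Proof. by apply: (addrI (hor_mul x 0)); rewrite -hor_mulDr !addr0. Qed.

Lemma hor_dotZl k x y : hor_dot (k *: x) y = k^* *: hor_dot x y.
Proof.
elim/tens_ind: x => [|x x' h h'|b th]; first by rewrite scaler0 hor_dot0l scaler0.
  by rewrite scalerDr !hor_dotDl h h' scalerDr.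
elim/tens_ind: y => [|y y' h h'|d et]; first by rewrite !hor_dot0r scaler0.
  by rewrite !hor_dotDr h h' scalerDr.
by rewrite -tpureZr !hor_dot_pure wedge_dotZl !scalerA mulrC.
Qed.

Lemma hor_dotZr k x y : hor_dot x (k *: y) = k *: hor_dot x y.
Proof.
elim/tens_ind: x => [|x x' h h'|b th]; first by rewrite !hor_dot0l scaler0.
  by rewrite !hor_dotDl h h' scalerDr.
elim/tens_ind: y => [|y y' h h'|d et]; first by rewrite scaler0 !hor_dot0r scaler0.
  by rewrite scalerDr !hor_dotDr h h' scalerDr.
by rewrite -tpureZr !hor_dot_pure wedge_dotZr !scalerA mulrC.
Qed.

Lemma hor_dot_star x y : star (hor_dot x y) = hor_dot y x.
Proof.
elim/tens_ind: x => [|x x' h h'|b th]; first by rewrite hor_dot0l hor_dot0r star0.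
  by rewrite hor_dotDl hor_dotDr starD h h'.
elim/tens_ind: y => [|y y' h h'|d et]; first by rewrite hor_dot0l hor_dot0r star0.
  by rewrite hor_dotDl hor_dotDr starD h h'.
by rewrite !hor_dot_pure starZ wedge_dot_star -total_state_herm.
Qed.

Lemma hor_mul_Sr (b : P) (th : W) q :
  hor_mul (b ⊗ th) (hor_S P E q) = b ⊗ (th * extS E q).
Proof.
rewrite /hor_S hor_mul_pure rmorph1 tens1 tlift_pure ?mulr1 ?wcirc1 //.
split=> [? ? ?|? ? ?|k ? ?]; first by rewrite mulrDr tpureDl.
  by rewrite wcircDr mulrDl tpureDr.
by rewrite wcircZr -scalerAl -scalerAr tpureZ tpureZr.
Qed.

Lemma wcirc_S q (a : G) : wcirc (extS E q) a = extS E (scirc q a).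
Proof. by rewrite /extS wcirc_pi tcirc_S. Qed.

Lemma hor_mul_Sl (b : P) (th : W) q :
  hor_mul (hor_S P E q) (b ⊗ th) =
  tlift (fun b0 c => b0 ⊗ (extS E (scirc q c) * th)) (bcoact P b).
Proof.
by rewrite /hor_S hor_mul_pure; apply: eq_tlift => b0 c; rewrite mul1r wcirc_S.
Qed.

Lemma hor_dot_mulr x y q : hor_dot x (hor_mul y (hor_S P E q)) = hor_dot x y * q.
Proof.
elim/tens_ind: x => [|x x' h h'|b th]; first by rewrite !hor_dot0l mul0r.
  by rewrite !hor_dotDl h h' mulrDl.
elim/tens_ind: y => [|y y' h h'|d et]; first by rewrite hor_mul0l !hor_dot0r mul0r.
  by rewrite hor_mulDl !hor_dotDr h h' mulrDl.
by rewrite hor_mul_Sr !hor_dot_pure wedge_dotSr scalerAl.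
Qed.

Lemma hor_dot_adj x y q :
  hor_dot (hor_mul (hor_S P E q) x) y = hor_dot x (hor_mul (hor_S P E (star q)) y).
Proof.
elim/tens_ind: x => [|x x' h h'|b th]; first by rewrite hor_mul0r !hor_dot0l.
  by rewrite hor_mulDr !hor_dotDl h h'.
elim/tens_ind: y => [|y y' h h'|d et]; first by rewrite hor_mul0r !hor_dot0r.
  by rewrite hor_mulDr !hor_dotDr h h'.
(* Both sides are values of [L]: at the two expressions that [total_state_antipode] identifies. *)
pose L (a : G) := wedge_dot th (extS E (scirc (star q) a) * et).
have LD : {morph L : a c / a + c}.
  by move=> a c; rewrite /L scircDr /extS !raddfD mulrDl wedge_dotDr.
have LZ k a : L (k *: a) = k *: L a.
  by rewrite /L scircZr /extS !linearZ /= -scalerAl wedge_dotZr.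
rewrite !hor_mul_Sl.
transitivity (L (tlift (fun b0 c => (total_state (star b0 * d) : C) *: star (antipode G c))
    (bcoact P b))).
  rewrite (raddf_tlift (L := fun z : hor => hor_dot z _)); last by move=> ? ?; apply: hor_dotDl.
  rewrite (raddf_tlift _ _ LD); apply: eq_tlift => b0 c.
  by rewrite hor_dot_pure wedge_dot_adj LZ scirc_star.
rewrite total_state_antipode (raddf_tlift _ _ LD).
rewrite (raddf_tlift (L := fun z : hor => hor_dot _ z)); last by move=> ? ?; apply: hor_dotDr.
by apply: eq_tlift => d0 c; rewrite LZ hor_dot_pure.
Qed.

(** Orthogonality is recorded in one order only, the other following from [total_state_herm]; strict
    positivity allows division by the norms. *)
Definition orthogonal_seq (s : seq P) :=
  pairwise (fun b d => total_state (star b * d) == 0 :> C) s &&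
  all (fun b => 0 < total_state (star b * b) :> C) s.

(** A Gram-Schmidt step inside the tensor product: b ⊗ w = (b - k p) ⊗ w + p ⊗ (k w), so the
    correction of [b] is paid by the right legs and the orthogonal left legs stay as they are. *)
Lemma orthogonalize (s : seq (P * W)) (b : P) (w : W) :
  orthogonal_seq [seq p.1 | p <- s] ->
  exists s' b', [/\ [seq p.1 | p <- s'] = [seq p.1 | p <- s],
    \sum_(p <- s) p.1 ⊗ p.2 + b ⊗ w = \sum_(p <- s') p.1 ⊗ p.2 + b' ⊗ w &
    forall p, p \in s -> total_state (star p.1 * b') = 0 :> C].
Proof.
elim: s => [|p s ih]; first by exists [::], b.
rewrite /orthogonal_seq /= => /andP[/andP[ps os] /andP[p0 ns]].
have [|s' [b' [s1 s2 s3]]] := ih; first exact/andP.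
pose k : C := total_state (star p.1 * b') / total_state (star p.1 * p.1).
exists ((p.1, p.2 + k *: w) :: s'), (b' - k *: p.1); split; first by rewrite /= s1.
  rewrite !big_cons /= -addrA s2 tpureDr tpureZr tpureDl -scaleNr tpureZ scaleNr.
  by rewrite -!addrA; congr (_ + _); rewrite [RHS]addrC -!addrA addNr addr0.
move=> r; rewrite inE mulrDr mulrN -scalerAr -scaleNr total_stateD total_stateZ.
move=> /orP[/eqP ->|rs]; first by rewrite /k mulNr divfK ?gt_eqF // subrr.
have /allP /(_ r.1) := ps; rewrite map_f // => /(_ isT) /eqP pr0.
by rewrite s3 // total_state_herm pr0 conjC0 mulr0 addr0.
Qed.

Lemma orthogonal_representation x : exists2 s : seq (P * W),
  orthogonal_seq [seq p.1 | p <- s] & x = \sum_(p <- s) p.1 ⊗ p.2.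
Proof.
rewrite (tens_seqE x); elim: (tseq x) => [|[b w] t [s os sE]].
  by exists [::]; rewrite ?big_nil.
rewrite big_cons sE addrC /=.
have [s' [b' [s1 -> s3]]] := orthogonalize b w os.
(* A vanishing remainder contributes nothing and is dropped, since all left legs must have positive
   norm. *)
have [->|b0] := eqVneq b' 0.
  exists s'; first by rewrite s1.
  by rewrite tpure0l addr0.
exists ((b', w) :: s'); last by rewrite big_cons addrC.
move: os; rewrite /orthogonal_seq /= s1 => /andP[-> ->]; rewrite total_state_gt0 // !andbT.
apply/allP => _ /mapP[p ps ->].
by rewrite total_state_herm s3 // conjC0.
Qed.

Lemma hor_dot_orthogonal (s : seq (P * W)) : orthogonal_seq [seq p.1 | p <- s] ->
  hor_dot (\sum_(p <- s) p.1 ⊗ p.2) (\sum_(p <- s) p.1 ⊗ p.2) =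
  \sum_(p <- s) total_state (star p.1 * p.1) *: wedge_dot p.2 p.2.
Proof.
elim: s => [|p s ih]; first by rewrite !big_nil hor_dot0l.
rewrite /orthogonal_seq /= => /andP[/andP[ps os] /andP[_ ns]].
have ort : hor_dot (p.1 ⊗ p.2) (\sum_(r <- s) r.1 ⊗ r.2) = 0.
  rewrite (big_morph (hor_dot (p.1 ⊗ p.2)) (hor_dotDr _) (hor_dot0r _)).
  rewrite big_seq big1 // => r rs; rewrite hor_dot_pure.
  by have /allP /(_ r.1) := ps; rewrite map_f // => /(_ isT) /eqP ->; rewrite scale0r.
rewrite !big_cons hor_dotDl !hor_dotDr ort addr0 hor_dot_pure.
by rewrite -[X in _ + (X + _)]hor_dot_star ort star0 add0r ih //; apply/andP.
Qed.

Lemma hor_dot_ge0 x : op_ge0 real (hor_dot x x).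
Proof.
have [s os ->] := orthogonal_representation x; rewrite hor_dot_orthogonal //.
elim: s {os} => [|p s ih]; first by rewrite big_nil; apply: op_ge00.
rewrite big_cons; apply: op_ge0P => //; first exact: total_state_ge0.
exact: wedge_dot_ge0.
Qed.

Lemma hor_dot_eq0 x : hor_dot x x = 0 -> x = 0.
Proof.
have [s os ->] := orthogonal_representation x; rewrite hor_dot_orthogonal //.
have {os} /andP[_] := os; elim: s => [|p s ih] /=; first by rewrite !big_nil.
move=> /andP[p0 ns]; rewrite !big_cons => pq.
have sum_ge0 : op_ge0 real (\sum_(r <- s) total_state (star r.1 * r.1) *: wedge_dot r.2 r.2).
  elim: s {ih ns pq} => [|r s ih]; first by rewrite big_nil; apply: op_ge00.
  rewrite big_cons; apply: op_ge0P => //; first exact: total_state_ge0.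
  exact: wedge_dot_ge0.
(* The weight of the head is strictly positive, so the vanishing of a sum of positive operators
   forces the right leg of the head to be null. *)
have [p20 s0] := op_ge0_addr_eq0 p0 (wedge_dot_ge0 _) sum_ge0 pq.
by rewrite ih // (wedge_dot_eq0 p20) tpure0r addr0.
Qed.

Lemma hor_coactD x y : hor_coact (x + y) = hor_coact x + hor_coact y.
Proof.
rewrite /hor_coact tliftD //.
apply: (balanced_tlift_l (F := bcoact P) (f := fun bk ck th =>
  tlift (fun thl dl => (bk ⊗ thl : hor) ⊗ (ck * dl)) (wcoact E th))); first exact: linearP.
- move=> th; apply: balanced_tlift => thl dl; split=> [? ? ?|? ? ?|k ? ?].
  + by rewrite !tpureDl.
  + by rewrite mulrDl tpureDr.
  + by rewrite -scalerAl !tpureZ tpureZr.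
- move=> c; apply: (balanced_tlift_r (F := wcoact E)
    (f := fun bk thl dl => (bk ⊗ thl : hor) ⊗ (c * dl))); first exact: linearP.
  + move=> b; split=> [? ? ?|? ? ?|k ? ?].
    * by rewrite tpureDr tpureDl.
    * by rewrite mulrDr tpureDr.
    * by rewrite -scalerAr tpureZr tpureZ tpureZr.
  + move=> dl; split=> [? ? ?|? ? ?|k ? ?].
    * by rewrite !tpureDl.
    * by rewrite tpureDr tpureDl.
    * by rewrite tpureZ tpureZr.
Qed.

Definition hor_dotG (X Y : tens hor G) : tens (Sig M) G :=
  tlift (fun (x : hor) (c : G) =>
    tlift (fun (y : hor) (d : G) => hor_dot x y ⊗ (star c * d)) Y) X.

Lemma hor_dotG_inner x (c : G) :
  balanced (fun (y : hor) (d : G) => hor_dot x y ⊗ (star c * d)).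
Proof.
split=> [? ? ?|? ? ?|k ? ?].
- by rewrite hor_dotDr tpureDl.
- by rewrite mulrDr tpureDr.
- by rewrite hor_dotZr -scalerAr tpureZ tpureZr.
Qed.

Lemma hor_dotG_outer (Y : tens hor G) : balanced (fun (x : hor) (c : G) =>
  tlift (fun (y : hor) (d : G) => hor_dot x y ⊗ (star c * d)) Y).
Proof.
apply: balanced_tlift => y d; split=> [? ? ?|? ? ?|k ? ?].
- by rewrite hor_dotDl tpureDl.
- by rewrite starD mulrDl tpureDr.
- by rewrite hor_dotZl starZ -scalerAl tpureZ tpureZr.
Qed.

Lemma hor_dotG_sum (s t : seq (hor * G)) :
  hor_dotG (\sum_(k <- s) k.1 ⊗ k.2) (\sum_(l <- t) l.1 ⊗ l.2) =
  \sum_(k <- s) \sum_(l <- t) hor_dot k.1 l.1 ⊗ (star k.2 * l.2).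
Proof.
rewrite /hor_dotG tlift_sumE; last exact: hor_dotG_outer.
by apply: eq_bigr => k _; rewrite tlift_sumE //; apply: hor_dotG_inner.
Qed.

Lemma hor_dotGDl X X' Y : hor_dotG (X + X') Y = hor_dotG X Y + hor_dotG X' Y.
Proof. by rewrite /hor_dotG tliftD //; apply: hor_dotG_outer. Qed.

Lemma hor_dotGDr X Y Y' : hor_dotG X (Y + Y') = hor_dotG X Y + hor_dotG X Y'.
Proof.
rewrite /hor_dotG -tlift_addf; apply: eq_tlift => x c.
by rewrite tliftD //; apply: hor_dotG_inner.
Qed.

Lemma hor_dotG_pure x (c : G) y (d : G) :
  hor_dotG (x ⊗ c) (y ⊗ d) = hor_dot x y ⊗ (star c * d).
Proof.
by rewrite /hor_dotG !tlift_pure //; [exact: hor_dotG_inner|exact: hor_dotG_outer].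
Qed.

Lemma hor_dotG_coact x y : hor_dotG (hor_coact x) (hor_coact y) = scoact M (hor_dot x y).
Proof.
have c0 : hor_coact (0 : hor) = 0.
  by apply: (addrI (hor_coact 0)); rewrite -hor_coactD !addr0.
have d0l Y : hor_dotG 0 Y = 0.
  by apply: (addrI (hor_dotG 0 Y)); rewrite -hor_dotGDl !addr0.
have d0r X : hor_dotG X 0 = 0.
  by apply: (addrI (hor_dotG X 0)); rewrite -hor_dotGDr !addr0.
elim/tens_ind: x => [|x x' h h'|b th]; first by rewrite c0 d0l hor_dot0l raddf0.
  by rewrite hor_coactD hor_dotGDl h h' hor_dotDl raddfD.
elim/tens_ind: y => [|y y' h h'|d et]; first by rewrite c0 d0r hor_dot0r raddf0.
  by rewrite hor_coactD hor_dotGDr h h' hor_dotDr raddfD.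
rewrite !hor_coact_pure hor_dot_pure linearZ /= -wedge_dot_coact.
rewrite (raddf_tlift (L := fun X => hor_dotG X _)); last by move=> ? ?; apply: hor_dotGDl.
(* The four sums run over the coactions of b, th, d, et in this order; the exchanges bring th and et
   outside, as in [wedge_dot_coact], and leave b and d innermost. *)
under eq_tlift => b0 c.
  rewrite (raddf_tlift (L := fun X => hor_dotG X _)); last by move=> ? ?; apply: hor_dotGDl.
  under eq_tlift => t e.
    rewrite (raddf_tlift (L := hor_dotG _)); last by move=> ? ?; apply: hor_dotGDr.
    under eq_tlift => d0 c'.
      rewrite (raddf_tlift (L := hor_dotG _)); last by move=> ? ?; apply: hor_dotGDr.
      under eq_tlift => t' e'.
        rewrite hor_dotG_pure hor_dot_pure tpureZ -tpureZr.
        over.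
      over.
    rewrite exchange_tlift.
    over.
  over.
rewrite exchange_tlift.
rewrite [RHS](raddf_tlift (L := fun z : tens (Sig M) G => total_state _ *: z)); last exact: scalerDr.
apply: eq_tlift => t e.
rewrite exchange_tlift.
rewrite [RHS](raddf_tlift (L := fun z : tens (Sig M) G => total_state _ *: z)); last exact: scalerDr.
apply: eq_tlift => t' e'.
(* The G-leg (c e)^* c' e' equals e^* (c^* c') e', and invariance of the state replaces the middle
   factor, the only one coming from b and d, by 1. *)
pose L (a : G) := wedge_dot t t' ⊗ (star e * (a * e')).
have LD : {morph L : a c / a + c} by move=> a c; rewrite /L mulrDl mulrDr tpureDr.
have LZ k a : L (k *: a) = k *: L a by rewrite /L -scalerAl -scalerAr tpureZr.
transitivity (L (tlift (fun b0 c => tlift (fun d0 e =>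
    (total_state (star b0 * d0) : C) *: (star c * e)) (bcoact P d)) (bcoact P b))).
  rewrite (raddf_tlift _ _ LD); apply: eq_tlift => b0 c.
  rewrite (raddf_tlift _ _ LD); apply: eq_tlift => d0 c'.
  by rewrite LZ /L tpureZr starM !mulrA.
by rewrite total_state_inv2 LZ /L mul1r.
Qed.

Lemma hor_dot_scalar_product : scalar_product (@hor_dot R G P V M E).
Proof.
split.
- exact: hor_dotDl.
- exact: hor_dotDr.
- exact: hor_dot_mulr.
- by move=> x y q; rewrite -hor_dot_star hor_dot_mulr starM hor_dot_star.
- exact: hor_dot_adj.
- exact: hor_dot_star.
- exact: hor_dot_ge0.
- exact: hor_dot_eq0.
Qed.

Lemma hor_dot_covariant : covariant_product (@hor_dot R G P V M E).
Proof. by move=> phi psi s t sE tE; rewrite -hor_dotG_sum -sE -tE hor_dotG_coact. Qed.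

End ScalarProduct.

Theorem lemma2p11 (R : realType) (G : cmqg (cplx R)) (P : qpb G)
    (V : coord_space G) (M : quantum_metric V) (E : exterior_algebra M) :
  [/\ scalar_product (@hor_dot R G P V M E),
      covariant_product (@hor_dot R G P V M E)
    & forall (b q : P) (th et : ext E),
        hor_dot (b ⊗ th) (q ⊗ et) = total_state (star b * q) *: wedge_dot th et].
Proof.
split; [exact: hor_dot_scalar_product|exact: hor_dot_covariant|].
by move=> b q th et; apply: hor_dot_pure.
Qed.
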